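(* Let $k$ be a field of characteristic zero, let $R$ be a finite semi-simple ring, let $\mathcal{A}$ be an essentially small additive category, and let $\phi:\mathcal{A}\to\mathbf{P}_R$ be an additive quotient. Then: (a) for all functors $A_1,A_2:\mathcal{A}\to k\text{-}\mathbf{Mod}$ which both factor through $\phi$, $\mathrm{Ext}^i_{k[\mathcal{A}]}(A_1,A_2)=0$ for all $i>0$; (b) for all functors $A_1:\mathcal{A}^{\mathrm{op}}\to k\text{-}\mathbf{Mod}$ and $A_2:\mathcal{A}\to k\text{-}\mathbf{Mod}$ which both factor through $\phi$, $\mathrm{Tor}_i^{k[\mathcal{A}]}(A_1,A_2)=0$ for all $i>0$.
   Context: $\mathbf{P}_R$ is the category of finitely generated projective right $R$-modules (here all finitely generated modules are projective since $R$ is semi-simple). An additive quotient is a full and essentially surjective additive functor between two additive categories. A contravariant functor $A_1$ on $\mathcal{A}$ factors through $\phi$ if it factors through $\phi^{\mathrm{op}}:\mathcal{A}^{\mathrm{op}}\to\mathbf{P}_R^{\mathrm{op}}$. $\mathrm{Ext}^*_{k[\mathcal{A}]}$ is Ext in the abelian category $k[\mathcal{A}]\text{-}\mathbf{Mod}$ of all functors $\mathcal{A}\to k\text{-}\mathbf{Mod}$. For $F:\mathcal{A}^{\mathrm{op}}\to k\text{-}\mathbf{Mod}$ and $G:\mathcal{A}\to k\text{-}\mathbf{Mod}$, $F\otimes_{k[\mathcal{A}]}G=\int^{x\in\mathcal{A}}F(x)\otimes_k G(x)$ (coend), with left derived functors $\mathrm{Tor}_*^{k[\mathcal{A}]}(F,G)$.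 *)

(* Defs.v *)
From HB Require Import structures.
From mathcomp Require Import all_boot all_algebra.
From mathcomp Require Import boolp.
From mathcomp.multinomials Require Import freeg.

Set Implicit Arguments.
Unset Strict Implicit.
Unset Printing Implicit Defensive.

Import GRing.Theory.
Local Open Scope ring_scope.

Record category := Category {
  cob :> Type;
  hom : cob -> cob -> Type;
  idm : forall x, hom x x;
  comp : forall x y z, hom y z -> hom x y -> hom x z;
  comp1m : forall x y (f : hom x y), comp (idm y) f = f;
  compm1 : forall x y (f : hom x y), comp f (idm x) = f;
  compA : forall x y z t (h : hom z t) (g : hom y z) (f : hom x y),
    comp h (comp g f) = comp (comp h g) f }.

Arguments hom {c} x y.
Arguments idm {c} x.
Arguments comp {c x y z} g f.

Notation "g \oc f" := (comp g f) (at level 50, left associativity).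

Definition op (C : category) : category :=
  @Category C (fun x y => hom y x) idm (fun _ _ _ g f => f \oc g)
    (fun _ _ => @compm1 C _ _) (fun _ _ => @comp1m C _ _)
    (fun _ _ _ _ h g f => esym (compA f g h)).

Definition isomorphic (C : category) (x y : C) :=
  exists (f : hom x y) (g : hom y x), g \oc f = idm x /\ f \oc g = idm y.

(* [S] lives in the universe of the carriers of modules, while the objects of a
   category, e.g. those of fgproj_cat below, may live in a larger one; the
   existence of resolutions and coends below forces this bound on [S] and on the
   types of morphisms. *)
Definition essentially_small (C : category) :=
  exists (S : Type) (o : S -> C), forall x : C, exists s, isomorphic (o s) x.

Record functor (C D : category) := Functor {
  fob :> C -> D;
  fmap : forall x y, hom x y -> hom (fob x) (fob y);
  fmap_id : forall x, fmap (idm x) = idm (fob x);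
  fmap_comp : forall x y z (g : hom y z) (f : hom x y),
    fmap (g \oc f) = fmap g \oc fmap f }.

Arguments fmap {C D} _ {x y} _.

Definition op_functor (C D : category) (F : functor C D) :
    functor (op C) (op D) :=
  @Functor (op C) (op D) F (fun x y f => @fmap C D F y x f)
    (@fmap_id C D F) (fun x y z g f => @fmap_comp C D F z y x f g).

Definition full (C D : category) (F : functor C D) :=
  forall (x y : C) (g : hom (F x) (F y)), exists f : hom x y, fmap F f = g.

Definition essentially_surjective (C D : category) (F : functor C D) :=
  forall y : D, exists x : C, isomorphic (F x) y.

Record additive_category := AdditiveCategory {
  acob : Type;
  ahom : acob -> acob -> zmodType;
  aid : forall x, ahom x x;
  acomp : forall x y z, ahom y z -> ahom x y -> ahom x z;
  acomp1m : forall x y (f : ahom x y), acomp (aid y) f = f;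
  acompm1 : forall x y (f : ahom x y), acomp f (aid x) = f;
  acompA : forall x y z t (h : ahom z t) (g : ahom y z) (f : ahom x y),
    acomp h (acomp g f) = acomp (acomp h g) f;
  acompDl : forall x y z (g g' : ahom y z) (f : ahom x y),
    acomp (g + g') f = acomp g f + acomp g' f;
  acompDr : forall x y z (g : ahom y z) (f f' : ahom x y),
    acomp g (f + f') = acomp g f + acomp g f';
  azero : exists z, aid z = 0;
  abiproduct : forall x y, exists z (i : ahom x z) (j : ahom y z)
    (p : ahom z x) (q : ahom z y),
    [/\ acomp p i = aid x, acomp q j = aid y,
        acomp p j = 0, acomp q i = 0 & acomp i p + acomp j q = aid z] }.

Definition cat_of_additive (A : additive_category) : category :=
  @Category (acob A) (fun x y => @ahom A x y) (@aid A) (@acomp A)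
    (@acomp1m A) (@acompm1 A) (@acompA A).

Coercion cat_of_additive : additive_category >-> category.

Definition additive_functor (A B : additive_category) (F : functor A B) :=
  forall (x y : acob A) (f g : ahom x y),
    fmap F (f + g) = (fmap F f : ahom (F x) (F y)) + fmap F g :> ahom (F x) (F y).

Definition additive_quotient (A B : additive_category) (F : functor A B) :=
  [/\ additive_functor F, full F & essentially_surjective F].

(* Right R-modules are left modules over the converse ring R^c. *)

Section Modules.
Variable R : pzRingType.

Definition finitely_generated (M : lmodType R) :=
  exists (n : nat) (e : 'I_n -> M),
    forall v, exists a : 'I_n -> R, v = \sum_i a i *: e i.

Definition projective_module (M : lmodType R) :=
  forall (N Q : lmodType R) (p : {linear N -> Q}) (f : {linear M -> Q}),
    (forall w, exists v, p v = w) ->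
    exists g : {linear M -> N}, forall v, p (g v) = f v.

Definition submodule (M : lmodType R) (U : M -> Prop) :=
  U 0 /\ forall a u v, U u -> U v -> U (a *: u + v).

Definition simple_submodule (M : lmodType R) (U : M -> Prop) :=
  [/\ submodule U, exists2 u, U u & u <> 0
    & forall V : M -> Prop, submodule V -> (forall v, V v -> U v) ->
      (forall v, V v -> v = 0) \/ (forall u, U u -> V u)].

End Modules.

(* R, as a right module over itself, is the direct sum of a finite family of
   simple submodules, i.e. of minimal right ideals. *)
Definition semisimple_ring (R : pzRingType) :=
  exists (n : nat) (U : 'I_n -> (R^c)^o -> Prop),
    (forall i, simple_submodule (U i)) /\
    forall r : (R^c)^o, exists! u : {ffun 'I_n -> (R^c)^o},
      (forall i, U i (u i)) /\ r = \sum_i u i.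


Section LinearMaps.
Variables (R : pzRingType) (U V : lmodType R).

Definition linear_of (f : U -> V) (fL : linear f) : {linear U -> V} :=
  HB.pack f (GRing.isLinear.Build R U V *:%R f fL).

Lemma linear_ext (f g : {linear U -> V}) : f =1 g -> f = g.
Proof.
case: f => f [[f0] [f1]]; case: g => g [[g0] [g1]] /= /funext fg.
move: f0 f1 g0 g1; rewrite fg => f0 f1 g0 g1.
by rewrite (Prop_irrelevance f0 g0) (Prop_irrelevance f1 g1).
Qed.

Definition linmap : Type := {linear U -> V}.

HB.instance Definition _ := gen_eqMixin linmap.
HB.instance Definition _ := gen_choiceMixin linmap.

Definition linmap_zero : linmap := \0 : {linear U -> V}.
Definition linmap_add (f g : linmap) : linmap :=
  (f : {linear U -> V}) \+ (g : {linear U -> V}) : {linear U -> V}.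
Definition linmap_opp (f : linmap) : linmap :=
  \- (f : {linear U -> V}) : {linear U -> V}.

Fact linmap_addA : associative linmap_add.
Proof. by move=> f g h; apply: linear_ext => x; exact: addrA. Qed.
Fact linmap_addC : commutative linmap_add.
Proof. by move=> f g; apply: linear_ext => x; exact: addrC. Qed.
Fact linmap_add0 : left_id linmap_zero linmap_add.
Proof. by move=> f; apply: linear_ext => x; exact: add0r. Qed.
Fact linmap_addN : left_inverse linmap_zero linmap_opp linmap_add.
Proof. by move=> f; apply: linear_ext => x; exact: addNr. Qed.

HB.instance Definition _ := GRing.isZmodule.Build linmap
  linmap_addA linmap_addC linmap_add0 linmap_addN.

End LinearMaps.

Section ProjectiveModules.
Variable R : pzRingType.

Lemma fg_zero : finitely_generated ('rV[R]_0 : lmodType R).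
Proof. by exists 0, (fun=> 0) => v; exists (fun=> 0); apply/rowP; case. Qed.

Lemma projective_zero : projective_module ('rV[R]_0 : lmodType R).
Proof.
move=> N Q p f _; exists (\0 : {linear _ -> _}) => v /=.
have -> : v = 0 by apply/rowP; case.
by rewrite !linear0.
Qed.

Lemma fg_prod (M N : lmodType R) :
  finitely_generated M -> finitely_generated N ->
  finitely_generated (M * N)%type.
Proof.
move=> [m [e He]] [n [h Hh]].
exists (m + n)%N, (fun i => match split i with inl i => (e i, 0)
                            | inr j => (0, h j) end) => -[u v].
have [a ->] := He u; have [b ->] := Hh v.
exists (fun i => match split i with inl i => a i | inr j => b j end).
have sl i : split (lshift n i) = inl i := unsplitK (inl i : 'I_m + 'I_n).
have sr i : split (rshift m i) = inr i := unsplitK (inr i : 'I_m + 'I_n).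
rewrite big_split_ord /=.
under [X in _ = X + _]eq_bigr => i _ do rewrite sl.
under [X in _ = _ + X]eq_bigr => i _ do rewrite sr.
have fstS I r (F : I -> M * N) : (\sum_(i <- r) F i).1 = \sum_(i <- r) (F i).1.
  exact: (raddf_sum fst).
have sndS I r (F : I -> M * N) : (\sum_(i <- r) F i).2 = \sum_(i <- r) (F i).2.
  exact: (raddf_sum snd).
rewrite [RHS]surjective_pairing /=; congr (_, _).
  rewrite !fstS [X in _ + X]big1 ?addr0 // => j _ /=; exact: scaler0.
rewrite !sndS [X in X + _]big1 ?add0r // => j _ /=; exact: scaler0.
Qed.

Definition inl_mod (M N : lmodType R) (v : M) : M * N := (v, 0).
Definition inr_mod (M N : lmodType R) (v : N) : M * N := (0, v).

Fact inl_mod_linear M N : linear (@inl_mod M N).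
Proof. by move=> a u v; rewrite /inl_mod -[RHS]/(_, _) /= scaler0 addr0. Qed.
Fact inr_mod_linear M N : linear (@inr_mod M N).
Proof. by move=> a u v; rewrite /inr_mod -[RHS]/(_, _) /= scaler0 addr0. Qed.

Definition in1 (M N : lmodType R) := linear_of (@inl_mod_linear M N).
Definition in2 (M N : lmodType R) := linear_of (@inr_mod_linear M N).

Lemma projective_prod (M N : lmodType R) :
  projective_module M -> projective_module N ->
  projective_module (M * N)%type.
Proof.
move=> PM PN K Q p f sp.
have [g Hg] := PM _ _ p (f \o in1 M N : {linear _ -> _}) sp.
have [h Hh] := PN _ _ p (f \o in2 M N : {linear _ -> _}) sp.
exists ((g \o fst) \+ (h \o snd) : {linear _ -> _}) => -[u v] /=.
rewrite linearD Hg Hh /= -linearD; congr (f _).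
by rewrite /inl_mod /inr_mod -[LHS]/(_, _) /= addr0 add0r.
Qed.

Record fgproj := FGProj {
  fgmod :> lmodType R;
  fgmodP : finitely_generated fgmod;
  fgmod_proj : projective_module fgmod }.

Definition fgproj_zero := FGProj fg_zero projective_zero.

Definition fgproj_prod (M N : fgproj) :=
  FGProj (fg_prod (fgmodP M) (fgmodP N))
         (projective_prod (@fgmod_proj M) (@fgmod_proj N)).

Let phom (M N : fgproj) : zmodType := linmap M N.
Let pid (M : fgproj) : phom M M := idfun : {linear M -> M}.
Let pcomp (M N Q : fgproj) (g : phom N Q) (f : phom M N) : phom M Q :=
  (g : {linear N -> Q}) \o (f : {linear M -> N}) : {linear M -> Q}.

Fact pcomp1m M N (f : phom M N) : pcomp (pid N) f = f.
Proof. exact: linear_ext. Qed.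
Fact pcompm1 M N (f : phom M N) : pcomp f (pid M) = f.
Proof. exact: linear_ext. Qed.
Fact pcompA M N Q T (h : phom Q T) (g : phom N Q) (f : phom M N) :
  pcomp h (pcomp g f) = pcomp (pcomp h g) f.
Proof. exact: linear_ext. Qed.
Fact pcompDl M N Q (g g' : phom N Q) (f : phom M N) :
  pcomp (g + g') f = pcomp g f + pcomp g' f.
Proof. exact: linear_ext. Qed.
Fact pcompDr M N Q (g : phom N Q) (f f' : phom M N) :
  pcomp g (f + f') = pcomp g f + pcomp g f'.
Proof. by apply: linear_ext => v; exact: linearD. Qed.

Fact pzero : exists z : fgproj, pid z = 0.
Proof. by exists fgproj_zero; apply: linear_ext => v; apply/rowP; case. Qed.

Fact pbiproduct M N : exists z (i : phom M z) (j : phom N z)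
  (p : phom z M) (q : phom z N),
  [/\ pcomp p i = pid M, pcomp q j = pid N,
      pcomp p j = 0, pcomp q i = 0 & pcomp i p + pcomp j q = pid z].
Proof.
exists (fgproj_prod M N), (in1 M N : linmap M (fgproj_prod M N)),
  (in2 M N : linmap N (fgproj_prod M N)),
  (fst : {linear (M * N)%type -> M}), (snd : {linear (M * N)%type -> N}).
split; apply: linear_ext => // -[u v].
rewrite -[LHS]/(inl_mod N u + inr_mod M v) /inl_mod /inr_mod.
by rewrite -[LHS]/(_, _) /= addr0 add0r.
Qed.

Definition fgproj_cat : additive_category :=
  @AdditiveCategory fgproj phom pid pcomp pcomp1m pcompm1 pcompA
    pcompDl pcompDr pzero pbiproduct.

End ProjectiveModules.

Definition right_fgproj_cat (R : pzRingType) := fgproj_cat R^c.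

Section FunctorModules.
Variable k : fieldType.

(* Functors to k-Mod, written out: they act on morphisms by linear maps. *)
Record kfunctor (C : category) := KFunctor {
  kob :> C -> lmodType k;
  kmap : forall x y, hom x y -> {linear kob x -> kob y};
  kmap_id : forall x v, kmap (idm x) v = v;
  kmap_comp : forall x y z (g : hom y z) (f : hom x y) v,
    kmap (g \oc f) v = kmap g (kmap f v) }.

Arguments kmap {C} _ {x y} _.

Record nattrans (C : category) (F G : kfunctor C) := NatTrans {
  ntr :> forall x, {linear F x -> G x};
  ntr_nat : forall x y (f : hom x y) v,
    ntr y (kmap F f v) = kmap G f (ntr x v) }.

Definition precompose (C D : category) (B : kfunctor D) (phi : functor C D) :
  kfunctor C.
Proof.
refine (@KFunctor C (fun x => B (phi x)) (fun x y f => kmap B (fmap phi f)) _ _).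
- by move=> x v; rewrite fmap_id kmap_id.
- by move=> x y z g f v; rewrite fmap_comp kmap_comp.
Defined.

(* Factorisation is understood up to natural isomorphism. *)
Definition factors_through (C D : category) (phi : functor C D)
    (F : kfunctor C) :=
  exists (B : kfunctor D) (eta : nattrans F (precompose B phi)),
    forall x, bijective (eta x).

(* Epimorphisms, kernels and images in the category of functors C -> k-Mod are
   computed objectwise. *)
Definition epi_trans (C : category) (F G : kfunctor C) (p : nattrans F G) :=
  forall x w, exists v, p x v = w.

Definition projective_functor (C : category) (P : kfunctor C) :=
  forall (F G : kfunctor C) (p : nattrans F G) (f : nattrans P G),
    epi_trans p -> exists g : nattrans P F, forall x v, p x (g x v) = f x v.

Record projective_resolution (C : category) (F : kfunctor C) :=
  ProjectiveResolution {
    res : nat -> kfunctor C;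
    resd : forall n, nattrans (res n.+1) (res n);
    resa : nattrans (res 0) F;
    res_proj : forall n, projective_functor (res n);
    resa_epi : epi_trans resa;
    resd_exact0 : forall x (v : res 0 x),
      resa x v = 0 <-> exists w, v = resd 0 x w;
    resd_exact : forall n x (v : res n.+1 x),
      resd n x v = 0 <-> exists w, v = resd n.+1 x w }.

Section Ext.
Variables (C : category) (F G : kfunctor C) (P : projective_resolution F).

Definition ext_cocycle (i : nat) (f : nattrans (res P i) G) :=
  forall x v, f x (resd P i x v) = 0.

Definition ext_coboundary (i : nat) : nattrans (res P i) G -> Prop :=
  match i with
  | 0 => fun f => forall x v, f x v = 0
  | j.+1 => fun f => exists g : nattrans (res P j) G,
              forall x v, f x v = g x (resd P j x v)
  end.

End Ext.

(* Ext^i(F, G) = 0: the complex Hom(P, G) has zero cohomology in degree i, for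
   every projective resolution P of F (see projective_resolution_exists). *)
Definition ext_vanishes (C : category) (i : nat) (F G : kfunctor C) :=
  forall (P : projective_resolution F) (f : nattrans (res P i) G),
    ext_cocycle f -> ext_coboundary f.

(* A cowedge F(x) (x)_k G(x) -> M, i.e. a family of k-bilinear maps
   F(x) x G(x) -> M compatible with the morphisms of C. *)
Record cowedge (C : category) (F : kfunctor (op C)) (G : kfunctor C)
    (M : lmodType k) := Cowedge {
  cow :> forall x : C, F x -> G x -> M;
  cow_linl : forall x b, linear (fun a => @cow x a b);
  cow_linr : forall x a, linear (@cow x a);
  cow_nat : forall (x y : C) (u : hom x y) (a : F y) (b : G x),
    @cow x (@kmap (op C) F y x u a) b = @cow y a (kmap G u b) }.

(* The coend of F(x) (x)_k G(x): a universal cowedge. *)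
Record coend (C : category) (F : kfunctor (op C)) (G : kfunctor C) := Coend {
  cend :> lmodType k;
  cend_in : cowedge F G cend;
  cend_lift : forall M : lmodType k, cowedge F G M -> {linear cend -> M};
  cend_liftE : forall (M : lmodType k) (b : cowedge F G M) (x : C) (u : F x) (v : G x),
    cend_lift b (cend_in x u v) = b x u v;
  cend_ext : forall (M : lmodType k) (f g : {linear cend -> M}),
    (forall (x : C) (u : F x) (v : G x), f (cend_in x u v) = g (cend_in x u v)) ->
    f =1 g }.

Section Tor.
Variables (C : category) (F : kfunctor (op C)).

Definition cowedge_map (G H : kfunctor C) (eta : nattrans G H)
  (M : lmodType k) (b : cowedge F H M) : cowedge F G M.
Proof.
refine (@Cowedge C F G M (fun x u v => b x u (eta x v)) _ _ _).
- by move=> x v; exact: cow_linl.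
- by move=> x u c v w /=; rewrite linearP cow_linr.
- by move=> x y u a c /=; rewrite cow_nat ntr_nat.
Defined.

(* The map induced by eta from F (x)_{k[C]} G to F (x)_{k[C]} H. *)
Definition coend_map (G H : kfunctor C) (T : coend F G) (U : coend F H)
    (eta : nattrans G H) : {linear T -> U} :=
  cend_lift T (cowedge_map eta (cend_in U)).

Variables (G : kfunctor C) (P : projective_resolution G).
Variable T : forall n, coend F (res P n).

Definition tor_boundary n : {linear T n.+1 -> T n} :=
  coend_map (T n.+1) (T n) (resd P n).

Definition tor_cycle (i : nat) : T i -> Prop :=
  match i with
  | 0 => fun=> True
  | j.+1 => fun z => tor_boundary j z = 0
  end.

Definition tor_bound (i : nat) (z : T i) := exists w, z = tor_boundary i w.

End Tor.

(* Tor_i(F, G) = 0: the complex obtained by tensoring F with P has zero homology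
   in degree i, for every projective resolution P of G and all choices of the
   coends (see projective_resolution_exists and coend_exists). *)
Definition tor_vanishes (C : category) (i : nat)
    (F : kfunctor (op C)) (G : kfunctor C) :=
  forall (P : projective_resolution G) (T : forall n, coend F (res P n))
    (z : T i), tor_cycle z -> tor_bound z.

End FunctorModules.

Section FreeModule.
Variables (k : fieldType) (K : choiceType).
Local Notation free := {freeg K / k}.

Lemma freeg_scaleU (c : k) (x : K) : << c *g x >> = c *: (<< x >> : free).
Proof.
apply/eqP/freeg_eqP => y; rewrite coeffZ !coeffU mul1r.
by case: (x == y); rewrite ?mulr1 ?mulr0.
Qed.

Section Lift.
Variables (M : lmodType k) (f : K -> M).

Lemma fglift_linear : linear (fglift f : free -> M).
Proof.
have fD (u v : free) : fglift f (u + v) = fglift f u + fglift f v.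
  have fB := @lift_is_additive k K M f.
  have f0 : fglift f 0 = 0 by have := fB 0 0; rewrite !subrr.
  by rewrite -{1}[v]opprK fB -[- v]sub0r fB f0 sub0r opprK.
have f0 : fglift f 0 = 0.
  by apply: (@addrI _ (fglift f 0)); rewrite -fD !addr0.
have fS I (r : seq I) (F : I -> free) :
    fglift f (\sum_(i <- r) F i) = \sum_(i <- r) fglift f (F i).
  by elim: r => [|i r IH]; rewrite ?big_nil // !big_cons fD IH.
move=> a u v; rewrite fD; congr (_ + _).
rewrite -[u in RHS]freeg_sumE [in LHS]/GRing.scale /= /fgscale !fS scaler_sumr.
by apply: eq_bigr => x _; rewrite !liftU scalerA.
Qed.

Definition flift : {linear free -> M} := linear_of fglift_linear.

Lemma fliftU x : flift << x >> = f x.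
Proof. by rewrite /flift /= liftU scale1r. Qed.

End Lift.

Lemma flift_ext (M : lmodType k) (f g : {linear free -> M}) :
  (forall x, f << x >> = g << x >>) -> f =1 g.
Proof.
move=> fg u; rewrite -[u]freeg_sumE !linear_sum.
by apply: eq_bigr => x _; rewrite freeg_scaleU !linearZ /= fg.
Qed.

Lemma flift_ext2 (M N M' : lmodType k) (f : {linear free -> M})
    (g : {linear M -> N}) (f' : {linear free -> M'}) (g' : {linear M' -> N}) :
  (forall x, g (f << x >>) = g' (f' << x >>)) ->
  forall u, g (f u) = g' (f' u).
Proof.
exact: (@flift_ext N (g \o f : {linear _ -> _}) (g' \o f' : {linear _ -> _})).
Qed.

End FreeModule.

Section KernelModule.
Variables (k : fieldType) (M N : lmodType k) (p : {linear M -> N}).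

Definition kermod : Type := {v : M | p v == 0}.
HB.instance Definition _ := SubChoice.on kermod.

Fact kermod_closed : submod_closed (fun v : M => p v == 0).
Proof.
split=> [|a u v]; rewrite !unfold_in ?linear0 // => /eqP pu /eqP pv.
by rewrite linearP pu pv scaler0 addr0.
Qed.

HB.instance Definition _ :=
  GRing.SubChoice_isSubLmodule.Build k M (fun v : M => p v == 0) kermod
    kermod_closed.

End KernelModule.

Section EnoughProjectives.
Variables (k : fieldType) (C : category) (S : Type) (o : S -> C).
Hypothesis oP : forall x : C, exists s, isomorphic (o s) x.

Section Cover.
Variable F : kfunctor k C.

Definition cover_gen (x : C) : Type :=
  {classic {s : S & (F (o s) * hom (o s) x)%type}}.

HB.instance Definition _ x := Choice.on (cover_gen x).

Definition cover_gen_map (x y : C) (f : hom x y) (t : cover_gen x) :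
    cover_gen y :=
  existT _ (projT1 t) ((projT2 t).1, f \oc (projT2 t).2).

(* The direct sum of the representables k[C(o s, -)], indexed by the pairs
   (s, v) with v in F(o s). *)
Definition cover : kfunctor k C.
Proof.
refine (@KFunctor k C (fun x => {freeg (cover_gen x) / k} : lmodType k)
  (fun x y f => flift (fun t : cover_gen x => << cover_gen_map f t >>)) _ _).
- move=> x v /=.
  apply: (flift_ext2 (f := flift _) (g := idfun) (f' := idfun) (g' := idfun)).
  by move=> [s [w f]] /=; rewrite [LHS]fliftU /cover_gen_map /= comp1m.
- move=> x y z g f v /=.
  apply: (flift_ext2 (f := flift _) (g := idfun) (f' := flift _)
    (g' := flift _)).
  by move=> [s [w h]] /=; rewrite [LHS]fliftU [X in _ = _ X]fliftU [RHS]fliftU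
    /cover_gen_map /= compA.
Defined.

Definition cover_eval (x : C) (t : cover_gen x) : F x :=
  kmap F (projT2 t).2 (projT2 t).1.

Definition cover_trans : nattrans cover F.
Proof.
refine (@NatTrans k C cover F (fun x => flift (@cover_eval x)) _).
move=> x y f; apply: flift_ext2 => -[s [v h]] /=.
by rewrite [X in _ X = _]fliftU [LHS]fliftU [X in _ = _ X]fliftU
  /cover_eval /= kmap_comp.
Defined.

Lemma cover_transE x (t : cover_gen x) : cover_trans x << t >> = cover_eval t.
Proof. exact: fliftU. Qed.

Lemma cover_epi : epi_trans cover_trans.
Proof.
move=> x w; have [s [f [g [_ fg]]]] := oP x.
exists << (existT _ s (kmap F g w, f) : cover_gen x) >>.
by rewrite cover_transE /cover_eval /= -kmap_comp fg kmap_id.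
Qed.

Lemma cover_proj : projective_functor cover.
Proof.
move=> G H p f sp.
pose e s v : cover_gen (o s) := existT _ s (v, idm (o s)).
pose c (t : {s : S & F (o s)}) :=
  cid (sp (o (projT1 t)) (f _ << e (projT1 t) (projT2 t) >>)).
pose h t := projT1 (c t); have hP t := projT2 (c t).
pose g0 x (t : cover_gen x) : G x :=
  kmap G (projT2 t).2 (h (existT _ (projT1 t) (projT2 t).1)).
have gN x y (u : hom x y) v :
    flift (@g0 y) (kmap cover u v) = kmap G u (flift (@g0 x) v).
  apply: flift_ext2 => -[s [w a]] /=.
  by rewrite [X in _ X = _]fliftU [LHS]fliftU [X in _ = _ X]fliftU /g0 /=
    kmap_comp.
exists (NatTrans gN) => x v /=.
apply: (flift_ext2 (f := flift _) (g := p x) (f' := idfun) (g' := f x)).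
move=> -[s [w a]] /=.
rewrite [X in _ X = _]fliftU /g0 /= ntr_nat [p _ _]hP.
rewrite -[LHS](ntr_nat f a) [X in _ X = _]fliftU.
by rewrite /cover_gen_map /= compm1.
Qed.

End Cover.

Section Kernel.
Variables (F G : kfunctor k C) (p : nattrans F G).

Fact kerf_map_subproof x y (f : hom x y) (v : kermod (p x)) :
  p y (kmap F f (val v)) == 0.
Proof. by rewrite ntr_nat (eqP (valP v)) linear0. Qed.

Definition kerf_map x y (f : hom x y) (v : kermod (p x)) : kermod (p y) :=
  Sub (kmap F f (val v)) (kerf_map_subproof f v).

Fact kerf_map_linear x y (f : hom x y) : linear (@kerf_map x y f).
Proof.
by move=> a u v; apply: val_inj; rewrite linearP /kerf_map !SubK !linearP.
Qed.

Definition kerf : kfunctor k C.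
Proof.
refine (@KFunctor k C (fun x => kermod (p x) : lmodType k)
  (fun x y f => linear_of (@kerf_map_linear x y f)) _ _).
- by move=> x v; apply: val_inj; exact: kmap_id.
- by move=> x y z g f v; apply: val_inj; exact: kmap_comp.
Defined.

Definition kerf_in : nattrans kerf F.
Proof.
refine (@NatTrans k C kerf F (fun x => val : {linear kermod (p x) -> F x}) _).
by [].
Defined.

End Kernel.

Definition nt_comp (F G H : kfunctor k C) (q : nattrans G H) (p : nattrans F G) :
  nattrans F H.
Proof.
refine (@NatTrans k C F H (fun x => q x \o p x : {linear _ -> _}) _).
by move=> x y f v /=; rewrite !ntr_nat.
Defined.

Section KernelExact.
Variables (E F G : kfunctor k C) (p : nattrans F G) (q : nattrans E (kerf p)).

Lemma kerf_in_eq0 x (v : E x) : nt_comp (kerf_in p) q x v = 0 <-> q x v = 0.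
Proof.
rewrite -[nt_comp _ _ x v]/(val (q x v)); split=> [qv|->]; last by [].
exact: val_inj.
Qed.

Lemma kerf_exact : epi_trans q -> forall x (v : F x),
  p x v = 0 <-> exists w, v = nt_comp (kerf_in p) q x w.
Proof.
move=> sq x v; split=> [/eqP v0|[w ->]]; last exact: (eqP (valP (q x w))).
have [w wE] := sq x (exist _ v v0).
by exists w; exact: esym (congr1 val wE).
Qed.

End KernelExact.

Variable F : kfunctor k C.

Fixpoint syzygy (n : nat) : kfunctor k C :=
  if n is m.+1 then kerf (cover_trans (syzygy m)) else F.

Definition standard_d n : nattrans (cover (syzygy n.+1)) (cover (syzygy n)) :=
  nt_comp (kerf_in (cover_trans (syzygy n))) (cover_trans (syzygy n.+1)).

Fact standard_exact n x (v : cover (syzygy n) x) :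
  cover_trans (syzygy n) x v = 0 <-> exists w, v = standard_d n x w.
Proof. by apply: kerf_exact; exact: cover_epi. Qed.

Fact standard_d_eq0 n x (v : cover (syzygy n.+1) x) :
  standard_d n x v = 0 <-> cover_trans (syzygy n.+1) x v = 0.
Proof. exact: kerf_in_eq0. Qed.

Definition standard_resolution : projective_resolution F :=
  @ProjectiveResolution k C F (fun n => cover (syzygy n)) standard_d
    (cover_trans F) (fun n => @cover_proj (syzygy n)) (@cover_epi F)
    (@standard_exact 0)
    (fun n x v => iff_trans (standard_d_eq0 v) (standard_exact v)).

End EnoughProjectives.

Theorem projective_resolution_exists (k : fieldType) (C : category)
    (F : kfunctor k C) :
  essentially_small C -> inhabited (projective_resolution F).
Proof. by move=> [S [o oP]]; exact: (inhabits (standard_resolution oP F)). Qed.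

Section QuotientModule.
Variables (k : fieldType) (M : lmodType k) (N : M -> Prop).
Hypothesis N_sub : submodule N.

Let N0 : N 0. Proof. by case: N_sub. Qed.
Let NZD a u v : N u -> N v -> N (a *: u + v).
Proof. by case: N_sub => _; apply. Qed.
Let ND u v : N u -> N v -> N (u + v).
Proof. by rewrite -[u + v]/(u + v) -{2}[u]scale1r; exact: NZD. Qed.
Let NZ a u : N u -> N (a *: u).
Proof. by move=> Nu; rewrite -[_ *: _]addr0; exact: NZD. Qed.
Let NN u : N u -> N (- u).
Proof. by rewrite -scaleN1r; exact: NZ. Qed.

Let rep (u : M) : M := choose (fun v => `[< N (v - u) >]) u.

Let repP u : N (rep u - u).
Proof.
apply/asboolP; apply: (@chooseP M (fun v => `[< N (v - u) >]) u).
by rewrite subrr; exact/asboolP.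
Qed.

Let rep_eq u v : N (u - v) -> rep u = rep v.
Proof.
move=> Nuv; have Nvu : N (v - u) by rewrite -opprB; exact: NN.
rewrite /rep (@eq_choose _ _ (fun w => `[< N (w - v) >])); last first.
  move=> w; apply/asboolP/asboolP => Nw.
    by rewrite -(subrK u w) -addrA; exact: ND.
  by rewrite -(subrK v w) -addrA; exact: ND.
by apply: choose_id; apply/asboolP; rewrite ?subrr.
Qed.

Let rep_id u : rep (rep u) = rep u. Proof. exact: rep_eq. Qed.

Definition quomod : Type := let _ := N_sub in {u : M | rep u == u}.
HB.instance Definition _ := Choice.on quomod.

Definition qpi (u : M) : quomod := exist _ (rep u) (introT eqP (rep_id u)).

Lemma qpi_eq u v : qpi u = qpi v <-> N (u - v).
Proof.
split=> [/(congr1 val) /= e|/rep_eq e]; last exact: val_inj.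
have /NN := repP u; rewrite opprB => Nu.
by rewrite -(subrK (rep u) u) {2}e -addrA; exact: ND.
Qed.

Let qrep (q : quomod) : M := val q.
Lemma qrepK q : qpi (qrep q) = q.
Proof. by apply: val_inj => /=; exact: (eqP (valP q)). Qed.

Let qpiP u : N (qrep (qpi u) - u). Proof. exact: repP. Qed.

Let qadd p q := qpi (qrep p + qrep q).
Let qopp q := qpi (- qrep q).
Let qscale a q := qpi (a *: qrep q).

Let qpiD u v : qadd (qpi u) (qpi v) = qpi (u + v).
Proof. by apply/qpi_eq; rewrite opprD addrACA; exact: ND. Qed.
Let qpiN u : qopp (qpi u) = qpi (- u).
Proof. by apply/qpi_eq; rewrite -opprD; exact: NN. Qed.
Let qpiZ a u : qscale a (qpi u) = qpi (a *: u).
Proof. by apply/qpi_eq; rewrite -scalerBr; exact: NZ. Qed.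

Let qaddA : associative qadd.
Proof.
move=> p q r; rewrite -[p]qrepK -[q]qrepK -[r]qrepK.
by rewrite !qpiD addrA.
Qed.
Let qaddC : commutative qadd.
Proof. by move=> p q; rewrite /qadd addrC. Qed.
Let qadd0 : left_id (qpi 0) qadd.
Proof. by move=> p; rewrite -[p]qrepK qpiD add0r. Qed.
Let qaddN : left_inverse (qpi 0) qopp qadd.
Proof. by move=> p; rewrite -[p]qrepK qpiN qpiD addNr. Qed.

HB.instance Definition _ := GRing.isZmodule.Build quomod qaddA qaddC qadd0 qaddN.

Fact qscaleA a b q : qscale a (qscale b q) = qscale (a * b) q.
Proof. by rewrite -[q]qrepK !qpiZ scalerA. Qed.
Fact qscale1 : left_id 1 qscale.
Proof. by move=> q; rewrite -[q]qrepK qpiZ scale1r. Qed.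
Fact qscaleDr : right_distributive qscale +%R.
Proof.
move=> a p q; rewrite -[p]qrepK -[q]qrepK.
by rewrite [_ + _]qpiD !qpiZ [RHS]qpiD scalerDr.
Qed.
Fact qscaleDl q : {morph qscale^~ q : a b / a + b}.
Proof. by move=> a b; rewrite -[q]qrepK !qpiZ [RHS]qpiD scalerDl. Qed.

HB.instance Definition _ := GRing.Zmodule_isLmodule.Build k quomod
  qscaleA qscale1 qscaleDr qscaleDl.

Fact qpi_linear : linear qpi.
Proof. by move=> a u v; rewrite -qpiD -qpiZ. Qed.

Lemma qpi_surj (q : quomod) : exists u, qpi u = q.
Proof. by exists (val q); exact: qrepK. Qed.

Section Lift.
Variables (Q : lmodType k) (f : {linear M -> Q}).
Hypothesis fN : forall u, N u -> f u = 0.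

Definition qlift (q : quomod) : Q := f (val q).

Lemma qliftE u : qlift (qpi u) = f u.
Proof. by apply/eqP; rewrite -subr_eq0 -linearB fN //; exact: qpiP. Qed.

Fact qlift_linear : linear qlift.
Proof.
move=> a p q; rewrite -[p]qrepK -[q]qrepK -qpi_linear !qliftE.
exact: linearP.
Qed.

End Lift.
End QuotientModule.

Section CoendExists.
Variables (k : fieldType) (C : category) (S : Type) (o : S -> C).
Hypothesis oP : forall x : C, exists s, isomorphic (o s) x.
Variables (F : kfunctor k (op C)) (G : kfunctor k C).

Definition coend_gen : Type := {classic {s : S & (F (o s) * G (o s))%type}}.
HB.instance Definition _ := Choice.on coend_gen.

Local Notation free := ({freeg coend_gen / k} : lmodType k).

Definition cowedge_eval (M : lmodType k) (b : cowedge F G M) (t : coend_gen) :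
  M := b (o (projT1 t)) (projT2 t).1 (projT2 t).2.

(* The relations of the coend: the elements killed by every cowedge. *)
Definition coend_rel (u : free) :=
  forall (M : lmodType k) (b : cowedge F G M), flift (cowedge_eval b) u = 0.

Fact coend_rel_sub : submodule coend_rel.
Proof.
split=> [M b|a u v ru rv M b]; first exact: linear0.
by rewrite linearP ru rv scaler0 addr0.
Qed.

Definition coend_mod : lmodType k := quomod coend_rel_sub.
Local Notation pi := (qpi coend_rel_sub).

Let sk (x : C) : S := projT1 (cid (oP x)).
Let sk_in (x : C) : hom (o (sk x)) x := projT1 (cid (projT2 (cid (oP x)))).
Let sk_out (x : C) : hom x (o (sk x)) :=
  projT1 (cid (projT2 (cid (projT2 (cid (oP x)))))).
Let sk_inout x : sk_in x \oc sk_out x = idm x.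
Proof. exact: (projT2 (cid (projT2 (cid (projT2 (cid (oP x))))))).2. Qed.

Definition coend_pure (x : C) (u : F x) (v : G x) : free :=
  << (existT _ (sk x) (@kmap k (op C) F x (o (sk x)) (sk_in x) u,
                       kmap G (sk_out x) v) : coend_gen) >>.

Lemma coend_pureE (M : lmodType k) (b : cowedge F G M) x u v :
  flift (cowedge_eval b) (@coend_pure x u v) = b x u v.
Proof.
rewrite [LHS]fliftU /cowedge_eval /= cow_nat -kmap_comp sk_inout.
by rewrite kmap_id.
Qed.

Definition coend_in : cowedge F G coend_mod.
Proof.
refine (@Cowedge k C F G coend_mod (fun x u v => pi (coend_pure u v)) _ _ _).
- move=> x v a u w; rewrite -(qpi_linear coend_rel_sub).
  apply/qpi_eq => M b; rewrite linearB linearP !coend_pureE cow_linl.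
  exact: subrr.
- move=> x u a v w; rewrite -(qpi_linear coend_rel_sub).
  apply/qpi_eq => M b; rewrite linearB linearP !coend_pureE cow_linr.
  exact: subrr.
- move=> x y f u v; apply/qpi_eq => M b; rewrite linearB !coend_pureE cow_nat.
  exact: subrr.
Defined.

Definition standard_coend : coend F G.
Proof.
refine (@Coend k C F G coend_mod coend_in
  (fun M b => linear_of (qlift_linear (f := flift (cowedge_eval b))
                           (fun u ru => ru M b))) _ _).
- move=> M b x u v; rewrite -[RHS]coend_pureE.
  exact: (@qliftE _ _ _ coend_rel_sub _ _ (fun w rw => rw M b)).
- move=> M f g fg q; have [u <-] := qpi_surj q.
  pose p := linear_of (qpi_linear coend_rel_sub).
  apply: (flift_ext2 (f := p) (g := f) (f' := p) (g' := g)) => -[s [v w]].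
  suff e : p << (existT _ s (v, w) : coend_gen) >> = coend_in (o s) v w.
    by rewrite e.
  apply/qpi_eq => M' b; rewrite linearB !coend_pureE [X in X - _]fliftU.
  exact: subrr.
Defined.

End CoendExists.

Theorem coend_exists (k : fieldType) (C : category) (F : kfunctor k (op C))
    (G : kfunctor k C) :
  essentially_small C -> inhabited (coend F G).
Proof. by move=> [S [o oP]]; exact: (inhabits (standard_coend oP F G)). Qed.

(* Main.v *)
Require Import Defs.
From HB Require Import structures.
From mathcomp Require Import all_boot all_algebra.
From mathcomp Require Import boolp classical_sets ring.
From mathcomp.multinomials Require Import freeg.
Import Defs.
Set Implicit Arguments.
Unset Strict Implicit.
Unset Printing Implicit Defensive.
Import GRing.Theory.
Local Open Scope ring_scope.

(* In characteristic zero the k-linearisation of P_R has a separability element: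
   for every x there are finitely many tensors in k[Hom(s, x)] (x) k[Hom(x, s)],
   natural in x, whose composites add up to the identity of x.  It is built
   block by block from the matrices ([f o j = 1]), f ranging over the split
   epimorphisms and j over the split monomorphisms between two modules, which
   are invertible.  Consequently a functor A1 that factors through phi is a
   direct summand of a free functor k[X], where X(x) is a disjoint union of sets
   Hom(M, phi x), and A2 is a direct factor of a product of functors
   x |-> W^Hom(phi x, M).

   For such functors Ext vanishes because |End M| is invertible in k and kills
   Hom(phi x, M).  Indeed, k[X] is resolved by the Cech nerve of the covering of
   X by representable functors.  A cocycle on this nerve with values in
   W^Hom(phi -, M) is a coboundary on any given finite set of simplices: coning
   off over one point of X gives a primitive which depends on the paths from that
   point, and the dependence disappears after averaging over multiples of the
   differences of the paths.  Linear algebra over a field passes from finite sets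
   of simplices to all of them.

   Tor is reduced to Ext by mapping the chains to their quotient by the
   boundaries. *)

(* [freeg] also exports a [lift]. *)
Local Notation lift := fintype.lift.

(** * Linear algebra over a field *)

(** The nerve is not a projective resolution: beyond the covering itself its terms are free functors
    on fibre powers of the covering, of the same kind as k[X]. So the vanishing is proved for all X
    at once, by induction on the degree: lower degrees are applied to the terms of the nerve, and
    averaging only serves to make the row of homs out of the nerve exact.

    The labels of X are there because a cone needs one apex from which finitely many vertices can be
    reached: two points with the same label are the components of a point over a biproduct.
    Biproducts also make room for translations: the path is changed in a new summand, along which
    the element of Hom(phi -, M) can be extended at will.

    Apart from divisions by |Aut T| and |End M|, characteristic zero enters by counting. If V does
    not embed in T, some indecomposable S has |Hom(V, S)| > |Hom(S, T)|, and this positive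
    difference makes an operator on functions on Hom(V, T) injective. Hence an element of
    k[Hom(V, T)] that dies after every T -> V is 0. An idempotent of k[End T] that kills the
    singular endomorphisms then reduces composition to the matrix ([f o j = 1]). *)

Section LinearSelection.
Variables (k : fieldType) (Y W : lmodType k).
Variables (Omega Gamma : Y * W -> Prop).
Hypotheses (Omega_sub : submodule Omega) (Gamma_sub : submodule Gamma).
Hypothesis Omega_total : forall y, exists w, Omega (y, w).
Hypothesis Gamma_fun : forall w, Gamma (0, w) -> w = 0.
Hypothesis Gamma_Omega : forall p, Gamma p -> Omega p.

(** The union with [Gamma] makes the empty set good, hence also the union of the empty chain. *)
Let good (A : Y * W -> Prop) :=
  [/\ submodule (fun p => A p \/ Gamma p),
      forall w, A (0, w) \/ Gamma (0, w) -> w = 0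
    & forall p, A p \/ Gamma p -> Omega p].

(** Zorn on partial linear graphs between [Gamma] and [Omega]: where a maximal one is undefined, a
    value allowed by [Omega] could be adjoined. *)
Lemma linear_selection :
  exists eta : {linear Y -> W},
    (forall y w, Gamma (y, w) -> eta y = w) /\ forall y, Omega (y, eta y).
Proof.
have [F Fgood Ftot|A [[Asub Afun AOm] Amax]] := @Zorn_bigcup (Y * W) good.
  split=> [|w [[B FB Bw]|/Gamma_fun//]|p [[B FB Bp]|]]; last exact: Gamma_Omega.
  - split=> [|a u v Uu Uv]; first by right; case: Gamma_sub.
    have [B [[BF|BG] [Bu Bv]]] : exists B : set (Y * W), (F B \/ B = Gamma) /\
        ((B u \/ Gamma u) /\ (B v \/ Gamma v)).
      case: Uu Uv => [[B FB Bu]|Gu] [[C FC Cv]|Gv].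
      + have [BC|CB] := Ftot _ _ FB FC.
          by exists C; split; [left|split; left=> //; exact: BC].
        by exists B; split; [left|split; left=> //; exact: CB].
      + by exists B; split; [left|split; [left|right]].
      + by exists C; split; [left|split; [right|left]].
      + by exists Gamma; split; [right|split; right].
    + have [[_ BD] _ _] := Fgood _ BF.
      by case: (BD a u v Bu Bv) => ?; [left; exists B|right].
    + right; rewrite BG in Bu Bv; case: Gamma_sub => _; apply.
        by case: Bu.
      by case: Bv.
  - by have [_ + _] := Fgood _ FB; apply; left.
  - by have [_ _] := Fgood _ FB; apply; left.
pose U p := A p \/ Gamma p.
have [U0 UD] : submodule U by [].
have UZ a p : U p -> U (a *: p) by move=> Up; rewrite -[_ *: _]addr0; exact: UD.
have UB p q : U p -> U q -> U (p - q).
  by move=> Up Uq; rewrite addrC -scaleN1r; exact: UD.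
have Ufun y w w' : U (y, w) -> U (y, w') -> w = w'.
  move=> Uw Uw'; apply/eqP; rewrite -subr_eq0; apply/eqP/Afun.
  have := UB _ _ Uw Uw'; suff -> : (y, w) - (y, w') = (0, w - w') by [].
  by rewrite -[LHS]/(_, _) /= subrr.
have Utot y : exists w, U (y, w).
  apply: contrapT => noU; have [w Ow] := Omega_total y.
  pose B p := exists a q, U q /\ p = a *: (y, w) + q.
  have AB : B = (fun p => B p \/ Gamma p).
    apply/funext => p; apply/propext; split; first by left.
    case=> // Gp; exists 0, p; split; first by right.
    by rewrite scale0r add0r.
  apply: (Amax B); last first.
    split; rewrite -?AB.
    - split; first by exists 0, 0; split=> //; rewrite scale0r addr0.
      move=> a _ _ [b [q [Uq ->]]] [c [q' [Uq' ->]]].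
      exists (a * b + c), (a *: q + q'); split; first exact: UD.
      by rewrite scalerDr scalerDl scalerA addrACA.
    - move=> w' [|Gw]; last exact: Gamma_fun.
      case=> a [[y1 w1] [Uq]]; rewrite -[RHS]/(_, _) /= => -[E ->].
      have [a0|a0] := eqVneq a 0.
        move: E Uq; rewrite a0 !scale0r !add0r => <- Uw.
        by apply: Afun.
      (* A vertical vector with nonzero coefficient at (y, w) would already put y in the domain of
         [U]. *)
      case: noU; exists (- a^-1 *: w1).
      have -> : (y, - a^-1 *: w1) = - a^-1 *: (y1, w1).
        rewrite -[RHS]/(_, _); congr (_, _).
        have -> : y1 = - (a *: y) by apply/eqP; rewrite -addr_eq0 addrC -E.
        by rewrite scalerN scaleNr opprK scalerA mulVf // scale1r.
      exact: UZ.
    - move=> p [[a [q [Uq ->]]]|]; last exact: Gamma_Omega.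
      by case: Omega_sub => _; apply=> //; exact: AOm.
  split=> [p Ap|BA]; first by exists 0, p; split; [left|rewrite scale0r add0r].
  case: noU; exists w; left; apply: BA; exists 1, 0; split=> //.
  by rewrite scale1r addr0.
have [e eP] := choice Utot.
have eL : linear e.
  move=> a u v; apply: Ufun (eP _) _.
  exact: UD (eP u) (eP v).
exists (linear_of eL); split=> [y w Gw|y]; last by apply: AOm; exact: eP.
by apply: Ufun (eP y) _; right.
Qed.

End LinearSelection.

Lemma linear_section (k : fieldType) (X Y : lmodType k) (p : {linear X -> Y}) :
  (forall y, exists x, p x = y) -> exists s : {linear Y -> X}, forall y, p (s y) = y.
Proof.
move=> psurj.
have [||y|w [/= _]|[y w] [/= -> ->]|s [_ sP]] :=
    @linear_selection k Y X (fun q => p q.2 = q.1) (fun q => q.1 = 0 /\ q.2 = 0).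
- by split=> [|a [u v] [u' v'] /= E E']; rewrite ?linear0 // linearP E E'.
- split=> // a [u v] [u' v'] /= [-> ->] [-> ->].
  by rewrite !scaler0 !addr0.
- exact: psurj.
- by [].
- exact: linear0.
- by exists s.
Qed.

(** In [row_zero] this turns a condition on single chains, each of finite support, into one global
    solution. *)
Lemma linear_factor (k : fieldType) (X Y W : lmodType k)
    (d : {linear X -> Y}) (theta : {linear X -> W}) :
  (forall x, d x = 0 -> theta x = 0) ->
  exists eta : {linear Y -> W}, forall x, eta (d x) = theta x.
Proof.
move=> dtheta.
have [||y|w [x [/= /esym dx ->]]||s [sP _]] := @linear_selection k Y W
    (fun=> True) (fun q => exists x, q.1 = d x /\ q.2 = theta x).
- by [].
- split; first by exists 0; rewrite !linear0.
  move=> a [u v] [u' v'] [x [/= -> ->]] [x' [/= -> ->]].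
  by exists (a *: x + x'); rewrite !linearP.
- by exists 0.
- exact: dtheta.
- by [].
- by exists s => x; apply: sP; exists x.
Qed.

Section DependentFunctions.
Variables (k : fieldType) (I : Type) (W : I -> lmodType k).

Definition dfun : Type := forall i, W i.
HB.instance Definition _ := gen_eqMixin dfun.
HB.instance Definition _ := gen_choiceMixin dfun.

Let dzero : dfun := fun=> 0.
Let dadd (f g : dfun) : dfun := fun i => f i + g i.
Let dopp (f : dfun) : dfun := fun i => - f i.
Let dscale (a : k) (f : dfun) : dfun := fun i => a *: f i.

Fact dfun_addA : associative dadd.
Proof. by move=> f g h; apply/functional_extensionality_dep => i; exact: addrA. Qed.
Fact dfun_addC : commutative dadd.
Proof. by move=> f g; apply/functional_extensionality_dep => i; exact: addrC. Qed.
Fact dfun_add0 : left_id dzero dadd.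
Proof. by move=> f; apply/functional_extensionality_dep => i; exact: add0r. Qed.
Fact dfun_addN : left_inverse dzero dopp dadd.
Proof. by move=> f; apply/functional_extensionality_dep => i; exact: addNr. Qed.
HB.instance Definition _ := GRing.isZmodule.Build dfun
  dfun_addA dfun_addC dfun_add0 dfun_addN.

Fact dfun_scaleA a b f : dscale a (dscale b f) = dscale (a * b) f.
Proof. by apply/functional_extensionality_dep => i; exact: scalerA. Qed.
Fact dfun_scale1 : left_id 1 dscale.
Proof. by move=> f; apply/functional_extensionality_dep => i; exact: scale1r. Qed.
Fact dfun_scaleDr : right_distributive dscale +%R.
Proof. by move=> a f g; apply/functional_extensionality_dep => i; exact: scalerDr. Qed.
Fact dfun_scaleDl f : {morph dscale^~ f : a b / a + b}.
Proof. by move=> a b; apply/functional_extensionality_dep => i; exact: scalerDl. Qed.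
HB.instance Definition _ := GRing.Zmodule_isLmodule.Build k dfun
  dfun_scaleA dfun_scale1 dfun_scaleDr dfun_scaleDl.

End DependentFunctions.

(** * Acyclic functors *)

Section FunctorConstructions.
Variables (k : fieldType) (C : category).
Implicit Types E F G H K P Q X Y : kfunctor k C.

Lemma kerfE F G (p : nattrans F G) x (v : kerf p x) : p x (val v) = 0.
Proof. exact/eqP/(valP v). Qed.

Definition nt_id F : nattrans F F :=
  @NatTrans k C F F (fun x => idfun : {linear F x -> F x}) (fun _ _ _ _ => erefl).

Definition nt_of F G (h : forall x, F x -> G x) (hL : forall x, linear (h x))
    (hN : forall (x y : C) (f : hom x y) v, h y (kmap F f v) = kmap G f (h x v)) :
  nattrans F G := @NatTrans k C F G (fun x => linear_of (hL x)) hN.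

Definition kerf_elt F G (p : nattrans F G) x (v : F x) (pv : p x v = 0) :
  kerf p x := exist _ v (introT eqP pv).

Section KernelLift.
Variables (F G X : kfunctor k C) (p : nattrans F G) (h : nattrans X F).
Hypothesis ph0 : forall x v, p x (h x v) = 0.

Definition kerf_lift : nattrans X (kerf p).
Proof.
refine (@nt_of X (kerf p) (fun x v => kerf_elt (ph0 v)) _ _).
- by move=> x a u v; apply: val_inj; exact: linearP.
- by move=> x y f v; apply: val_inj; exact: ntr_nat.
Defined.
End KernelLift.

Section Sum.
Variables F G : kfunctor k C.

Definition sum_map x y (f : hom x y) (v : F x * G x) : F y * G y :=
  (kmap F f v.1, kmap G f v.2).
Fact sum_map_linear x y (f : hom x y) : linear (sum_map f).
Proof. by move=> a u v; congr (_, _); exact: linearP. Qed.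

Definition sumf : kfunctor k C.
Proof.
refine (@KFunctor k C (fun x => (F x * G x)%type : lmodType k)
  (fun x y f => linear_of (@sum_map_linear x y f)) _ _).
- by move=> x [u v] /=; congr (_, _); exact: kmap_id.
- by move=> x y z g f [u v] /=; congr (_, _); exact: kmap_comp.
Defined.

Definition nt_fst : nattrans sumf F.
Proof. by refine (@nt_of sumf F (fun x v => v.1) _ _). Defined.
Definition nt_snd : nattrans sumf G.
Proof. by refine (@nt_of sumf G (fun x v => v.2) _ _). Defined.

Definition nt_pair X (p : nattrans X F) (q : nattrans X G) : nattrans X sumf.
Proof.
refine (@nt_of X sumf (fun x v => (p x v, q x v)) _ _).
- by move=> x a u v; congr (_, _); exact: linearP.
- by move=> x y f v; congr (_, _); exact: ntr_nat.
Defined.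

Definition nt_comb X (a : k) (p : nattrans F X) (q : nattrans G X) :
  nattrans sumf X.
Proof.
refine (@nt_of sumf X (fun x v => p x v.1 + a *: q x v.2) _ _).
- move=> x b u v; rewrite (linearP (p x)) (linearP (q x)).
  by rewrite !scalerDr !scalerA (mulrC a) addrACA.
- by move=> x y f v; rewrite /= linearD linearZ !ntr_nat.
Defined.

End Sum.

Definition nt_lin F G (a : k) (p q : nattrans F G) : nattrans F G :=
  nt_comp (nt_comb a p q) (nt_pair (nt_id F) (nt_id F)).

Definition pullback F G H (p : nattrans F H) (q : nattrans G H) :=
  kerf (nt_comb (-1) p q).

Definition pb_fst F G H (p : nattrans F H) (q : nattrans G H) :
    nattrans (pullback p q) F := nt_comp (nt_fst F G) (kerf_in _).
Definition pb_snd F G H (p : nattrans F H) (q : nattrans G H) :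
    nattrans (pullback p q) G := nt_comp (nt_snd F G) (kerf_in _).

Lemma pbE F G H (p : nattrans F H) (q : nattrans G H) x (v : pullback p q x) :
  p x (pb_fst p q x v) = q x (pb_snd p q x v).
Proof.
have := kerfE v; rewrite [nt_comb _ _ _ _ _]/= scaleN1r => /eqP.
by rewrite subr_eq0 => /eqP.
Qed.

Lemma pb_ext F G H (p : nattrans F H) (q : nattrans G H) x (u v : pullback p q x) :
  pb_fst p q x u = pb_fst p q x v -> pb_snd p q x u = pb_snd p q x v -> u = v.
Proof.
move=> E1 E2; apply: val_inj; rewrite [LHS]surjective_pairing [RHS]surjective_pairing.
by congr (_, _).
Qed.

Section PullbackLift.
Variables (X F G H : kfunctor k C) (p : nattrans F H) (q : nattrans G H).
Variables (u : nattrans X F) (v : nattrans X G).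
Hypothesis pquv : forall x w, p x (u x w) = q x (v x w).

Fact pb_lift_subproof x w : nt_comb (-1) p q x (nt_pair u v x w) = 0.
Proof. by rewrite /= scaleN1r pquv subrr. Qed.

Definition pb_lift : nattrans X (pullback p q) := kerf_lift pb_lift_subproof.
End PullbackLift.

Lemma pbI F G H (p : nattrans F H) (q : nattrans G H) x u v :
  p x u = q x v -> exists w, pb_fst p q x w = u /\ pb_snd p q x w = v.
Proof.
move=> E; have E0 : nt_comb (-1) p q x (u, v) == 0 by rewrite /= scaleN1r E subrr.
by exists (exist _ (u, v) E0).
Qed.

Lemma proj_retract P Q (s : nattrans Q P) (r : nattrans P Q) :
  (forall x v, r x (s x v) = v) -> projective_functor P -> projective_functor Q.
Proof.
move=> rs PP F G p f sp; have [g gP] := PP _ _ p (nt_comp f r) sp.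
by exists (nt_comp g s) => x v; rewrite /= gP /= rs.
Qed.

Definition nt_inl F G : nattrans F (sumf F G).
Proof.
refine (@nt_of F (sumf F G) (fun x v => (v, 0)) _ _).
- by move=> x a u v; rewrite -[RHS]/(_, _) /= scaler0 addr0.
- by move=> x y f v; rewrite -[RHS]/(_, _) /= linear0.
Defined.

Definition nt_inr F G : nattrans G (sumf F G).
Proof.
refine (@nt_of G (sumf F G) (fun x v => (0, v)) _ _).
- by move=> x a u v; rewrite -[RHS]/(_, _) /= scaler0 addr0.
- by move=> x y f v; rewrite -[RHS]/(_, _) /= linear0.
Defined.

Lemma proj_sum P Q : projective_functor P -> projective_functor Q ->
  projective_functor (sumf P Q).
Proof.
move=> PP PQ F G p f sp.
have [g gP] := PP _ _ p (nt_comp f (nt_inl P Q)) sp.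
have [h hP] := PQ _ _ p (nt_comp f (nt_inr P Q)) sp.
exists (nt_comb 1 g h) => x [u v]; rewrite /= scale1r linearD gP hP /= -linearD.
by congr (f x (_, _)); rewrite ?addr0 ?add0r.
Qed.

Lemma proj_section P F (p : nattrans F P) : projective_functor P -> epi_trans p ->
  exists s : nattrans P F, forall x v, p x (s x v) = v.
Proof. by move=> PP sp; have [s sP] := PP _ _ p (nt_id P) sp; exists s. Qed.

(* [acyc G i F] says that Ext^(i+1)(F, G) = 0. *)
Fixpoint acyc G (i : nat) F : Prop :=
  if i is j.+1 then
    forall P (p : nattrans P F), projective_functor P -> epi_trans p ->
      acyc G j (kerf p)
  else
    forall E (p : nattrans E F), epi_trans p -> forall f : nattrans (kerf p) G,
      exists g : nattrans E G, forall x (v : kerf p x), g x (val v) = f x v.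

(** An epimorphism onto a projective splits, so maps extend from its kernel, and the kernel is
    projective again if the source is. *)
Lemma acyc_proj G i P : projective_functor P -> acyc G i P.
Proof.
elim: i P => [|i IH] P PP.
  move=> E p sp f; have [s sP] := proj_section PP sp.
  have ph0 x v : p x (nt_lin (-1) (nt_id E) (nt_comp s p) x v) = 0.
    by rewrite /= scaleN1r linearB sP subrr.
  exists (nt_comp f (kerf_lift ph0)) => x v; congr (f x _); apply: val_inj.
  by rewrite /= kerfE linear0 scaler0 addr0.
move=> P' p PP' sp; apply: IH; have [s sP] := proj_section PP sp.
have ph0 x v : p x (nt_lin (-1) (nt_id P') (nt_comp s p) x v) = 0.
  by rewrite /= scaleN1r linearB sP subrr.
apply: (proj_retract (s := kerf_in p) (r := kerf_lift ph0)) => // x v.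
by apply: val_inj; rewrite /= kerfE linear0 scaler0 addr0.
Qed.

Section EnoughProj.
Variables (S : Type) (o : S -> C).
Hypothesis oP : forall x : C, exists s, isomorphic (o s) x.

Lemma enough_proj F : exists P (p : nattrans P F), projective_functor P /\ epi_trans p.
Proof.
exists (cover o F), (cover_trans o F); split; first exact: cover_proj.
exact: cover_epi.
Qed.

Lemma acyc_retract G i X Y (s : nattrans Y X) (r : nattrans X Y) :
  (forall x v, r x (s x v) = v) -> acyc G i X -> acyc G i Y.
Proof.
elim: i X Y s r => [|i IH] X Y s r rs aX.
  move=> E p sp f.
  have sq : epi_trans (pb_snd p r).
    move=> x w; have [e pe] := sp x (r x w).
    by have [u [_ uw]] := pbI pe; exists u.
  have ph0 x v : p x (nt_comp (pb_fst p r) (kerf_in (pb_snd p r)) x v) = 0.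
    by rewrite [nt_comp _ _ _ _]/= pbE kerfE linear0.
  have [g gP] := aX _ _ sq (nt_comp f (kerf_lift ph0)).
  have E0 x w : p x (nt_id E x w) = r x (nt_comp s p x w) by rewrite /= rs.
  exists (nt_comp g (pb_lift E0)) => x v.
  have v0 : pb_snd p r x (pb_lift E0 x (val v)) = 0.
    by rewrite /= kerfE linear0.
  rewrite /= (gP x (kerf_elt v0)) /=; congr (f x _); exact: val_inj.
move=> P p PP sp; have [Q [q [PQ sq]]] := enough_proj X.
(* A cover of X such that r o t is p on the first component; so the kernel of p is a retract of the
   kernel of t. *)
pose t : nattrans (sumf P Q) X :=
  nt_comb 1 (nt_comp s p) (nt_lin (-1) q (nt_comp s (nt_comp r q))).
have tE x u v : t x (u, v) = s x (p x u) + (q x v - s x (r x (q x v))).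
  by rewrite /= scale1r scaleN1r.
have st : epi_trans t.
  move=> x w; have [u pu] := sp x (r x w); have [v qv] := sq x w.
  by exists (u, v); rewrite tE pu qv addrC subrK.
have i0 x (v : kerf p x) : t x (nt_comp (nt_inl P Q) (kerf_in p) x v) = 0.
  by rewrite tE /= kerfE !linear0 ?subr0 ?oppr0 ?addr0.
have j0 x (v : kerf t x) : p x (nt_comp (nt_fst P Q) (kerf_in t) x v) = 0.
  have rE u : r x (t x u) = p x u.1.
    by case: u => u w; rewrite tE linearD linearB !rs subrr addr0.
  by rewrite /= -rE kerfE linear0.
apply: (IH _ _ (kerf_lift i0) (kerf_lift j0)); last exact: aX _ _ (proj_sum PP PQ) st.
by move=> x v; apply: val_inj.
Qed.

(** The map is extended in two stages: to the kernel of E -> B because A is acyclic, then to E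
    because B is. *)
Lemma acyc_ext0 G A X B (a : nattrans A X) (b : nattrans X B) :
  epi_trans b -> (forall x u, a x u = 0 -> u = 0) ->
  (forall x v, b x v = 0 <-> exists u, v = a x u) ->
  acyc G 0 A -> acyc G 0 B -> acyc G 0 X.
Proof.
move=> sb ia ab aA aB E p sp f.
have sbp : epi_trans (nt_comp b p).
  by move=> x w; have [v <-] := sb x w; have [e <-] := sp x v; exists e.
pose K := kerf (nt_comp b p).
(* the kernel of E -> B maps onto A, with kernel the kernel of p *)
pose r := nt_comp p (kerf_in (nt_comp b p)).
have sr : epi_trans (pb_snd r a).
  move=> x w; have [e pe] := sp x (a x w).
  have e0 : nt_comp b p x e = 0 by apply/ab; exists w.
  have [u [_ uw]] := @pbI K A X r a x (kerf_elt e0) w pe.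
  by exists u.
have h0 x (v : kerf (pb_snd r a) x) :
    p x (nt_comp (kerf_in _) (nt_comp (pb_fst r a) (kerf_in _)) x v) = 0.
  have := pbE (val v); rewrite kerfE linear0; exact.
have [g gP] := aA _ _ sr (nt_comp f (kerf_lift h0)).
(* As a is injective onto the kernel of b, the first projection of the pullback is an isomorphism
   onto K; [d] is its inverse. *)
have c x (v : K x) : exists w : pullback r a x, pb_fst r a x w = v.
  have /ab[u vu] : b x (r x v) = 0 by exact: kerfE v.
  by have [w [wv _]] := pbI vu; exists w.
pose d x v := projT1 (cid (c x v)).
have dP x v : pb_fst r a x (d x v) = v := projT2 (cid (c x v)).
have dE x v w : pb_fst r a x w = v -> d x v = w.
  move=> <-; apply: pb_ext; first exact: dP.
  apply/eqP; rewrite -subr_eq0 -linearB; apply/eqP/ia.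
  by rewrite !linearB -!pbE dP subrr.
have dL x : linear (d x).
  by move=> e u v; apply: dE; rewrite linearP !dP.
have dN (x y : C) (t : hom x y) v : d y (kmap K t v) = kmap (pullback r a) t (d x v).
  by apply: dE; rewrite ntr_nat dP.
have [h hP] := aB _ _ sbp (nt_comp g (nt_of dL dN)).
exists h => x v.
have v0 : nt_comp b p x (val v) = 0 by rewrite /= kerfE linear0.
have w0 : pb_snd r a x (d x (kerf_elt v0)) = 0.
  apply: ia; have <- := pbE (d x (kerf_elt v0)); rewrite dP; exact: (kerfE v).
rewrite (hP x (kerf_elt v0)) [LHS](gP x (kerf_elt w0)) /=.
congr (f x _); apply: val_inj; exact: (congr1 (kerf_in (nt_comp b p) x) (dP x (kerf_elt v0))).
Qed.

Definition nt_zero F G : nattrans F G.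
Proof.
refine (@nt_of F G (fun x v => 0) _ _).
- by move=> x a u v; rewrite scaler0 addr0.
- by move=> x y f v; rewrite linear0.
Defined.

(** Preimages under a are unique, so choosing them objectwise is linear and natural. *)
Lemma nt_factor K F X (a : nattrans K F) (h : nattrans X F) :
  (forall x u, a x u = 0 -> u = 0) -> (forall x v, exists u, h x v = a x u) ->
  exists h' : nattrans X K, forall x v, a x (h' x v) = h x v.
Proof.
move=> ia ha; pose d x v := projT1 (cid (ha x v)).
have dP x v : a x (d x v) = h x v by rewrite /d; case: cid.
have dE x v u : a x u = h x v -> d x v = u.
  move=> E; apply/eqP; rewrite -subr_eq0; apply/eqP/ia.
  by rewrite linearB dP E subrr.
have dL x : linear (d x) by move=> c u v; apply: dE; rewrite !linearP !dP.
have dN (x y : C) (t : hom x y) v : d y (kmap X t v) = kmap K t (d x v).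
  by apply: dE; rewrite !ntr_nat dP.
by exists (nt_of dL dN).
Qed.

Lemma nt_descend X F G (b : nattrans X F) (m : nattrans X G) :
  epi_trans b -> (forall x v, b x v = 0 -> m x v = 0) ->
  exists m' : nattrans F G, forall x v, m' x (b x v) = m x v.
Proof.
move=> sb bm; pose d x w := m x (projT1 (cid (sb x w))).
have dE x v : d x (b x v) = m x v.
  rewrite /d; case: cid => u /= bu; apply/eqP; rewrite -subr_eq0 -linearB.
  by apply/eqP/bm; rewrite linearB bu subrr.
have dL x : linear (d x).
  by move=> c u v; have [u' <-] := sb x u; have [v' <-] := sb x v;
    rewrite -linearP !dE linearP.
have dN (x y : C) (t : hom x y) v : d y (kmap F t v) = kmap G t (d x v).
  by have [v' <-] := sb x v; rewrite -ntr_nat !dE ntr_nat.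
by exists (nt_of dL dN); exact: dE.
Qed.

Section Shift.
Variables (G : kfunctor k C) (i : nat).

Let ext_closed := forall A X B (a : nattrans A X) (b : nattrans X B),
  epi_trans b -> (forall x u, a x u = 0 -> u = 0) ->
  (forall x v, b x v = 0 <-> exists u, v = a x u) ->
  acyc G i A -> acyc G i B -> acyc G i X.

(** Schanuel: the pullback of two covers is an extension of P0 by the kernel of p, and the kernel of
    p0 is a direct summand of it because P is projective. Closure under extensions is assumed here
    since [acyc_ext] is deduced from this lemma by induction on the degree. *)
Lemma acyc_cover_of_ext : ext_closed ->
  forall F P (p : nattrans P F), projective_functor P -> epi_trans p ->
    acyc G i (kerf p) -> acyc G i.+1 F.
Proof.
move=> extP F P p PP sp aK P0 p0 PP0 sp0.
have [||c cP] := @proj_section P _ (pb_snd p0 p).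
- exact: PP.
- by move=> x w; have [e pe] := sp0 x (p x w); have [u [_ <-]] := pbI pe; exists u.
have a0 x w : p0 x (nt_zero (kerf p) P0 x w) = p x (kerf_in p x w).
  by rewrite /= kerfE linear0.
have aX : acyc G i (pullback p0 p).
  apply: (extP _ _ _ (pb_lift a0) (pb_fst p0 p)) => //.
  - by move=> x w; have [e pe] := sp x (p0 x w); have [u [<- _]] := pbI (esym pe); exists u.
  - move=> x u u0; apply: val_inj; exact: (congr1 (pb_snd p0 p x) u0).
  - move=> x v; split=> [v0|[u ->]]; last by [].
    have v1 : p x (pb_snd p0 p x v) = 0 by rewrite -pbE v0 linear0.
    exists (kerf_elt v1); apply: pb_ext; first by rewrite v0.
    by [].
  - exact: acyc_proj.
have s0 x w : p0 x (kerf_in p0 x w) = p x (nt_zero (kerf p0) P x w).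
  by rewrite /= linear0 kerfE.
pose h := nt_lin (-1) (nt_id _) (nt_comp c (pb_snd p0 p)).
have hE x w : h x w = w - c x (pb_snd p0 p x w) by rewrite /= scaleN1r.
have r0 x w : p0 x (nt_comp (pb_fst p0 p) h x w) = 0.
  by rewrite -[LHS]/(p0 x (pb_fst p0 p x (h x w))) pbE hE 
    (linearB (pb_snd p0 p x)) cP subrr linear0.
apply: (acyc_retract (s := pb_lift s0) (r := kerf_lift r0) _ aX).
move=> x v; apply: val_inj.
rewrite -[LHS]/(pb_fst p0 p x (h x (pb_lift s0 x v))) hE.
have -> : pb_snd p0 p x (pb_lift s0 x v) = 0 by [].
by rewrite linear0 subr0.
Qed.

End Shift.

(** Horseshoe: covers of A and B give a cover of X, and the three kernels again form a short exact
    sequence. *)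
Lemma acyc_ext G i A X B (a : nattrans A X) (b : nattrans X B) :
  epi_trans b -> (forall x u, a x u = 0 -> u = 0) ->
  (forall x v, b x v = 0 <-> exists u, v = a x u) ->
  acyc G i A -> acyc G i B -> acyc G i X.
Proof.
elim: i A X B a b => [|i IH] A X B a b; first exact: acyc_ext0.
move=> sb ia ab aA aB.
have [PA [pA [PPA spA]]] := enough_proj A.
have [PB [pB [PPB spB]]] := enough_proj B.
have [c cP] := PPB _ _ b pB sb.
pose t := nt_comb 1 (nt_comp a pA) c.
have tE x u v : t x (u, v) = a x (pA x u) + c x v by rewrite /= scale1r.
have ba x u : b x (a x u) = 0 by apply/ab; exists u.
have st : epi_trans t.
  move=> x w; have [v pv] := spB x (b x w).
  have /ab[u wu] : b x (w - c x v) = 0 by rewrite linearB cP pv subrr.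
  have [u' pu'] := spA x u; exists (u', v).
  by rewrite tE pu' -wu subrK.
apply: (acyc_cover_of_ext IH (p := t)) => //; first exact: proj_sum.
have bt x w : pB x w.2 = b x (t x w).
  by case: w => u v; rewrite tE linearD ba add0r cP.
have i0 x v : t x (nt_comp (nt_inl PA PB) (kerf_in pA) x v) = 0.
  by rewrite [nt_comp _ _ _ _]/= tE kerfE !linear0 addr0.
have j0 x v : pB x (nt_comp (nt_snd PA PB) (kerf_in t) x v) = 0.
  by rewrite [nt_comp _ _ _ _]/= bt kerfE linear0.
apply: (IH _ _ _ (kerf_lift i0) (kerf_lift j0)).
- move=> x w; have [u au] : exists u, c x (val w) = a x u.
    by apply/ab; rewrite cP kerfE.
  have [u' pu'] := spA x (- u).
  have t0 : t x (u', val w) = 0 by rewrite tE pu' linearN au addNr.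
  by exists (kerf_elt t0); apply: val_inj.
- by move=> x u u0; apply: val_inj; exact: (congr1 (fun v => (val v).1) u0).
- move=> x v; split=> [v0|[u ->]]; last exact: val_inj.
  have v20 : (val v).2 = 0 by exact: (congr1 val v0).
  have u0 : pA x (val v).1 = 0.
    apply: ia; have := kerfE v; rewrite [val v]surjective_pairing tE v20.
    by rewrite linear0 addr0.
  exists (kerf_elt u0); apply: val_inj; rewrite [LHS]surjective_pairing v20.
  by [].
- exact: aA.
- exact: aB.
Qed.

Lemma acyc_cover G i F P (p : nattrans P F) : projective_functor P ->
  epi_trans p -> acyc G i (kerf p) -> acyc G i.+1 F.
Proof. by apply: acyc_cover_of_ext => *; apply: acyc_ext; eauto. Qed.

Section ShortExact.
Variables (G F D K : kfunctor k C) (q : nattrans D F) (a : nattrans K D).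
Hypothesis q_epi : epi_trans q.
Hypothesis a_inj : forall x u, a x u = 0 -> u = 0.
Hypothesis aq_exact : forall x v, q x v = 0 <-> exists u, v = a x u.

(** From the exact sequence Hom(D, G) -> Hom(K, G) -> Ext^1(F, G) -> Ext^1(D, G). *)
Lemma acyc_shift0 : acyc G 0 D ->
  (forall h : nattrans K G, exists g : nattrans D G, forall x u, g x (a x u) = h x u) ->
  acyc G 0 F.
Proof.
move=> aD aK E p sp f.
have h0 x v : p x (nt_comp (pb_fst p q) (kerf_in (pb_snd p q)) x v) = 0.
  by rewrite -[LHS]/(p x (pb_fst p q x (val v))) pbE kerfE linear0.
have [|g gP] := aD _ (pb_snd p q) _ (nt_comp f (kerf_lift h0)).
  by move=> x w; have [e pe] := sp x (q x w); have [u [_ <-]] := pbI pe; exists u.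
have i0 x u : p x (nt_zero K E x u) = q x (a x u).
  by rewrite linear0; apply/esym/aq_exact; exists u.
(* [g] extends f to the pullback of E and D. Subtracting an extension to D of its restriction to K
   makes it descend to E. *)
have [h hP] := aK (nt_comp g (pb_lift i0)).
have [||m mP] := nt_descend (b := pb_fst p q)
    (m := nt_lin (-1) g (nt_comp h (pb_snd p q))).
- by move=> x w; have [v qv] := q_epi (p x w); have [u [<- _]] := pbI (esym qv); exists u.
- move=> x v v0; have /aq_exact[u uv] : q x (pb_snd p q x v) = 0.
    by rewrite -pbE v0 linear0.
  rewrite [LHS]/= scaleN1r; apply/eqP; rewrite subr_eq0; apply/eqP.
  rewrite -[RHS]/(h x (pb_snd p q x v)) uv hP /=; congr (g x _).
  by apply: pb_ext; [rewrite v0|rewrite uv].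
exists m => x v.
have j0 y w : p y (kerf_in p y w) = q y (nt_zero (kerf p) D y w).
  by rewrite /= linear0 kerfE.
have := mP x (pb_lift j0 x v); rewrite [pb_fst _ _ _ _]/= => ->.
rewrite [LHS]/= scaleN1r linear0 subr0.
have w0 : pb_snd p q x (pb_lift j0 x v) = 0 by [].
rewrite -[LHS]/(g x (val (kerf_elt w0))) gP /=.
by congr (f x _); apply: val_inj.
Qed.

(** From Ext^(i+1)(K, G) -> Ext^(i+2)(F, G) -> Ext^(i+2)(D, G): the kernel of P -> F is an extension
    of K by the kernel of P -> D. *)
Lemma acyc_shift i : acyc G i.+1 D -> acyc G i K -> acyc G i.+1 F.
Proof.
move=> aD aK; have [P [p [PP sp]]] := enough_proj D.
have sqp : epi_trans (nt_comp q p).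
  by move=> x w; have [v <-] := q_epi w; have [u <-] := sp x v; exists u.
apply: (acyc_cover PP sqp).
have [|b bP] := @nt_factor K D _ a (nt_comp p (kerf_in (nt_comp q p))) a_inj.
  by move=> x v; apply/aq_exact; exact: (kerfE v).
have i0 x v : nt_comp q p x (kerf_in p x v) = 0 by rewrite /= kerfE linear0.
apply: (@acyc_ext G i (kerf p) _ K (kerf_lift i0) b).
- move=> x u; have [v pv] := sp x (a x u).
  have v0 : nt_comp q p x v = 0 by rewrite /= pv; apply/aq_exact; exists u.
  exists (kerf_elt v0); apply/eqP; rewrite -subr_eq0; apply/eqP/a_inj.
  by rewrite linearB bP /= pv subrr.
- by move=> x u u0; apply: val_inj; exact: (congr1 val u0).
- move=> x v; split=> [v0|[u ->]].
    have pv0 : p x (val v) = 0 by have := bP x v; rewrite v0 linear0 => /esym.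
    by exists (kerf_elt pv0); exact: val_inj.
  by apply: a_inj; rewrite bP; exact: (kerfE u).
- exact: aD.
- exact: aK.
Qed.

End ShortExact.

End EnoughProj.
End FunctorConstructions.

(** * From acyclicity to Ext; products and retracts in the target *)

Section ExtVanishing.
Variables (k : fieldType) (C : category).
Implicit Types F G : kfunctor k C.

Section ShiftResolution.
Variables (F : kfunctor k C) (R : projective_resolution F).

Fact resa_d0 x v : resa R x (resd R 0 x v) = 0.
Proof. by apply/resd_exact0; exists v. Qed.

Definition shift_resolution : projective_resolution (kerf (resa R)).
Proof.
refine (@ProjectiveResolution k C (kerf (resa R)) (fun n => res R n.+1)
  (fun n => resd R n.+1) (kerf_lift resa_d0) (fun n => @res_proj k C F R n.+1) _ _
  (fun n => @resd_exact k C F R n.+1)).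
- move=> x w; have [v wv] := (resd_exact0 (val w)).1 (kerfE w).
  by exists v; apply: val_inj; rewrite wv.
- move=> x v; rewrite -resd_exact.
  by split=> [/(congr1 val)|d0] //; apply: val_inj.
Defined.

End ShiftResolution.

(** A 1-cocycle descends to the kernel of the augmentation, from where it extends to [res R 0].
    Higher degrees follow by shifting the resolution. *)
Lemma acyc_ext_vanishes G i F : acyc G i F -> ext_vanishes i.+1 F G.
Proof.
elim: i F => [|i IH] F aF R f fc.
  have c_epi := @resa_epi k C _ (shift_resolution R).
  have [|m mP] := nt_descend (m := f) c_epi.
    move=> x v /(congr1 val) /= /resd_exact[w ->]; exact: fc.
  have [g gP] := aF _ _ (@resa_epi k C F R) m.
  exists g => x v; rewrite -mP -gP; exact: erefl.
exact: (IH _ (aF _ _ (@res_proj k C F R 0) (@resa_epi k C F R)) (shift_resolution R) f fc).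
Qed.

Section TargetProduct.
Variables (I : Type) (G : I -> kfunctor k C).

Definition prod_map (x y : C) (f : hom x y) (v : dfun (fun i => G i x)) :
  dfun (fun i => G i y) := fun i => kmap (G i) f (v i).
Fact prod_map_linear x y (f : hom x y) : linear (prod_map f).
Proof.
move=> a u v; apply/functional_extensionality_dep => i; exact: linearP.
Qed.

Definition prodf : kfunctor k C.
Proof.
refine (@KFunctor k C (fun x => dfun (fun i => G i x) : lmodType k)
  (fun x y f => linear_of (@prod_map_linear x y f)) _ _).
- by move=> x v; apply/functional_extensionality_dep => i; exact: kmap_id.
- by move=> x y z g f v; apply/functional_extensionality_dep => i; exact: kmap_comp.
Defined.

Definition nt_proj i : nattrans prodf (G i).
Proof. by refine (@nt_of k C prodf (G i) (fun x v => v i) _ _). Defined.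

Definition nt_tuple F (f : forall i, nattrans F (G i)) : nattrans F prodf.
Proof.
refine (@nt_of k C F prodf (fun x v => (fun i => f i x v) : dfun _) _ _).
- by move=> x a u v; apply/functional_extensionality_dep => i; exact: linearP.
- by move=> x y t v; apply/functional_extensionality_dep => i; exact: ntr_nat.
Defined.

Lemma acyc_prod i F : (forall j, acyc (G j) i F) -> acyc prodf i F.
Proof.
elim: i F => [|i IH] F aF.
  move=> E p sp f.
  have g j := cid (aF j E p sp (nt_comp (nt_proj j) f)).
  exists (nt_tuple (fun j => projT1 (g j))) => x v.
  apply/functional_extensionality_dep => j; exact: (projT2 (g j)).
by move=> P p PP sp; apply: IH => j; exact: aF.
Qed.

End TargetProduct.

Lemma acyc_target_retract G G' (s : nattrans G G') (r : nattrans G' G) i F :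
  (forall x v, r x (s x v) = v) -> acyc G' i F -> acyc G i F.
Proof.
move=> rs; elim: i F => [|i IH] F aF.
  move=> E p sp f; have [g gP] := aF E p sp (nt_comp s f).
  by exists (nt_comp r g) => x v; rewrite /= gP /= rs.
by move=> P p PP sp; apply: IH; exact: aF.
Qed.

End ExtVanishing.

Lemma existT_inj (I : Type) (T : I -> Type) i (a b : T i) :
  existT T i a = existT T i b -> a = b.
Proof. by move=> E; have := projT2_eq E; rewrite (Prop_irrelevance (projT1_eq E) erefl). Qed.

(** * Free functors and the Cech nerve *)

Definition is_biproduct (A : additive_category) (x y z : acob A) (i : ahom x z)
    (j : ahom y z) (p : ahom z x) (q : ahom z y) :=
  [/\ acomp p i = aid x, acomp q j = aid y,
      acomp p j = 0, acomp q i = 0 & acomp i p + acomp j q = aid z].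

Section AdditiveCategory.
Variable A : additive_category.

Lemma acomp0l (x y z : acob A) (f : ahom x y) : acomp (0 : ahom y z) f = 0.
Proof. by apply: (@addrI _ (acomp 0 f)); rewrite -acompDl !addr0. Qed.
Lemma acomp0r (x y z : acob A) (g : ahom y z) : acomp g (0 : ahom x y) = 0.
Proof. by apply: (@addrI _ (acomp g 0)); rewrite -acompDr !addr0. Qed.
Lemma acompNr (x y z : acob A) (g : ahom y z) (f : ahom x y) :
  acomp g (- f) = - acomp g f.
Proof. by apply: (@addrI _ (acomp g f)); rewrite -acompDr !subrr acomp0r. Qed.
Lemma acompMnl (x y z : acob A) (g : ahom y z) (f : ahom x y) n :
  acomp (g *+ n) f = acomp g f *+ n.
Proof. by elim: n => [|n IH]; rewrite ?mulr0n ?acomp0l // !mulrS acompDl IH. Qed.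
Lemma acompMnr (x y z : acob A) (g : ahom y z) (f : ahom x y) n :
  acomp g (f *+ n) = acomp g f *+ n.
Proof. by elim: n => [|n IH]; rewrite ?mulr0n ?acomp0r // !mulrS acompDr IH. Qed.

(* A functor X from A to sets which is a disjoint union, indexed by the labels,
   of functors that turn biproducts into products. *)
Record afset := AFSet {
  sob :> acob A -> Type;
  smap : forall x y, ahom x y -> sob x -> sob y;
  smap_id : forall x (u : sob x), smap (aid x) u = u;
  smap_comp : forall x y z (g : ahom y z) (f : ahom x y) u,
    smap (acomp g f) u = smap g (smap f u);
  label : Type;
  lab : forall x, sob x -> label;
  lab_map : forall x y (f : ahom x y) u, lab (smap f u) = lab u;
  spair : forall x y z (i : ahom x z) (j : ahom y z) p q, is_biproduct i j p q ->
    forall u v, lab u = lab v -> exists w, smap p w = u /\ smap q w = v;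
  spair_inj : forall x y z (i : ahom x z) (j : ahom y z) p q, is_biproduct i j p q ->
    forall w w', smap p w = smap p w' -> smap q w = smap q w' -> w = w' }.

End AdditiveCategory.
Arguments smap {A} _ {x y} _ _.
Arguments lab {A} _ {x} _.

Section FreeFunctor.
Variables (k : fieldType) (A : additive_category) (X : afset A).

Definition sgen (x : acob A) : Type := {classic (X x)}.
HB.instance Definition _ x := Choice.on (sgen x).

Definition freef : kfunctor k A.
Proof.
refine (@KFunctor k A (fun x => {freeg (sgen x) / k} : lmodType k)
  (fun x y f => flift (fun u : sgen x => << (smap X f u : sgen y) >>)) _ _).
- move=> x v /=.
  apply: (flift_ext2 (f := flift _) (g := idfun) (f' := idfun) (g' := idfun)).
  by move=> u /=; rewrite [LHS]fliftU /= smap_id.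
- move=> x y z g f v /=.
  apply: (flift_ext2 (f := flift _) (g := idfun) (f' := flift _)
    (g' := flift _)).
  by move=> u /=; rewrite [LHS]fliftU [X in _ = _ X]fliftU [RHS]fliftU /= smap_comp.
Defined.

Lemma freef_mapU (x y : acob A) (f : ahom x y) (u : sgen x) :
  @kmap k A freef x y f << u >> = << (smap X f u : sgen y) >>.
Proof. exact: fliftU. Qed.

Section Lift.
Variables (F : kfunctor k A) (h : forall x : acob A, X x -> F x).
Hypothesis hN : forall (x y : acob A) (f : ahom x y) u,
  h (smap X f u) = @kmap k A F x y f (h u).

Definition freef_lift : nattrans freef F.
Proof.
refine (@NatTrans k A freef F (fun x => flift (fun u : sgen x => h u)) _).
move=> x y f; apply: flift_ext2 => u.
by rewrite freef_mapU [LHS]fliftU [X in _ = _ X]fliftU hN.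
Defined.

Lemma freef_liftU x (u : sgen x) : freef_lift x << u >> = h u.
Proof. exact: fliftU. Qed.

End Lift.

Lemma freef_ext F (f g : nattrans freef F) :
  (forall x (u : sgen x), f x << u >> = g x << u >>) -> forall x v, f x v = g x v.
Proof. by move=> fg x; apply: flift_ext => u; exact: fg. Qed.

End FreeFunctor.
Arguments freef k {A} X.

Section Cech.
Variables (A : additive_category) (S : Type) (o : S -> acob A) (X : afset A).
Implicit Types x y z : acob A.

(** By Yoneda a point of X(o s) is a map Hom(o s, -) -> X; [cover_pt] is the disjoint union of these
    representables and [ev] the resulting covering. *)
Definition cpoint : Type := {s : S & X (o s)}.
Definition cover_pt x : Type := {l : cpoint & ahom (o (projT1 l)) x}.
Definition ev x (q : cover_pt x) : X x := smap X (projT2 q) (projT2 (projT1 q)).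
Definition pt_map x y (f : ahom x y) (q : cover_pt x) : cover_pt y :=
  existT _ (projT1 q) (acomp f (projT2 q)).

Lemma ev_map x y (f : ahom x y) q : ev (pt_map f q) = smap X f (ev q).
Proof. exact: smap_comp. Qed.

(* The nerve of the covering [ev] of X by representable functors, augmented: an
   element of [cech n] has n vertices, and [cech 0] is X itself. *)
Record cech (n : nat) x := Cech {
  cbase : X x;
  cpts : 'I_n -> cover_pt x;
  cechP : forall i, ev (cpts i) = cbase }.

Lemma cech_ext n x (u v : cech n x) :
  cbase u = cbase v -> (forall i, cpts u i = cpts v i) -> u = v.
Proof.
case: u v => [m p mp] [m' p' mp'] /= mm /funext pp; move: mp mp'.
by rewrite mm pp => mp mp'; rewrite (Prop_irrelevance mp mp').
Qed.

Definition cech_map n x y (f : ahom x y) (v : cech n x) : cech n y :=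
  @Cech n y (smap X f (cbase v)) (fun i => pt_map f (cpts v i))
    (fun i => etrans (ev_map f _) (congr1 _ (cechP v i))).

Lemma pt_pair x y z (i : ahom x z) (j : ahom y z) p q : is_biproduct i j p q ->
  forall (u : cover_pt x) (v : cover_pt y), projT1 u = projT1 v ->
  exists w, pt_map p w = u /\ pt_map q w = v.
Proof.
case=> pi qj pj qi _ [l f] [l' g] /= E; case: _ / E g => g.
exists (existT _ l (acomp i f + acomp j g)); rewrite /pt_map /= !acompDr !acompA.
by rewrite pi pj qi qj !acomp1m !acomp0l addr0 add0r.
Qed.

Lemma pt_pair_inj x y z (i : ahom x z) (j : ahom y z) p q : is_biproduct i j p q ->
  forall w w', pt_map p w = pt_map p w' -> pt_map q w = pt_map q w' -> w = w'.
Proof.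
case=> _ _ _ _ E [l f] [l' g] /= E1 E2; have ll := congr1 (@projT1 _ _) E1.
rewrite /= in ll; case: _ / ll g E1 E2 => g E1 E2.
have {}E1 := existT_inj E1.
have {}E2 := existT_inj E2.
suff -> : f = g by [].
by rewrite -[f]acomp1m -[g]acomp1m -E !acompDl -!acompA E1 E2.
Qed.

(** Fibre powers of the covering are again of type [afset], labelled by the label of the base point
    and the representables containing the vertices. *)
Definition cechf (n : nat) : afset A.
Proof.
refine (@AFSet A (cech n) (@cech_map n) _ _ (label X * ('I_n -> cpoint))%type
  (fun x v => (lab X (cbase v), fun i => projT1 (cpts v i))) _ _ _).
- move=> x u; apply: cech_ext => [|i] /=; first exact: smap_id.
  by rewrite /pt_map acomp1m; case: (cpts u i).
- move=> x y z g f u; apply: cech_ext => [|i] /=; first exact: smap_comp.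
  by rewrite /pt_map /= acompA.
- by move=> x y f u; rewrite /= lab_map.
- move=> x y z i j p q bip u v [El /(congr1 (fun f => f _)) Ep].
  have [m [pm qm]] := spair bip El.
  have [w wP] := choice (fun n => pt_pair bip (Ep n)).
  have mw n0 : ev (w n0) = m.
    have [pw qw] := wP n0.
    by apply: (spair_inj bip); rewrite -ev_map ?pw ?qw cechP.
  exists (Cech mw); split; apply: cech_ext => //= n0; by have [] := wP n0.
- move=> x y z i j p q bip u v E1 E2; apply: cech_ext => [|n0].
    exact: (spair_inj bip (congr1 (@cbase _ _) E1) (congr1 (@cbase _ _) E2)).
  apply: (pt_pair_inj bip).
    exact: (congr1 (fun c => cpts c n0) E1).
  exact: (congr1 (fun c => cpts c n0) E2).
Defined.

Definition cface n x (i : 'I_n.+1) (v : cech n.+1 x) : cech n x :=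
  @Cech n x (cbase v) (fun j => cpts v (lift i j)) (fun j => cechP v _).

Definition ccons_pts n x (q : cover_pt x) (p : 'I_n -> cover_pt x) (i : 'I_n.+1) :=
  if unlift ord0 i is Some j then p j else q.

Fact ccons_subproof n x (v : cech n x) q : ev q = cbase v ->
  forall i, ev (ccons_pts q (cpts v) i) = cbase v.
Proof. by move=> qv i; rewrite /ccons_pts; case: unliftP => // j _; exact: cechP. Qed.

Definition ccons n x (v : cech n x) q (qv : ev q = cbase v) : cech n.+1 x :=
  Cech (ccons_subproof qv).

Lemma cface0_cons n x (v : cech n x) q (qv : ev q = cbase v) :
  cface ord0 (ccons qv) = v.
Proof. by apply: cech_ext => //= i; rewrite /ccons_pts liftK. Qed.

Lemma cfaceS_cons n x (v : cech n.+1 x) q (qv : ev q = cbase v) (i : 'I_n.+1) :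
  cface (lift ord0 i) (ccons qv) = ccons (qv : ev q = cbase (cface i v)).
Proof.
apply: cech_ext => //= j; rewrite /ccons_pts.
case: (unliftP ord0 j) => [j'|] ->; last first.
  suff -> : lift (lift ord0 i) ord0 = ord0 by rewrite unlift_none.
  exact: val_inj.
suff -> : lift (lift ord0 i) (lift ord0 j') = lift ord0 (lift i j') by rewrite liftK.
by apply: val_inj; rewrite /= /bump /= !add1n ltnS addnS.
Qed.

Lemma ccons_head n x (v : cech n.+1 x) :
  v = ccons (cechP v ord0 : ev (cpts v ord0) = cbase (cface ord0 v)).
Proof.
apply: cech_ext => //= i; rewrite /ccons_pts.
by case: unliftP => [j|] ->.
Qed.

Lemma cface_map n x y (f : ahom x y) (i : 'I_n.+1) v :
  cface i (cech_map f v) = cech_map f (cface i v).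
Proof. by apply: cech_ext. Qed.

End Cech.

Section CechComplex.
Variables (k : fieldType) (A : additive_category) (S : Type) (o : S -> acob A).
Hypothesis oP : forall x : A, exists s, @isomorphic A (o s) x.
Variable X : afset A.
Implicit Types x y z : acob A.

Local Notation C n := (freef k (cechf o X n)).
Local Notation cech n x := (sgen (cechf o X n) x).

Definition cbd n x (v : cech n.+1 x) : C n x :=
  \sum_(i < n.+1) (-1) ^+ i *: << (cface i v : cech n x) >>.

Fact cbd_nat n x y (f : ahom x y) (v : cech n.+1 x) :
  cbd (smap (cechf o X n.+1) f v) = @kmap k A (C n) x y f (cbd v).
Proof.
rewrite linear_sum; apply: eq_bigr => i _; rewrite linearZ; congr (_ *: _).
by rewrite [RHS]freef_mapU; congr << _ >>; exact: cface_map.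
Qed.

Definition cdiff n : nattrans (C n.+1) (C n) := freef_lift (@cbd_nat n).

Lemma cdiffU n x (v : cech n.+1 x) : cdiff n x << v >> = cbd v.
Proof. exact: fliftU. Qed.

Section Contraction.
Variables (x : acob A) (sec : X x -> cover_pt o X x).
Hypothesis secP : forall m, ev (sec m) = m.

(** Prepending the vertex chosen by [sec] contracts the nerve at the object x. This is not natural
    in x, but exactness is tested objectwise. *)
Definition contr n : {linear C n x -> C n.+1 x} :=
  flift (fun v : cech n x => << (ccons (secP (cbase v)) : cech n.+1 x) >>).

Lemma contrU n (v : cech n x) :
  contr n << v >> = << (ccons (secP (cbase v)) : cech n.+1 x) >>.
Proof. exact: fliftU. Qed.

Lemma cdiff_contr n w : cdiff n.+1 x (contr n.+1 w) = w - contr n (cdiff n x w).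
Proof.
pose f := [the {linear C n.+1 x -> C n.+1 x} of
  (cdiff n.+1 x \o contr n.+1) \+ (contr n \o cdiff n x)].
suff fid : f =1 idfun by apply/eqP; rewrite eq_sym subr_eq eq_sym; exact/eqP/(fid w).
apply: flift_ext => v.
rewrite -[LHS]/(cdiff n.+1 x (contr n.+1 << v >>) + contr n (cdiff n x << v >>)).
rewrite contrU cdiffU cdiffU.
rewrite /cbd big_ord_recl expr0 scale1r cface0_cons linear_sum -addrA -big_split.
rewrite big1 ?addr0 // => i _; rewrite cfaceS_cons linearZ contrU lift0.
by rewrite exprS mulN1r scaleNr; exact: addNr.
Qed.

Lemma cdiff_contr0 w : cdiff 0 x (contr 0 w) = w.
Proof.
apply: (flift_ext (f := (cdiff 0 x \o contr 0 : {linear _ -> _})) (g := idfun)) => v.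
rewrite -[LHS]/(cdiff 0 x (contr 0 << v >>)) contrU cdiffU /cbd big_ord1 expr0 scale1r.
by rewrite cface0_cons.
Qed.

End Contraction.

Lemma cover_pt_surj x (m : X x) : exists q : cover_pt o X x, ev q = m.
Proof.
have [s [f [g [_ fg]]]] := oP x.
exists (existT _ (existT _ s (smap X g m)) f).
by rewrite /ev /= -smap_comp [acomp f g]fg smap_id.
Qed.

Lemma cover_section x : exists sec : X x -> cover_pt o X x, forall m, ev (sec m) = m.
Proof. by have [f fP] := choice (@cover_pt_surj x); exists f. Qed.

Lemma cover_section_at x (q : cover_pt o X x) :
  exists sec : X x -> cover_pt o X x, (forall m, ev (sec m) = m) /\ sec (ev q) = q.
Proof.
have [sec secP] := cover_section x.
exists (fun m => if pselect (m = ev q) then q else sec m).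
split=> [m|]; first by case: pselect => [E|_] /=; rewrite ?E.
by case: pselect => // /(_ erefl).
Qed.

(** Instead of a double sum over faces: a section through the first vertex of v exhibits v as a
    cone, and the contraction formula lowers the degree. *)
Lemma cdiff_cdiff n x w : cdiff n x (cdiff n.+1 x w) = 0.
Proof.
elim: n w => [|n IH] w.
  apply: (flift_ext (f := (cdiff 0 x \o cdiff 1 x : {linear _ -> _})) (g := \0)) => v.
  rewrite -[LHS]/(cdiff 0 x (cdiff 1 x << v >>)).
  have [sec [secP secv]] := cover_section_at (cpts v ord0).
  have -> : << v >> = contr secP 1 << (cface ord0 v : cech 1 x) >>.
    rewrite contrU; congr << _ >>; rewrite {1}(ccons_head v).
    by apply: cech_ext => //= i; rewrite /ccons_pts; case: unliftP => // _; rewrite -secv cechP.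
  by rewrite cdiff_contr linearB cdiff_contr0 subrr.
apply: (flift_ext (f := (cdiff n.+1 x \o cdiff n.+2 x : {linear _ -> _})) (g := \0)) => v.
rewrite -[LHS]/(cdiff n.+1 x (cdiff n.+2 x << v >>)).
have [sec [secP secv]] := cover_section_at (cpts v ord0).
have -> : << v >> = contr secP n.+2 << (cface ord0 v : cech n.+2 x) >>.
  rewrite contrU; congr << _ >>; rewrite {1}(ccons_head v).
  by apply: cech_ext => //= i; rewrite /ccons_pts; case: unliftP => // _; rewrite -secv cechP.
by rewrite cdiff_contr linearB cdiff_contr IH linear0 subr0 subrr.
Qed.

Lemma cdiff_exact n x w : cdiff n x w = 0 -> exists v, w = cdiff n.+1 x v.
Proof.
have [sec secP] := cover_section x => w0.
by exists (contr secP n.+1 w); rewrite cdiff_contr w0 linear0 subr0.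
Qed.

Lemma cdiff0_epi : epi_trans (cdiff 0).
Proof.
move=> x w; have [sec secP] := cover_section x.
by exists (contr secP 0 w); exact: cdiff_contr0.
Qed.

(** [cech 1] is the covering itself, a disjoint union of representables, so a lift amounts to values
    at the identities of the o s. *)
Lemma cech1_proj : projective_functor (C 1).
Proof.
move=> F G p f sp.
pose e (l : cpoint o X) : cech 1 (o (projT1 l)) := @Cech A S o X 1 (o (projT1 l))
  (projT2 l) (fun=> existT _ l (aid _)) (fun=> smap_id _).
have [h hP] : exists h : forall l : cpoint o X, F (o (projT1 l)),
    forall l, p _ (h l) = f _ << e l >>.
  exists (fun l => projT1 (cid (sp _ (f _ << e l >>)))) => l.
  by case: cid.
pose g0 x (v : cech 1 x) : F x :=
  @kmap k A F _ x (projT2 (cpts v ord0)) (h (projT1 (cpts v ord0))).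
have gN x y (t : ahom x y) (v : cech 1 x) :
    g0 y (smap (cechf o X 1) t v) = @kmap k A F x y t (g0 x v).
  exact: (@kmap_comp k A F _ _ _ t (projT2 (cpts v ord0))).
exists (freef_lift gN).
suff H : forall x v, nt_comp p (freef_lift gN) x v = f x v by exact: H.
apply: freef_ext => x v; rewrite -[LHS]/(p x (freef_lift gN x << v >>)).
rewrite freef_liftU /g0 (ntr_nat p) hP -(ntr_nat f).
congr (f x _); rewrite [LHS]freef_mapU; congr << _ >>.
apply: cech_ext => /= [|i]; first by rewrite -(cechP v ord0).
by rewrite (ord1 i) /pt_map /= acompm1; case: (cpts v ord0).
Qed.

End CechComplex.

(** * Vanishing of Ext from free functors into torsion exponentials *)

Section TorsionTarget.
Variables (k : fieldType) (A B : additive_category) (phi : functor A B).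
Hypothesis phi_add : additive_functor phi.
Variables (X0 : acob B) (W : lmodType k).
Implicit Types x y z : acob A.

Definition tgt x : zmodType := @ahom B (phi x) X0.
Definition tm x y (f : ahom x y) (a : tgt y) : tgt x :=
  @acomp B _ _ _ a (@fmap A B phi x y f).

Lemma tm_id x a : tm (aid x) a = a.
Proof. by rewrite /tm [fmap phi _](fmap_id phi x); exact: acompm1. Qed.
Lemma tm_comp x y z (g : ahom y z) (f : ahom x y) a :
  tm (acomp g f) a = tm f (tm g a).
Proof. by rewrite /tm [fmap phi _](fmap_comp phi g f) acompA. Qed.
Lemma tmDl x y (f g : ahom x y) a : tm (f + g) a = tm f a + tm g a.
Proof. by rewrite /tm (phi_add f g) acompDr. Qed.
Lemma tmDr x y (f : ahom x y) a b : tm f (a + b) = tm f a + tm f b.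
Proof. exact: acompDl. Qed.
Lemma tm0l x y a : tm (0 : ahom x y) a = 0.
Proof. by apply: (@addrI _ (tm 0 a)); rewrite -tmDl !addr0. Qed.
Lemma tmMn x y (f : ahom x y) a n : tm (f *+ n) a = tm f a *+ n.
Proof. by elim: n => [|n IH]; rewrite ?mulr0n ?tm0l // !mulrS tmDl IH. Qed.

Definition funf_map x y (f : ahom x y) (g : dfun (fun _ : tgt x => W)) :
  dfun (fun _ : tgt y => W) := fun a => g (tm f a).
Fact funf_map_linear x y (f : ahom x y) : linear (funf_map f).
Proof. by []. Qed.

Definition funf : kfunctor k A.
Proof.
refine (@KFunctor k A (fun x => dfun (fun _ : tgt x => W) : lmodType k)
  (fun x y f => linear_of (@funf_map_linear x y f)) _ _).
- by move=> x g; apply/funext => a; rewrite /= /funf_map tm_id.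
- by move=> x y z g f h; apply/funext => a; rewrite /= /funf_map tm_comp.
Defined.

Variable N : nat.
Hypothesis N_neq0 : (N%:R : k) != 0.
Hypothesis N_tgt : forall x (a : tgt x), a *+ N = 0.

Section RowZero.
Variables (S : Type) (o : S -> acob A).
Hypothesis oP : forall x : A, exists s, @isomorphic A (o s) x.
Variable X : afset A.
Local Notation cech n x := (cech o X n x).

Lemma cech_map_comp n x y z (g : ahom y z) (f : ahom x y) (v : cech n x) :
  cech_map (acomp g f) v = cech_map g (cech_map f v).
Proof. exact: (@smap_comp A (cechf o X n)). Qed.
Lemma cech_map_id n x (v : cech n x) : cech_map (aid x) v = v.
Proof. exact: (@smap_id A (cechf o X n)). Qed.

(* Natural cochains are the natural transformations k[cech n] -> funf. *)
Definition cochain n := forall x, cech n x -> tgt x -> W.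
Definition natural n (eta : cochain n) := forall x y (f : ahom x y) v a,
  eta y (cech_map f v) a = eta x v (tm f a).
Definition codiff n (eta : cochain n) : cochain n.+1 := fun x v a =>
  \sum_(i < n.+1) (-1) ^+ i *: eta x (cface i v) a.

(** * Translating and averaging primitives *)

Section Translations.
Variables (n : nat) (theta : cochain n.+2).
Hypothesis theta_nat : natural theta.
Variables (s0 : acob A) (m0 : X s0).

Definition pcochain := forall x, ahom s0 x -> cech n.+1 x -> tgt x -> W.
Implicit Type xi : pcochain.

(* A primitive of theta that is also allowed to depend on a path q from the point
   m0 of X to the base point of the simplex. *)
Definition primitive xi :=
  (forall x y (f : ahom x y) q v a, smap X q m0 = cbase v ->
     xi y (acomp f q) (cech_map f v) a = xi x q v (tm f a)) /\
  (forall x q (v : cech n.+2 x) a, smap X q m0 = cbase v ->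
     theta v a = \sum_(i < n.+2) (-1) ^+ i *: xi x q (cface i v) a).

(* Adding h to a path from m0 does not change its end point. *)
Definition null x' (h : ahom s0 x') := forall z (q : ahom s0 z) (j : ahom x' z),
  smap X (q + acomp j h) m0 = smap X q m0.

(** xi does not notice that h is added to the path along j, provided that the element of [tgt]
    restricts to b along j. *)
Definition invariant xi x' (h : ahom s0 x') (b : tgt x') :=
  forall x q (v : cech n.+1 x) a, smap X q m0 = cbase v ->
  forall z (i : ahom x z) (j : ahom x' z) c, tm i c = a -> tm j c = b ->
    xi z (acomp i q + acomp j h) (cech_map i v) c = xi x q v a.

(** Brings the existential biproduct into Type, so that [translate] can be defined by a fixed
    choice. *)
Record bip_data x y := BipData { bz : acob A; bi : ahom x bz; bj : ahom y bz;
  bp : ahom bz x; bq : ahom bz y; bipP : is_biproduct bi bj bp bq }.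

Definition bip x y : bip_data x y.
Proof.
have [z Hz] := cid (abiproduct x y); have [i Hi] := cid Hz.
have [j Hj] := cid Hi; have [p Hp] := cid Hj; have [q Hq] := cid Hp.
exact: BipData Hq.
Qed.

(* The value of xi after embedding x in the biproduct of x and x' and adding h to
   the path there; b extends a to an element of tgt over the biproduct. *)
Definition translate x' (h : ahom s0 x') (b : tgt x') xi : pcochain :=
  fun x q v a => let d := bip x x' in
    xi (bz d) (acomp (bi d) q + acomp (bj d) h) (cech_map (bi d) v)
       (tm (bp d) a + tm (bq d) b).

Lemma null_compat x x' z (h : ahom s0 x') (i : ahom x z) (j : ahom x' z) q
    (v : cech n.+1 x) : null h -> smap X q m0 = cbase v ->
  smap X (acomp i q + acomp j h) m0 = cbase (cech_map i v).
Proof. by move=> nh qv; rewrite nh smap_comp qv. Qed.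

Lemma nullMn x' (h : ahom s0 x') m : null h -> null (h *+ m).
Proof.
move=> nh; elim: m => [|m IH] z q j; first by rewrite mulr0n acomp0r addr0.
by rewrite mulrSr acompDr addrA nh IH.
Qed.

(** Naturality of xi along the map (i, j) from the biproduct to z moves the value from the biproduct
    to any z. *)
Lemma translateE xi x' (h : ahom s0 x') b : primitive xi -> null h ->
  forall x q (v : cech n.+1 x) a, smap X q m0 = cbase v ->
  forall z (i : ahom x z) (j : ahom x' z) c, tm i c = a -> tm j c = b ->
    xi z (acomp i q + acomp j h) (cech_map i v) c = translate h b xi q v a.
Proof.
move=> [xiN _] nh x q v a qv z i j c ca cb; rewrite /translate.
case: (bip x x') => z0 i0 j0 p0 q0 /= [pi qj pj qi E].
pose f := acomp i p0 + acomp j q0.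
have fi : acomp f i0 = i.
  by rewrite acompDl -!acompA pi qi acompm1 acomp0r addr0.
have fj : acomp f j0 = j.
  by rewrite acompDl -!acompA pj qj acompm1 acomp0r add0r.
rewrite -{1}fi -{1}fj -{1}fi cech_map_comp -!acompA -acompDr xiN.
  by rewrite tmDl !tm_comp ca cb.
exact: null_compat.
Qed.

(** As h is null, the new path still ends at the base point, and theta over the biproduct pulls back
    to theta over x. *)
Lemma translate_primitive xi x' (h : ahom s0 x') b : primitive xi -> null h ->
  primitive (translate h b xi).
Proof.
move=> gx nh; have [xiN xiC] := gx; split=> [x y f q v a qv|x q v a qv].
  have qv' : smap X (acomp f q) m0 = cbase (cech_map f v) by rewrite smap_comp qv.
  rewrite {1}/translate; case: (bip y x') => z i j p r /= [pi rj pj ri E].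
  rewrite -cech_map_comp acompA.
  apply: translateE => //; rewrite ?tm_comp tmDr -!tm_comp ?pi ?rj ?pj ?ri.
    by rewrite tm_id tm0l addr0.
  by rewrite tm_id tm0l add0r.
rewrite /translate; case: (bip x x') => z i j p r /= [pi rj pj ri E].
have -> : theta v a = theta (cech_map i v) (tm p a + tm r b).
  by rewrite theta_nat tmDr -!tm_comp pi ri tm_id tm0l addr0.
rewrite (xiC _ (acomp i q + acomp j h)); last by rewrite nh smap_comp qv.
by apply: eq_bigr => t _; rewrite cface_map.
Qed.

(** Both shifts are added to the path, so their order is irrelevant; averaging over one keeps the
    invariance under another. *)
Lemma translate_invariant xi x' (h : ahom s0 x') b y' (h' : ahom s0 y') b' :
  primitive xi -> null h -> invariant xi h' b' -> invariant (translate h b xi) h' b'.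
Proof.
move=> gx nh inv x q v a qv z i j c ca cb.
rewrite [in LHS]/translate; case: (bip z x') => z0 i0 j0 p0 q0 /= [pi qj pj qi E].
rewrite /translate; case: (bip x x') => z1 i1 j1 p1 q1 /= [pi1 qj1 pj1 qi1 E1].
set c0 := tm p0 c + tm q0 b.
have ic : tm i0 c0 = c by rewrite tmDr -!tm_comp pi qi tm_id tm0l addr0.
have jc : tm j0 c0 = b by rewrite tmDr -!tm_comp pj qj tm_id tm0l add0r.
pose f := acomp (acomp i0 i) p1 + acomp j0 q1.
have fi : acomp f i1 = acomp i0 i.
  by rewrite acompDl -!acompA pi1 qi1 acompm1 acomp0r addr0.
have fj : acomp f j1 = j0.
  by rewrite acompDl -!acompA pj1 qj1 acompm1 !acomp0r add0r.
rewrite -(inv _ _ _ _ _ z0 f (acomp i0 j) c0).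
- rewrite -!cech_map_comp fi !acompDr !acompA fi fj.
  by congr xi; rewrite addrAC.
- exact: null_compat.
- by rewrite tmDl !tm_comp ic jc ca.
- by rewrite tm_comp ic cb.
Qed.

(** Multiplying the second summand of the biproduct by N takes the path with h to the path with h *+
    N, and pulls the extension of a by b back to the extension by 0, because N kills [tgt]. Over the
    extension by 0 one can project to x, where the shift disappears. *)
Lemma translate0 xi x' (h : ahom s0 x') b x q (v : cech n.+1 x) a :
  primitive xi -> null h -> smap X q m0 = cbase v ->
  translate (h *+ N) b xi q v a = translate (h *+ 0) b xi q v a.
Proof.
move=> gx nh qv; have [xiN _] := gx; rewrite /translate.
case: (bip x x') => z i j p r /= [pi rj pj ri E].
have e1 : tm i (tm p a + tm r b) = a.
  by rewrite tmDr -!tm_comp pi ri tm_id tm0l addr0.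
rewrite mulr0n acomp0r addr0 [RHS]xiN // e1.
pose f := acomp i p + acomp j r *+ N.
have fi : acomp f i = i.
  by rewrite acompDl acompMnl -!acompA pi ri acompm1 acomp0r mul0rn addr0.
have fj : acomp f j = j *+ N.
  by rewrite acompDl acompMnl -!acompA pj rj acompm1 acomp0r add0r.
have qv' := null_compat (z := z) i j nh qv.
have -> : acomp i q + acomp j (h *+ N) = acomp f (acomp i q + acomp j h).
  by rewrite acompDr !acompA fi fj acompMnl acompMnr.
have -> : cech_map i v = cech_map f (cech_map i v) by rewrite -cech_map_comp fi.
rewrite xiN //.
have -> : tm f (tm p a + tm r b) = tm p a.
  by rewrite tmDl tmMn N_tgt addr0 tm_comp e1.
rewrite -xiN // acompDr !acompA pi pj acomp1m acomp0l addr0.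
by rewrite -cech_map_comp pi cech_map_id.
Qed.

(* As b *+ N = 0, translation by h *+ N is trivial, so that the average over the
   multiples of h is invariant under translation by h. *)
Definition average x' (h : ahom s0 x') (b : tgt x') xi : pcochain :=
  fun x q v a => N%:R^-1 *: \sum_(m < N) translate (h *+ m) b xi q v a.

Lemma average_primitive xi x' (h : ahom s0 x') b : primitive xi -> null h ->
  primitive (average h b xi).
Proof.
move=> gx nh; have gt m := translate_primitive b gx (nullMn m nh).
split=> [x y f q v a qv|x q v a qv].
  rewrite /average; congr (_ *: _); apply: eq_bigr => m _.
  by have [tN _] := gt m; exact: tN.
under eq_bigr => i _ do rewrite /average scalerA mulrC -scalerA scaler_sumr.
rewrite -scaler_sumr exchange_big /=.
under eq_bigr => m _ do rewrite -(proj2 (gt m) x q v a qv).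
by rewrite sumr_const card_ord -scaler_nat scalerA mulVf // scale1r.
Qed.

Lemma average_invariant xi x' (h : ahom s0 x') b y' (h' : ahom s0 y') b' :
  primitive xi -> null h -> invariant xi h' b' -> invariant (average h b xi) h' b'.
Proof.
move=> gx nh inv x q v a qv z i j c ca cb.
rewrite /average; congr (_ *: _); apply: eq_bigr => m _.
exact: (translate_invariant b gx (nullMn m nh) inv).
Qed.

Lemma average_self_invariant xi x' (h : ahom s0 x') b :
  primitive xi -> null h -> invariant (average h b xi) h b.
Proof.
move=> gx nh x q v a qv z i j c ca cb; rewrite /average; congr (_ *: _).
(* Adding h turns the m-th translate into the next one, and by [translate0] the sum is cyclic. *)
transitivity (\sum_(m < N) translate (h *+ m.+1) b xi q v a).
  apply: eq_bigr => m _.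
  have qv' : smap X (acomp i q + acomp j h) m0 = cbase (cech_map i v).
    exact: null_compat.
  rewrite -(translateE (i := aid z) (j := j) (c := c) gx (nullMn m nh) qv') ?tm_id //.
  rewrite -(translateE (i := i) (j := j) (c := c) gx (nullMn m.+1 nh) qv) //.
  by rewrite acomp1m cech_map_id mulrS acompDr addrA.
case: N (translate0 b (q := q) (v := v) a gx nh qv) => [|M] E; first by rewrite !big_ord0.
by rewrite big_ord_recr big_ord_recl /= E addrC.
Qed.

Definition shift := {classic {s : S & (ahom s0 (o s) * tgt (o s))%type}}.

(** Averages over the shifts one at a time, which limits the argument to finitely many of them. *)
Lemma invariant_cochain xi (H : seq shift) :
  primitive xi -> (forall s h b, (existT _ s (h, b) : shift) \in H -> null h) ->
  exists xi', primitive xi' /\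
    forall s h b, (existT _ s (h, b) : shift) \in H -> invariant xi' h b.
Proof.
move=> gx; elim: H => [|[s [h b]] H IH] nH; first by exists xi.
have [|xi' [gx' inv]] := IH.
  by move=> s' h' b' Hs; apply: (nH s' h' b'); rewrite in_cons; apply/orP; right.
have nh : null h by apply: (nH s h b); rewrite in_cons eqxx.
exists (average h b xi'); split; first exact: average_primitive.
move=> s' h' b'; rewrite in_cons => /predU1P[E|/inv]; last exact: average_invariant.
move=> {IH nH inv}; have ss := congr1 (@projT1 _ _) E; rewrite /= in ss.
case: _ / ss h b nh E => h b nh E.
by have [-> ->] := existT_inj E; exact: average_self_invariant.
Qed.

End Translations.

(** By [spair_inj] the paths (q - j g2, g1) and (q - j g2, g2) to the biproduct end at the same
    point; the map (id, j) takes them to q + j (g1 - g2) and to q. *)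
Lemma null_sub (s0 : acob A) (m0 : X s0) x (g1 g2 : ahom s0 x) :
  smap X g1 m0 = smap X g2 m0 -> null m0 (g1 - g2).
Proof.
move=> g12 z q j; case: (bip z x) => y i1 j1 p1 q1 bipP.
have [pi qj pj qi _] := bipP.
pose q' := q - acomp j g2; pose r := p1 + acomp j q1.
have E : smap X (acomp i1 q' + acomp j1 g1) m0 = smap X (acomp i1 q' + acomp j1 g2) m0.
  apply: (spair_inj bipP); rewrite -!smap_comp !acompDr !acompA ?pi ?qj ?pj ?qi.
    by rewrite !acomp1m !acomp0l !addr0.
  by rewrite !acomp1m !acomp0l !add0r.
have rE g : acomp r (acomp i1 q' + acomp j1 g) = q' + acomp j g.
  rewrite !acompDr !acompDl !acompA -!(acompA j) pi qj pj qi.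
  by rewrite !(acomp0l, acomp0r, acomp1m, acompm1, addr0, add0r).
have := congr1 (smap X r) E; rewrite -!smap_comp !rE /q' subrK => <-.
by rewrite acompDr acompNr addrAC -addrA.
Qed.

Definition reach (c e : cpoint o X) :=
  exists r : ahom (o (projT1 c)) (o (projT1 e)), smap X r (projT2 c) = projT2 e.

Lemma reach_trans c d e : reach c d -> reach d e -> reach c e.
Proof.
by move=> [r rE] [r' rE']; exists (acomp r' r); rewrite smap_comp rE.
Qed.

Lemma reach_lab c e : reach c e -> lab X (projT2 c) = lab X (projT2 e).
Proof. by move=> [r <-]; rewrite lab_map. Qed.

(** Two points with the same label are the components of a point over the biproduct, which reaches
    both. This supplies the apex of the cone in [local_primitive_lab]. *)
Lemma reach_directed (E : seq {classic cpoint o X}) (e0 : cpoint o X) :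
  (forall e, e \in E -> lab X (projT2 e) = lab X (projT2 e0)) ->
  exists c, reach c e0 /\ forall e, e \in E -> reach c e.
Proof.
elim: E => [|e E IH] lE.
  by exists e0; split=> //; exists (aid _); rewrite smap_id.
have [|c [ce0 cE]] := IH; first by move=> d dE; apply: lE; rewrite in_cons dE orbT.
case: (bip (o (projT1 c)) (o (projT1 e))) => z i j p q bipP.
have [|m [pm qm]] := spair bipP (u := projT2 c) (v := projT2 e).
  by rewrite (reach_lab ce0) lE // in_cons eqxx.
have [s [f [g [_ fg]]]] := oP z.
have rm y (t : ahom z y) : smap X (acomp t f) (smap X g m) = smap X t m.
  by rewrite smap_comp -(smap_comp f) [acomp f g]fg smap_id.
pose d : cpoint o X := existT _ s (smap X g m).
have dc : reach d c by exists (acomp p f); rewrite /= rm.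
exists d; split; first exact: reach_trans ce0.
move=> e'; rewrite in_cons => /predU1P[->|/cE]; last exact: reach_trans.
by exists (acomp q f); rewrite /= rm.
Qed.

Definition simplex n := {classic {s : S & (cech n (o s) * tgt (o s))%type}}.

(** The averaged cone becomes independent of a path by taking the path through the first vertex.
    Among the faces only the one that omits this vertex changes the path, by a difference under
    which xi is invariant. *)
Lemma local_primitive_lab n (theta : cochain n.+2) : natural theta ->
  (forall x v a, @codiff _ theta x v a = 0) ->
  forall (l : label X) (Z : seq (simplex n.+2)),
  exists eta : cochain n.+1, natural eta /\
    forall s v a, (existT _ s (v, a) : simplex n.+2) \in Z ->
      lab X (cbase v) = l -> codiff eta v a = theta _ v a.
Proof.
move=> thN thC l Z.
pose Zl : seq (simplex n.+2) :=
  filter (fun w : simplex n.+2 => `[< lab X (cbase (projT2 w).1) = l >]) Z.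
pose pt (i : 'I_n.+2) (w : simplex n.+2) : {classic cpoint o X} :=
  projT1 (cpts (projT2 w).1 i).
pose one : 'I_n.+2 := lift ord0 ord0.
have ptl i w : lab X (projT2 (pt i w)) = lab X (cbase (projT2 w).1).
  by rewrite -(cechP (projT2 w).1 i) lab_map.
have ZlP (w : simplex n.+2) : w \in Zl -> lab X (cbase (projT2 w).1) = l.
  by rewrite mem_filter => /andP[/asboolP].
case E : Zl => [|w0 Z0].
  exists (fun _ _ _ => 0); split=> // s v a yZ vl.
  suff : (existT _ s (v, a) : simplex n.+2) \in Zl by rewrite E.
  by rewrite mem_filter yZ andbT; exact/asboolP.
have w0l : lab X (cbase (projT2 w0).1) = l by apply: ZlP; rewrite E mem_head.
have [|c [_ cE]] := @reach_directed (map (pt ord0) Zl ++ map (pt one) Zl) (pt ord0 w0).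
  by move=> e; rewrite mem_cat => /orP[] /mapP[w /ZlP wl ->]; rewrite !ptl wl w0l.
have cpt i (w : simplex n.+2) : w \in Zl -> (i == ord0) || (i == one) ->
    reach c (pt i w).
  move=> wZ /orP[] /eqP ->; apply: cE; rewrite mem_cat; apply/orP; [left|right];
  exact: map_f.
have {cE E w0l w0 Z0} [r rP] : exists r : forall e : cpoint o X, ahom (o (projT1 c)) (o (projT1 e)),
    forall e, reach c e -> smap X (r e) (projT2 c) = projT2 e.
  exists (fun e => if pselect (reach c e) is left H then projT1 (cid H) else 0).
  by move=> e ce; case: pselect => // H; case: cid.
pose s0 := o (projT1 c); pose m0 : X s0 := projT2 c.
pose mkpt x (q : ahom s0 x) : cover_pt o X x :=
  existT (fun l : cpoint o X => ahom (o (projT1 l)) x) c q.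
(* the cone with apex c *)
pose xi0 : pcochain n s0 := fun x q v a =>
  if pselect (smap X q m0 = cbase v) is left H
  then theta x (@ccons A S o X n.+1 x v (mkpt x q) H) a else 0.
have gx0 : primitive theta m0 xi0.
  split=> [x y f q v a qv|x q v a qv].
    rewrite /xi0; case: pselect => [H|[]]; last by rewrite /= ?smap_comp qv.
    case: pselect => // H'; rewrite -thN; congr (theta _ _ _).
    apply: cech_ext => //= i; rewrite /ccons_pts.
    by case: unliftP.
  have := thC x (@ccons A S o X n.+2 x v (mkpt x q) qv) a.
  rewrite /codiff big_ord_recl expr0 scale1r cface0_cons => /eqP.
  rewrite addr_eq0 => /eqP ->; rewrite -sumrN; apply: eq_bigr => i _.
  rewrite lift0 exprS mulN1r scaleNr opprK; congr (_ *: _).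
  rewrite cfaceS_cons /xi0; case: pselect => // H.
  by congr (theta _ _ _); apply: cech_ext.
pose pth x (p : cover_pt o X x) := acomp (projT2 p) (r (projT1 p)).
have pthE n' x (v : cech n' x) i : reach c (projT1 (cpts v i)) ->
    smap X (pth x (cpts v i)) m0 = cbase v.
  by move=> ce; rewrite /pth smap_comp rP // -(cechP v i).
pose sh (w : simplex n.+2) : shift s0 := existT _ (projT1 w)
  (pth _ (cpts (projT2 w).1 one) - pth _ (cpts (projT2 w).1 ord0), (projT2 w).2).
have [|xi [gx inv]] := invariant_cochain (H := map sh Zl) thN gx0.
  move=> s h b /mapP[[s' [v' a']] wZ Ey]; have ss := congr1 (@projT1 _ _) Ey.
  rewrite /= in ss; case: _ / ss v' a' wZ Ey => v' a' wZ Ey.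
  have [-> _] := existT_inj Ey.
  have c0 : reach c (projT1 (cpts v' ord0)) by apply: (cpt _ _ wZ); rewrite eqxx.
  have c1 : reach c (projT1 (cpts v' one)) by apply: (cpt _ _ wZ); rewrite eqxx orbT.
  by apply: null_sub; rewrite !pthE.
(* Maps preserve the [cpoint] of the first vertex, hence also whether c reaches it; so the default
   value 0 keeps this natural. *)
exists (fun x v a => let p := cpts v ord0 in
  if pselect (reach c (projT1 p)) then xi x (pth x p) v a else 0).
split=> [x y f v a|s v a yZ vl] /=.
  case: pselect => // ce /=; have [xiN _] := gx; rewrite -xiN; last exact: pthE.
  by rewrite /pth /= acompA.
have yZl : (existT _ s (v, a) : simplex n.+2) \in Zl.
  by rewrite mem_filter yZ andbT; exact/asboolP.
have c0 : reach c (projT1 (cpts v ord0)) by apply: (cpt _ _ yZl); rewrite eqxx ?orbT.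
have c1 : reach c (projT1 (cpts v one)) by apply: (cpt _ _ yZl); rewrite eqxx ?orbT.
rewrite (proj2 gx _ (pth _ (cpts v ord0)) v a (pthE _ _ _ _ c0)).
rewrite /codiff big_ord_recl [RHS]big_ord_recl; congr (_ *: _ + _).
  case: pselect => //= _.
  have := inv _ _ _ (map_f sh yZl) _ (pth _ (cpts v ord0)) (cface ord0 v) a
    (pthE _ _ _ _ c0) _ (aid _) (aid _) a (tm_id a) (tm_id a).
  by rewrite !acomp1m cech_map_id addrC subrK.
apply: eq_bigr => i _; congr (_ *: _).
have -> : cpts (cface (lift ord0 i) v) ord0 = cpts v ord0.
  by congr (cpts v _); exact: val_inj.
by case: pselect.
Qed.

(** Maps preserve labels, so primitives chosen for each label glue to a natural one. *)
Lemma local_primitive n (theta : cochain n.+2) : natural theta ->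
  (forall x v a, @codiff _ theta x v a = 0) ->
  forall Z : seq (simplex n.+2),
  exists eta : cochain n.+1, natural eta /\
    forall s v a, (existT _ s (v, a) : simplex n.+2) \in Z ->
      codiff eta v a = theta _ v a.
Proof.
move=> thN thC Z.
have [f fP] := choice (fun l => local_primitive_lab thN thC l Z).
exists (fun x v a => f (lab X (cbase v)) x v a); split=> [x y t v a|s v a vZ].
  by rewrite /= lab_map; have [fN _] := fP (lab X (cbase v)); exact: fN.
by have [_] := fP (lab X (cbase v)); apply.
Qed.

Local Notation free n := ({freeg (simplex n) / k} : lmodType k).

Definition cochain_eval n (eta : cochain n) : {linear free n -> W} :=
  flift (fun w : simplex n => eta _ (projT2 w).1 (projT2 w).2).

Definition simplex_bd n : {linear free n.+1 -> free n} :=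
  flift (fun w : simplex n.+1 => \sum_(i < n.+1) (-1) ^+ i *:
    << (existT _ (projT1 w) (cface i (projT2 w).1, (projT2 w).2) : simplex n) >>).

Lemma cochain_eval_bd n (eta : cochain n) e :
  cochain_eval eta (simplex_bd n e) = cochain_eval (codiff eta) e.
Proof.
apply: (flift_ext2 (f := simplex_bd n) (g := cochain_eval eta)
  (f' := idfun) (g' := cochain_eval (codiff eta))) => w.
rewrite [X in _ X = _]fliftU [RHS]fliftU linear_sum; apply: eq_bigr => i _.
by rewrite linearZ; congr (_ *: _); rewrite [LHS]fliftU.
Qed.

(* The chains killed by all natural cochains are the relations of the coend of
   k[cech n] and k[tgt]. *)
Definition chain_rel n (e : free n) :=
  forall eta : cochain n, natural eta -> cochain_eval eta e = 0.

Fact chain_rel_sub n : submodule (@chain_rel n).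
Proof.
split=> [eta _|c u v ru rv eta etaN]; first exact: linear0.
by rewrite linearP ru // rv // scaler0 addr0.
Qed.

(** A linear map from chains modulo [chain_rel] to W is a natural cochain. To factor theta through
    the boundary, theta must kill every e whose boundary is a relation; a primitive on the finite
    support of e shows that it does. *)
Lemma row_zero n (theta : cochain n.+2) : natural theta ->
  (forall x v a, @codiff _ theta x v a = 0) ->
  exists eta : cochain n.+1, natural eta /\
    forall x v a, @codiff _ eta x v a = theta _ v a.
Proof.
move=> thN thC.
pose pi := linear_of (qpi_linear (@chain_rel_sub n.+1)).
have [|h hP] := @linear_factor k _ _ W
    (pi \o simplex_bd n.+1 : {linear free n.+2 -> _}) (cochain_eval theta).
  move=> e e0; have {e0} /qpi_eq e0 : pi (simplex_bd n.+1 e) = pi 0.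
    by rewrite linear0.
  have [eta [etaN etaP]] := local_primitive thN thC (dom e).
  have := e0 _ etaN; rewrite subr0 cochain_eval_bd => <-.
  rewrite -[e]freeg_sumE !linear_sum.
  rewrite !big_seq; apply: eq_bigr => w we; rewrite freeg_scaleU !linearZ.
  congr (_ *: _); rewrite [LHS]fliftU [RHS]fliftU.
  by case: w we => s [v a] we /=; rewrite etaP.
pose sk (x : A) : S := projT1 (cid (oP x)).
pose sk_in x : ahom (o (sk x)) x := projT1 (cid (projT2 (cid (oP x)))).
pose sk_out x : ahom x (o (sk x)) :=
  projT1 (cid (projT2 (cid (projT2 (cid (oP x)))))).
have sk_io x : acomp (sk_in x) (sk_out x) = aid x.
  exact: (projT2 (cid (projT2 (cid (projT2 (cid (oP x))))))).2.
(* Chains only involve simplices over the objects o s; [cell] moves a simplex over x to one of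
   them. *)
pose cell n x (v : cech n x) a : simplex n :=
  existT _ (sk x) (cech_map (sk_out x) v, tm (sk_in x) a).
have cellE m (eta : cochain m) : natural eta -> forall x v a,
    cochain_eval eta << @cell m x v a >> = eta x v a.
  by move=> eN x v a; rewrite [LHS]fliftU /= eN -tm_comp sk_io tm_id.
exists (fun x v a => h (pi << cell _ _ v a >>)); split=> [x y f v a|x v a].
  congr (h _); apply/qpi_eq => eta eN; apply/eqP.
  by rewrite linearB !cellE // eN subrr.
rewrite -(cellE _ _ thN) -hP.
rewrite -[RHS]/(h (pi (simplex_bd n.+1 << @cell n.+2 x v a >>))).
have -> : simplex_bd n.+1 << @cell n.+2 x v a >> =
    \sum_(i < n.+2) (-1) ^+ i *: << @cell n.+1 x (cface i v) a >>.
  by rewrite [LHS]fliftU; apply: eq_bigr => i _; congr (_ *: << _ >>).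
by rewrite !linear_sum; apply: eq_bigr => i _; rewrite !linearZ.
Qed.

Local Notation C n := (freef k (cechf o X n)).

Lemma row_zero_nt n (theta : nattrans (C n.+2) funf) :
  (forall x w, theta x (cdiff k o X n.+2 x w) = 0) ->
  exists eta : nattrans (C n.+1) funf,
    forall x w, eta x (cdiff k o X n.+1 x w) = theta x w.
Proof.
move=> thC.
pose th : cochain n.+2 := fun x v a =>
  (theta x << (v : sgen (cechf o X n.+2) x) >> : dfun _) a.
have [||eta [etaN etaP]] := @row_zero n th.
- move=> x y f v a; have := ntr_nat theta f << (v : sgen (cechf o X n.+2) x) >>.
  by rewrite [X in theta y X]freef_mapU => /(congr1 (fun g : dfun _ => g a)).
- move=> x v a.
  have := thC x << (v : sgen (cechf o X n.+3) x) >>; rewrite cdiffU /cbd linear_sum.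
  move=> /(congr1 (fun g : dfun _ => g a)); rewrite -[RHS]/0 => <-.
  pose ea := linear_of (f := fun g : dfun (fun _ : tgt x => W) => g a)
    (fun _ _ _ => erefl).
  rewrite -[RHS]/(ea _) linear_sum; apply: eq_bigr => i _.
  by rewrite linearZ.
pose e x (v : cech n.+1 x) : dfun (fun _ : tgt x => W) := eta x v.
have eN (x y : acob A) (f : ahom x y) (v : cech n.+1 x) :
    e y (smap (cechf o X n.+1) f v) = @kmap k A funf x y f (e x v).
  by apply/funext => a; exact: etaN.
pose g := @freef_lift k A (cechf o X n.+1) funf e eN; exists g.
suff H : forall x w, nt_comp g (cdiff k o X n.+1) x w = theta x w by [].
apply: freef_ext => x v.
rewrite -[LHS]/(g x (cdiff k o X n.+1 x << v >>)) cdiffU /cbd linear_sum.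
apply/funext => a; rewrite -[RHS]/(th x v a) -etaP.
pose ea := linear_of (f := fun g : dfun (fun _ : tgt x => W) => g a)
  (fun _ _ _ => erefl).
rewrite -[LHS]/(ea _) linear_sum; apply: eq_bigr => i _.
rewrite !linearZ; congr (_ *: _).
exact: (congr1 (fun f : dfun _ => f a) (@freef_liftU k A (cechf o X n.+1) funf e eN x _)).
Qed.

End RowZero.

(** * Dimension shifting along the nerve *)

Section FreeAcyclic.
Variables (S : Type) (o : S -> acob A).
Hypothesis oP : forall x : A, exists s, @isomorphic A (o s) x.

Section CechSyzygies.
Variable X : afset A.
Local Notation C n := (freef k (cechf o X n)).

Definition csyz n : kfunctor k A :=
  if n is m.+1 then kerf (cdiff k o X m) else C 0.

Definition csyz_map n : nattrans (C n.+1) (csyz n) :=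
  match n return nattrans (C n.+1) (csyz n) with
  | 0 => cdiff k o X 0
  | m.+1 => @kerf_lift k A _ _ _ (cdiff k o X m) (cdiff k o X m.+1) (@cdiff_cdiff k A S o oP X m)
  end.

Lemma csyz_map_epi n : epi_trans (csyz_map n).
Proof.
case: n => [|n] x w; first exact: (cdiff0_epi oP).
have [v wv] := cdiff_exact oP (kerfE w).
by exists v; apply: val_inj; rewrite wv.
Qed.

Lemma csyz_map_exact n x (v : C n.+1 x) :
  csyz_map n x v = 0 <-> exists u : csyz n.+1 x, v = kerf_in (cdiff k o X n) x u.
Proof.
have -> : csyz_map n x v = 0 <-> cdiff k o X n x v = 0.
  case: n v => // n v; split=> [/(congr1 val)|v0] //; exact: val_inj.
split=> [v0|[u ->]]; last exact: kerfE.
by exists (kerf_elt v0).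
Qed.

(** In the top degree i only syzygy 0 is claimed: it rests on C 1, which is projective, and on the
    next syzygy one degree lower. [row_zero_nt] is the start in degree 0. *)
Lemma acyc_csyz i : (forall j, (j < i)%N -> forall Y : afset A, acyc funf j (freef k Y)) ->
  forall j n, (j <= i)%N -> (j < i)%N || (n == 0)%N -> acyc funf j (csyz n).
Proof.
move=> aY; have aC j n : (j < i)%N || (n == 0)%N -> acyc funf j (C n.+1).
  by case/orP=> [/aY|/eqP ->] //; apply: acyc_proj; exact: cech1_proj.
elim=> [|j IH] n ji jn.
  apply: (@acyc_shift0 k A funf (csyz n) (C n.+1) (csyz n.+1) (csyz_map n)
    (kerf_in (cdiff k o X n)) (@csyz_map_epi n) (@csyz_map_exact n)).
    exact: aC.
  move=> h.
  have [|eta etaP] := @row_zero_nt S o oP X n (nt_comp h (csyz_map n.+1)).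
    move=> x w; rewrite -[LHS]/(h x (csyz_map n.+1 x (cdiff k o X n.+2 x w))).
    rewrite (_ : csyz_map n.+1 x _ = 0) ?linear0 //.
    by apply: val_inj; exact: cdiff_cdiff.
  exists eta => x u; have [w <-] := csyz_map_epi u.
  exact: etaP.
apply: (@acyc_shift k A S o oP funf (csyz n) (C n.+1) (csyz n.+1) (csyz_map n)
    (kerf_in (cdiff k o X n)) (@csyz_map_epi n) _ (@csyz_map_exact n)).
- by move=> x u u0; exact: val_inj.
- exact: aC.
- by apply: IH; [exact: ltnW|rewrite ji].
Qed.

End CechSyzygies.

Lemma acyc_freef i (X : afset A) : acyc funf i (freef k X).
Proof.
have [j] := ubnP i; elim: j i X => // j IH i X ij.
pose e x (u : X x) : cech o X 0 x :=
  @Cech A S o X 0 x u (fun i => False_rect _ (notF (valP i)))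
    (fun i => False_ind _ (notF (valP i))).
have eN (x y : acob A) (f : ahom x y) (u : X x) :
    << (e y (smap X f u) : sgen (cechf o X 0) y) >> =
    @kmap k A (freef k (cechf o X 0)) x y f << (e x u : sgen (cechf o X 0) x) >>.
  by rewrite freef_mapU; congr << _ >>; apply: cech_ext => //= -[].
have rN (x y : acob A) (f : ahom x y) (v : cech o X 0 x) :
    << (cbase (cech_map f v) : sgen X y) >> =
    @kmap k A (freef k X) x y f << (cbase v : sgen X x) >>.
  by rewrite freef_mapU.
apply: (acyc_retract oP (s := @freef_lift k A X (freef k (cechf o X 0)) _ eN)
  (r := @freef_lift k A (cechf o X 0) (freef k X) _ rN)).
  move=> x v.
  apply: (flift_ext2 (f := @freef_lift k A X (freef k (cechf o X 0)) _ eN x)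
    (g := @freef_lift k A (cechf o X 0) (freef k X) _ rN x)
    (f' := idfun) (g' := idfun)) => u.
  by rewrite (@freef_liftU k A X) [LHS](@freef_liftU k A (cechf o X 0)).
apply: (@acyc_csyz X i _ i 0) => //; last by rewrite orbT.
by move=> l li Y; apply: IH; exact: leq_trans li _.
Qed.

End FreeAcyclic.
End TorsionTarget.

(** * Separability of finite regular categories *)

(* The properties of the category of finitely generated modules over a finite
   semisimple ring on which separability depends. *)
Record frcat := FRCat {
  rob :> Type;
  rhom : rob -> rob -> finZmodType;
  rid : forall x, rhom x x;
  rcomp : forall x y z, rhom y z -> rhom x y -> rhom x z;
  rcomp1m : forall x y (f : rhom x y), rcomp (rid y) f = f;
  rcompm1 : forall x y (f : rhom x y), rcomp f (rid x) = f;
  rcompA : forall x y z t (h : rhom z t) (g : rhom y z) (f : rhom x y),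
    rcomp h (rcomp g f) = rcomp (rcomp h g) f;
  rcompDl : forall x y z (g g' : rhom y z) (f : rhom x y),
    rcomp (g + g') f = rcomp g f + rcomp g' f;
  rcompDr : forall x y z (g : rhom y z) (f f' : rhom x y),
    rcomp g (f + f') = rcomp g f + rcomp g f';
  rsplit : forall x (e : rhom x x), rcomp e e = e ->
    exists y (a : rhom y x) (b : rhom x y), rcomp b a = rid y /\ rcomp a b = e;
  rreg : forall x y (f : rhom x y), exists g, rcomp (rcomp f g) f = f }.

Arguments rid {f} x : rename.
Notation "g ** f" := (rcomp g f) (at level 40, left associativity).

Definition frop (C : frcat) : frcat.
Proof.
refine (@FRCat C (fun x y => rhom y x) (fun x => rid x) (fun x y z g f => f ** g)
  _ _ _ _ _ _ _).
- by move=> x y f; exact: rcompm1.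
- by move=> x y f; exact: rcomp1m.
- by move=> x y z t h g f; rewrite rcompA.
- by move=> x y z g g' f; exact: rcompDr.
- by move=> x y z g f f'; exact: rcompDl.
- by move=> x e /rsplit[y [a [b [ba ab]]]]; exists y, b, a.
- by move=> x y f; have [g gP] := rreg f; exists g; rewrite rcompA.
Defined.

(** * Retracts, indecomposables and multiplicities *)

Section RegularCategory.
Variable C : frcat.
Implicit Types x y z S T V : C.

Lemma rcomp0l x y z (f : rhom x y) : (0 : rhom y z) ** f = 0.
Proof. by apply: (@addrI _ (0 ** f)); rewrite -rcompDl !addr0. Qed.
Lemma rcomp0r x y z (g : rhom y z) : g ** (0 : rhom x y) = 0.
Proof. by apply: (@addrI _ (g ** 0)); rewrite -rcompDr !addr0. Qed.
Lemma rcompNl x y z (g : rhom y z) (f : rhom x y) : (- g) ** f = - (g ** f).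
Proof. by apply: (@addrI _ (g ** f)); rewrite -rcompDl !subrr rcomp0l. Qed.
Lemma rcompNr x y z (g : rhom y z) (f : rhom x y) : g ** (- f) = - (g ** f).
Proof. by apply: (@addrI _ (g ** f)); rewrite -rcompDr !subrr rcomp0r. Qed.
Lemma rcompBl x y z (g g' : rhom y z) (f : rhom x y) :
  (g - g') ** f = g ** f - g' ** f.
Proof. by rewrite rcompDl rcompNl. Qed.
Lemma rcompBr x y z (g : rhom y z) (f f' : rhom x y) :
  g ** (f - f') = g ** f - g ** f'.
Proof. by rewrite rcompDr rcompNr. Qed.

Definition retract x y := exists (i : rhom x y) (r : rhom y x), r ** i = rid x.
Definition riso x y :=
  exists (i : rhom x y) (r : rhom y x), r ** i = rid x /\ i ** r = rid y.
Definition esize x := #|rhom x x|.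

Lemma retract_trans x y z : retract x y -> retract y z -> retract x z.
Proof.
move=> [i [r ri]] [j [s sj]]; exists (j ** i), (r ** s).
by rewrite rcompA -(rcompA r) sj rcompm1.
Qed.

Lemma riso_retract x y : riso x y -> retract x y.
Proof. by move=> [i [r [ri _]]]; exists i, r. Qed.
Lemma riso_sym x y : riso x y -> riso y x.
Proof. by move=> [i [r [ri ir]]]; exists r, i. Qed.
Lemma riso_refl x : riso x x.
Proof. by exists (rid x), (rid x); rewrite rcomp1m. Qed.
Lemma riso_trans x y z : riso x y -> riso y z -> riso x z.
Proof.
move=> [i [r [ri ir]]] [j [s [sj js]]]; exists (j ** i), (r ** s).
by rewrite !rcompA -(rcompA r) sj -(rcompA j) ir !rcompm1 ri js.
Qed.

(** The embedding f |-> i f r of End x in End y misses the identity; [None] is sent there, which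
    makes the inequality strict. *)
Lemma esize_retract x y (i : rhom x y) (r : rhom y x) :
  r ** i = rid x -> i ** r != rid y -> (esize x < esize y)%N.
Proof.
move=> ri ir; pose h (u : option (rhom x x)) : rhom y y :=
  if u is Some f then i ** f ** r else rid y.
have hK f : r ** (i ** f ** r) ** i = f.
  by rewrite -!rcompA ri rcompm1 rcompA ri rcomp1m.
rewrite /esize -card_option; apply: (@leq_card _ _ h) => -[f|] [g|] //= E.
- by congr Some; rewrite -[f]hK E hK.
- case/eqP: ir; have fE : f = rid x by rewrite -[f]hK E rcompm1.
  by rewrite -E fE rcompm1.
- case/eqP: ir; have gE : g = rid x by rewrite -[g]hK -E rcompm1.
  by rewrite E gE rcompm1.
Qed.

Lemma retract_leq x y : retract x y -> (esize x <= esize y)%N.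
Proof.
move=> [i [r ri]]; have [ir|ir] := eqVneq (i ** r) (rid y); last first.
  exact: ltnW (esize_retract ri ir).
apply: (@leq_card _ _ (fun f => i ** f ** r)) => f g E.
have hK u : r ** (i ** u ** r) ** i = u.
  by rewrite -!rcompA ri rcompm1 rcompA ri rcomp1m.
by rewrite -[f]hK E hK.
Qed.

Lemma retract_antisym x y : retract x y -> retract y x -> riso x y.
Proof.
move=> [i [r ri]] /retract_leq yx; exists i, r; split=> //.
by apply/eqP; apply: contraTT yx => ir; rewrite -ltnNge (esize_retract ri).
Qed.

Lemma endo_inv x (f g : rhom x x) : f ** g = rid x -> g ** f = rid x.
Proof.
move=> fg; have ginj : injective (fun h : rhom x x => g ** h).
  by move=> h h' /= E; rewrite -[h]rcomp1m -fg -rcompA E rcompA fg rcomp1m.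
have := f_invF ginj (rid x); move: (invF _ _) => h gh.
by rewrite -[RHS]gh -[f]rcompm1 -gh (rcompA f) fg rcomp1m.
Qed.

Definition indec S := rid S != 0 /\ forall e : rhom S S, e ** e = e -> e = 0 \/ e = rid S.

Lemma exists_indec V : rid V != 0 -> exists S, indec S /\ retract S V.
Proof.
have [n] := ubnP (esize V); elim: n V => // n IH V Vn V0.
have [iV|] := pselect (indec V); first by
  exists V; split=> //; exists (rid V), (rid V); rewrite rcomp1m.
move=> /not_andP[/negP/negPn/eqP|/existsNP[e /not_implyP[ee /not_orP[e0 e1]]]].
  by move/eqP: V0.
have [y [a [b [ba ab]]]] := rsplit ee.
have y0 : rid y != 0.
  apply: contra_not_neq e0 => y0.
  by rewrite -ab -[a]rcompm1 y0 rcomp0r rcomp0l.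
have yV : (esize y < esize V)%N.
  by apply: (esize_retract ba); rewrite ab; exact/eqP.
have [|S [iS Sy]] := IH y _ y0; first exact: leq_trans yV _.
by exists S; split=> //; apply: retract_trans Sy _; exists a, b.
Qed.

(** By regularity some g m is an idempotent with m (g m) = m; it is nonzero, hence the identity. *)
Lemma indec_mono S V (m : rhom S V) : indec S -> m != 0 -> exists l, l ** m = rid S.
Proof.
move=> [_ iS] m0; have [g gP] := rreg m.
have [|gm|gm] := iS (g ** m); last by exists g.
  by rewrite rcompA -(rcompA g) -(rcompA g) gP.
by case/eqP: m0; rewrite -gP -rcompA gm rcomp0r.
Qed.

Lemma indec_epi S V (l : rhom V S) : indec S -> l != 0 -> exists m, l ** m = rid S.
Proof.
move=> [_ iS] l0; have [g gP] := rreg l.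
have [|gm|gm] := iS (l ** g); last by exists g.
  by rewrite rcompA gP.
by case/eqP: l0; rewrite -gP gm rcomp0l.
Qed.

Lemma indec_card S S' : indec S -> indec S' -> #|rhom S S'| = #|rhom S' S|.
Proof.
have nz T T' (f : rhom T T') : indec T -> indec T' -> f != 0 -> #|rhom T T'| = #|rhom T' T|.
  move=> iT iT' f0; have [l lf] := indec_mono iT f0; have [m fm] := indec_epi iT' f0.
  have lm : l = m by rewrite -[l]rcompm1 -fm rcompA lf rcomp1m.
  rewrite -{}lm in fm.
  apply: (@bij_eq_card _ _ (fun h => l ** h ** l)); exists (fun h => f ** h ** f) => h.
    by rewrite !rcompA fm rcomp1m -rcompA lf rcompm1.
  by rewrite !rcompA lf rcomp1m -rcompA fm rcompm1.
move=> iS iS'; have [[f f0]|nf] := pselect (exists f : rhom S S', f != 0).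
  exact: nz f0.
have [[g g0]|ng] := pselect (exists g : rhom S' S, g != 0).
  exact/esym/(nz _ _ _ iS' iS g0).
have z (T T' : C) : ~ (exists f : rhom T T', f != 0) -> #|rhom T T'| = 1%N.
  move=> nh; apply/eqP/card1P; exists 0 => h; rewrite [h \in _]inE inE; apply/esym/eqP.
  by apply: contrapT => /eqP h0; apply: nh; exists h.
by rewrite !z.
Qed.

Definition is_dsum V V1 S (i : rhom V1 V) (p : rhom V V1) (m : rhom S V) (l : rhom V S) :=
  [/\ p ** i = rid V1, l ** m = rid S, p ** m = 0, l ** i = 0 & i ** p + m ** l = rid V].

Lemma exists_dsum V S (m : rhom S V) (l : rhom V S) : l ** m = rid S ->
  exists V1 (i : rhom V1 V) (p : rhom V V1), is_dsum i p m l.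
Proof.
move=> lm; pose e := rid V - m ** l.
have em : e ** m = 0 by rewrite rcompBl rcomp1m -rcompA lm rcompm1 subrr.
have le : l ** e = 0 by rewrite rcompBr rcompm1 rcompA lm rcomp1m subrr.
have ee : e ** e = e by rewrite {2}/e rcompBr rcompm1 rcompA em rcomp0l subr0.
have [V1 [i [p [pi ip]]]] := rsplit ee; exists V1, i, p; split=> //.
- by rewrite -[p]rcomp1m -pi -!rcompA (rcompA i) ip em rcomp0r.
- by rewrite -[i]rcompm1 -pi !rcompA -(rcompA l) ip le rcomp0l.
- by rewrite ip subrK.
Qed.

Lemma card_dsum_l V V1 S (i : rhom V1 V) p (m : rhom S V) l Y : is_dsum i p m l ->
  #|rhom V Y| = (#|rhom V1 Y| * #|rhom S Y|)%N.
Proof.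
move=> [pi lm pm li E]; rewrite -card_prod.
apply: (@bij_eq_card _ _ (fun f => (f ** i, f ** m))).
exists (fun u => u.1 ** p + u.2 ** l) => [f|[u v]] /=.
  by rewrite -!rcompA -rcompDr E rcompm1.
by rewrite !rcompDl -!rcompA pi lm pm li !rcompm1 !rcomp0r addr0 add0r.
Qed.

Lemma card_dsum_r V V1 S (i : rhom V1 V) p (m : rhom S V) l Y : is_dsum i p m l ->
  #|rhom Y V| = (#|rhom Y V1| * #|rhom Y S|)%N.
Proof.
move=> [pi lm pm li E]; rewrite -card_prod.
apply: (@bij_eq_card _ _ (fun f => (p ** f, l ** f))).
exists (fun u => i ** u.1 + m ** u.2) => [f|[u v]] /=.
  by rewrite !rcompA -rcompDl E rcomp1m.
by rewrite !rcompDr !rcompA pi lm pm li !rcomp1m !rcomp0l addr0 add0r.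
Qed.

Lemma rhom_gt0 x y : (0 < #|rhom x y|)%N.
Proof. by apply/card_gt0P; exists 0. Qed.

(** Cardinals of homs to and from S measure the multiplicity of S. A common summand S is split off
    from V and T, which divides the two sides by factors equal by [indec_card]. *)
Lemma retract_criterion V T :
  (forall S, indec S -> (#|rhom V S| <= #|rhom S T|)%N) -> retract V T.
Proof.
have [n] := ubnP (esize V); elim: n V T => // n IH V T Vn H.
have [V0|V0] := eqVneq (rid V) 0; first by exists 0, 0; rewrite rcomp0l.
have [S [iS [m [l lm]]]] := exists_indec V0.
have l0 : l != 0.
  by apply: contra_neq iS.1 => l0; rewrite -lm l0 rcomp0l.
have [m' m'0] : exists m' : rhom S T, m' != 0.
  apply: contrapT => nm'; have : (#|rhom V S| <= 1)%N.
    apply: leq_trans (H S iS) _; apply/card_le1_eqP => f g _ _.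
    have z (h : rhom S T) : h = 0.
      by apply: contrapT => /eqP h0; apply: nm'; exists h.
    by rewrite [f]z [g]z.
  by move/card_le1_eqP => /(_ l 0 isT isT) E; rewrite E eqxx in l0.
have [l' lm'] := indec_mono iS m'0.
have [V1 [i [p D]]] := exists_dsum lm; have [T1 [i' [p' D']]] := exists_dsum lm'.
have [pi _ pm li E] := D; have [pi' _ pm' li' E'] := D'.
have V1V : (esize V1 < esize V)%N.
  apply: (esize_retract pi); apply: contra_neq l0 => ip.
  by rewrite -[l]rcompm1 -ip rcompA li rcomp0l.
have [||j [r rj]] := IH V1 T1; first exact: leq_trans V1V _.
  move=> S' iS'; have := H S' iS'.
  rewrite (card_dsum_l _ D) (card_dsum_r _ D') (indec_card iS iS').
  by rewrite leq_pmul2r ?rhom_gt0.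
exists (i' ** j ** p + m' ** l), (i ** r ** p' + m ** l').
rewrite rcompDl !rcompDr -!rcompA (rcompA p' i') pi' (rcompA p' m') pm'.
rewrite (rcompA l' i') li' (rcompA l' m') lm' !(rcomp0l, rcomp0r, rcomp1m).
by rewrite addr0 add0r (rcompA r) rj rcomp1m.
Qed.

End RegularCategory.

(** * The linearised category k[C] *)

Section HomAlgebra.
Variables (k : fieldType) (C : frcat).
Implicit Types x y z S T V : C.

(* k[Hom(x, y)], with basis [dl f]. *)
Definition halg x y := {ffun rhom x y -> k^o}.

Definition dl x y (f : rhom x y) : halg x y := [ffun h => (h == f)%:R].

Definition conv x y z (c : halg y z) (d : halg x y) : halg x z :=
  [ffun h => \sum_g \sum_f c g * d f * (g ** f == h)%:R].

Lemma sum_delta (I : finType) (i : I) (F : I -> k) :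
  \sum_j (i == j)%:R * F j = F i.
Proof.
rewrite (bigD1 i) //= eqxx mul1r big1 ?addr0 // => j /negPf.
by rewrite eq_sym => ->; rewrite mul0r.
Qed.

Lemma conv_sum x y z (c : halg y z) (d : halg x y) (b : rhom x z -> k) :
  \sum_h conv c d h * b h = \sum_g \sum_f c g * d f * b (g ** f).
Proof.
under eq_bigr => h _ do rewrite ffunE mulr_suml.
rewrite exchange_big; apply: eq_bigr => g _ /=.
under eq_bigr => h _ do rewrite mulr_suml.
rewrite exchange_big; apply: eq_bigr => f _ /=.
by under eq_bigr => h _ do rewrite -mulrA; rewrite -mulr_sumr sum_delta.
Qed.

Lemma convA x y z t (a : halg z t) (b : halg y z) (c : halg x y) :
  conv a (conv b c) = conv (conv a b) c.
Proof.
apply/ffunP => h; rewrite ffunE [RHS]ffunE.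
under [RHS]eq_bigr => u _ do under eq_bigr => f _ do rewrite -mulrA.
under [RHS]eq_bigr => u _ do rewrite -mulr_sumr.
rewrite conv_sum; apply: eq_bigr => g _.
under eq_bigr => u _ do rewrite [a g * _]mulrC -mulrA.
rewrite conv_sum; apply: eq_bigr => g' _; rewrite mulr_sumr; apply: eq_bigr => f _.
by rewrite rcompA; ring.
Qed.

Lemma convDl x y z (a a' : halg y z) (c : halg x y) : conv (a + a') c = conv a c + conv a' c.
Proof.
apply/ffunP => h; rewrite !ffunE -big_split; apply: eq_bigr => g _ /=.
by rewrite -big_split; apply: eq_bigr => f _; rewrite ffunE (mulrDl (a g)) mulrDl.
Qed.
Lemma convDr x y z (a : halg y z) (c c' : halg x y) : conv a (c + c') = conv a c + conv a c'.
Proof.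
apply/ffunP => h; rewrite !ffunE -big_split; apply: eq_bigr => g _ /=.
by rewrite -big_split; apply: eq_bigr => f _; rewrite ffunE (mulrDr (a g)) mulrDl.
Qed.
Lemma convZl x y z (t : k) (a : halg y z) (c : halg x y) : conv (t *: a) c = t *: conv a c.
Proof.
apply/ffunP => h; rewrite !ffunE scaler_sumr; apply: eq_bigr => g _ /=.
by rewrite scaler_sumr; apply: eq_bigr => f _; rewrite ffunE -[t *: a g]/(t * a g)
  -[RHS]/(t * (a g * c f * _)); ring.
Qed.
Lemma convZr x y z (t : k) (a : halg y z) (c : halg x y) : conv a (t *: c) = t *: conv a c.
Proof.
apply/ffunP => h; rewrite !ffunE scaler_sumr; apply: eq_bigr => g _ /=.
by rewrite scaler_sumr; apply: eq_bigr => f _; rewrite ffunE -[t *: c f]/(t * c f)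
  -[RHS]/(t * (a g * c f * _)); ring.
Qed.

Lemma conv0l x y z (c : halg x y) : conv (0 : halg y z) c = 0.
Proof. by rewrite -(scale0r 0) convZl !scale0r. Qed.
Lemma conv0r x y z (a : halg y z) : conv a (0 : halg x y) = 0.
Proof. by rewrite -(scale0r 0) convZr !scale0r. Qed.
Lemma conv_suml x y z (c : halg x y) I (r : seq I) P (F : I -> halg y z) :
  conv (\sum_(i <- r | P i) F i) c = \sum_(i <- r | P i) conv (F i) c.
Proof.
apply: (big_morph (fun a => conv a c)); last exact: conv0l.
by move=> a b; exact: convDl.
Qed.
Lemma conv_sumr x y z (a : halg y z) I (r : seq I) P (F : I -> halg x y) :
  conv a (\sum_(i <- r | P i) F i) = \sum_(i <- r | P i) conv a (F i).
Proof. by apply: (big_morph (conv a)); [move=> b c; exact: convDr|exact: conv0r]. Qed.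
Lemma convBl x y z (a a' : halg y z) (c : halg x y) : conv (a - a') c = conv a c - conv a' c.
Proof. by rewrite -scaleN1r convDl convZl scaleN1r. Qed.
Lemma convBr x y z (a : halg y z) (c c' : halg x y) : conv a (c - c') = conv a c - conv a c'.
Proof. by rewrite -scaleN1r convDr convZr scaleN1r. Qed.

Lemma halgE x y (c : halg x y) : c = \sum_h c h *: dl h.
Proof.
apply/ffunP => h; rewrite sum_ffunE; under eq_bigr => g _ do rewrite !ffunE /=.
by under eq_bigr => g _ do rewrite -[_ *: _]/(_ * _) mulrC; rewrite sum_delta.
Qed.

Lemma conv_dl x y z (g : rhom y z) (f : rhom x y) : conv (dl g) (dl f) = dl (g ** f).
Proof.
apply/ffunP => h; rewrite !ffunE.
under eq_bigr => g' _ do under eq_bigr => f' _ do rewrite !ffunE eq_sym -mulrA.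
under eq_bigr => g' _ do rewrite -mulr_sumr.
rewrite sum_delta; under eq_bigr => f' _ do rewrite eq_sym.
by rewrite sum_delta eq_sym.
Qed.

Lemma conv1m x y (c : halg x y) : conv (dl (rid y)) c = c.
Proof.
rewrite {1}[c]halgE conv_sumr [RHS]halgE; apply: eq_bigr => f _.
by rewrite convZr conv_dl rcomp1m.
Qed.
Lemma convm1 x y (c : halg x y) : conv c (dl (rid x)) = c.
Proof.
rewrite {1}[c]halgE conv_suml [RHS]halgE; apply: eq_bigr => f _.
by rewrite convZl conv_dl rcompm1.
Qed.

Lemma conv_dlrE x y z (c : halg y z) (j : rhom x y) h :
  conv c (dl j) h = \sum_f c f * (f ** j == h)%:R.
Proof.
rewrite ffunE; apply: eq_bigr => f _.
under eq_bigr => j' _ do rewrite ffunE eq_sym mulrAC mulrC.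
by rewrite sum_delta.
Qed.

End HomAlgebra.

(** * Injectivity of composition and of the matrix ([f o j = 1]) *)

Section Injectivity.
Variable k : fieldType.
Hypothesis k_char0 : forall n, (0 < n)%N -> (n%:R : k) != 0.
Variable C : frcat.
Implicit Types x y z S T V : C.

Definition shift_sum V T S (z : rhom S T) (c : rhom V T -> k) : rhom V T -> k :=
  fun f => \sum_(l : rhom V S) c (f + z ** l).

Lemma shift_sum_idem V T S (z : rhom S T) (c : rhom V T -> k) f :
  shift_sum z (shift_sum z c) f = #|rhom V S|%:R * shift_sum z c f.
Proof.
rewrite /shift_sum; transitivity (\sum_(l : rhom V S) \sum_(l' : rhom V S) c (f + z ** l')).
  apply: eq_bigr => l _; rewrite [RHS](reindex_inj (addrI l)) /=.
  by apply: eq_bigr => l' _; rewrite rcompDr addrA.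
by rewrite sumr_const mulr_natl.
Qed.

Lemma shift_sumC V T S (z z' : rhom S T) (c : rhom V T -> k) f :
  shift_sum z (shift_sum z' c) f = shift_sum z' (shift_sum z c) f.
Proof.
rewrite /shift_sum exchange_big; apply: eq_bigr => l _; apply: eq_bigr => l' _.
by rewrite addrAC.
Qed.

(* The operators [shift_sum z] commute and have eigenvalues 0 and #|rhom V S|, so
   adding a positive integer to a sum of them gives an invertible operator. *)
Lemma shift_sum_inj V T S (Z : seq (rhom S T)) n (c : rhom V T -> k) : (0 < n)%N ->
  (forall f, n%:R * c f + \sum_(z <- Z) shift_sum z c f = 0) -> forall f, c f = 0.
Proof.
elim: Z n c => [|z Z IH] n c n0 H.
  move=> f; have := H f; rewrite big_nil addr0 => /eqP.
  by rewrite mulf_eq0 (negPf (k_char0 n0)) => /eqP.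
have c1 : forall f, shift_sum z c f = 0.
  apply: (IH (n + #|rhom V S|)%N); first by rewrite addn_gt0 n0.
  move=> f; have : shift_sum z (fun g => n%:R * c g +
      \sum_(w <- z :: Z) shift_sum w c g) f = 0.
    by rewrite /shift_sum big1 // => l _; exact: H.
  rewrite {1}/shift_sum big_split /= -mulr_sumr exchange_big big_cons /= => E.
  rewrite -[RHS]E natrD mulrDl -shift_sum_idem -addrA; congr (_ + (_ + _)).
  by apply: eq_bigr => w _; exact: shift_sumC.
apply: (IH n) => // f; have := H f; rewrite big_cons c1 add0r; exact.
Qed.

(** The sum of c (f + z l) over z : S -> T and l : V -> S is computed in two ways. For l != 0 the
    maps f + z l are those that agree with f on a complement of S in V, so by induction their
    coefficients add up to 0. Grouping by z gives the operators [shift_sum z], and z = 0 contributes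
    |Hom(V, S)| c f against the |Hom(S, T)| c f from l = 0. *)
Lemma conv_inj V T (c : halg k V T) :
  (forall j : rhom T V, conv c (dl k j) = 0) -> c = 0.
Proof.
have [n] := ubnP (esize V); elim: n V c => // n IH V c Vn H.
have [[i [r ri]]|nVT] := pselect (retract V T).
  by rewrite -[c]convm1 -ri -conv_dl convA H conv0l.
have [S [iS lt]] : exists S, indec S /\ (#|rhom S T| < #|rhom V S|)%N.
  apply: contrapT => nS; apply: nVT; apply: retract_criterion => S iS.
  by rewrite leqNgt; apply/negP => lt; apply: nS; exists S.
have sum0 (l : rhom V S) f : l != 0 -> \sum_(z : rhom S T) c (f + z ** l) = 0.
  move=> l0; have [m lm] := indec_epi iS l0.
  have [V1 [i [p [pi _ pm li E]]]] := exists_dsum lm.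
  have V1V : (esize V1 < esize V)%N.
    apply: (esize_retract pi); apply: contra_neq l0 => ip.
    by rewrite -[l]rcompm1 -ip rcompA li rcomp0l.
  have ci0 : conv c (dl k i) = 0.
    apply: (IH V1); first exact: leq_trans V1V _.
    by move=> j; rewrite -convA conv_dl H.
  have := congr1 (fun d : halg k V1 T => d (f ** i)) ci0; rewrite conv_dlrE ffunE.
  move=> E0; rewrite -[RHS]E0 [RHS](bigID (fun g => g ** i == f ** i)) /= [X in _ + X]big1 ?addr0;
    last by move=> g /negPf ->; rewrite mulr0.
  rewrite [RHS](reindex_onto (fun w => f + w ** l) (fun g => (g - f) ** m)) /=.
    apply: eq_big => [w|w _].
      rewrite rcompDl -rcompA li rcomp0r addr0 eqxx /=.
      by rewrite [f + _]addrC addrK -rcompA lm rcompm1 eqxx.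
    by rewrite rcompDl -rcompA li rcomp0r addr0 eqxx mulr1.
  move=> g /eqP gi; apply/eqP; rewrite eq_sym addrC -subr_eq; apply/eqP.
  rewrite -[LHS]rcompm1 -E rcompDr !rcompA (rcompBl _ _ i) gi subrr.
  by rewrite rcomp0l add0r.
apply/ffunP => f; rewrite [RHS]ffunE; move: f.
pose Z := filter (fun z : rhom S T => z != 0) (enum (rhom S T)).
apply: (@shift_sum_inj V T S Z (#|rhom V S| - #|rhom S T|)); first by rewrite subn_gt0.
move=> f; rewrite natrB ?(ltnW lt) // mulrBl.
have E1 : \sum_(z : rhom S T) shift_sum z c f = #|rhom S T|%:R * c f.
  rewrite exchange_big (bigD1 (0 : rhom V S)) //= [X in _ + X]big1 ?addr0.
    by under eq_bigr => w _ do rewrite rcomp0r addr0; rewrite sumr_const mulr_natl.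
  by move=> l /sum0 ->.
rewrite -E1 (bigD1 (0 : rhom S T)) //=.
have -> : shift_sum (0 : rhom S T) c f = #|rhom V S|%:R * c f.
  by rewrite /shift_sum; under eq_bigr => l _ do rewrite rcomp0l addr0;
    rewrite sumr_const mulr_natl.
rewrite opprD addrA subrr add0r big_filter [X in - _ + X]big_enum_cond /=.
by rewrite addNr.
Qed.

(* As C is regular, these are all the epimorphisms and all the monomorphisms. *)
Definition ep x y (f : rhom x y) := [exists g, f ** g == rid y].
Definition mo x y (f : rhom x y) := [exists g, g ** f == rid x].

Lemma epP x y (f : rhom x y) : reflect (exists g, f ** g = rid y) (ep f).
Proof. by apply: (iffP existsP) => -[g /eqP]; exists g => //; apply/eqP. Qed.
Lemma moP x y (f : rhom x y) : reflect (exists g, g ** f = rid x) (mo f).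
Proof. by apply: (iffP existsP) => -[g /eqP]; exists g => //; apply/eqP. Qed.

Lemma endo_ep_mo x (h : rhom x x) : ep h = mo h.
Proof.
by apply/epP/moP => -[g gP]; exists g; exact: endo_inv.
Qed.

Lemma ep_compl x y z (g : rhom y z) (f : rhom x y) : ep (g ** f) -> ep g.
Proof. by move/epP=> [h hP]; apply/epP; exists (f ** h); rewrite rcompA. Qed.
Lemma mo_compr x y z (g : rhom y z) (f : rhom x y) : mo (g ** f) -> mo f.
Proof. by move/moP=> [h hP]; apply/moP; exists (h ** g); rewrite -rcompA. Qed.

(* e is the central idempotent of k[End T] that annihilates all non-invertible
   endomorphisms. *)
Definition top_idem T (e : halg k T T) :=
  [/\ e (rid T) = 1, forall h, ep h -> h != rid T -> e h = 0,
      forall h : rhom T T, ~~ ep h -> conv (dl k h) e = 0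
    & forall h : rhom T T, ~~ ep h -> conv e (dl k h) = 0].

Section TopIdem.
Variables (T : C) (e : halg k T T).
Hypothesis eP : top_idem e.

Lemma top_idem_decomp : e = dl k (rid T) + \sum_(h | ~~ ep h) e h *: dl k h.
Proof.
have [e1 e0 _ _] := eP; rewrite {1}[e]halgE (bigID (@ep T T)) /=; congr (_ + _).
have id_ep : ep (rid T) by apply/epP; exists (rid T); rewrite rcomp1m.
rewrite (bigD1 (rid T)) //= e1 scale1r big1 ?addr0 // => h /andP[hp h1].
by rewrite e0 // scale0r.
Qed.

Lemma top_idem_idem : conv e e = e.
Proof.
have [_ _ le re] := eP; rewrite {1}top_idem_decomp convDl conv1m conv_suml.
by rewrite big1 ?addr0 // => h hp; rewrite convZl le // scaler0.
Qed.

Lemma top_idem_mo V (j : rhom T V) : ~~ mo j -> conv (dl k j) e = 0.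
Proof.
move=> nj; have [_ _ le _] := eP; have [g jg] := rreg j.
rewrite -jg -rcompA -conv_dl -convA le ?conv0r //.
apply: contra nj => /epP[h gjh]; apply/moP; exists g.
have E : (g ** j) ** (g ** j) = g ** j by rewrite -rcompA (rcompA j) jg.
by rewrite -[LHS]rcompm1 -gjh rcompA E.
Qed.

Lemma top_idem_ep V (f : rhom V T) : ~~ ep f -> conv e (dl k f) = 0.
Proof.
move=> nf; have [_ _ _ re] := eP; have [g fg] := rreg f.
rewrite -fg -conv_dl convA re ?conv0l //.
by apply: contra nf; exact: ep_compl.
Qed.

(** The other terms of e f are multiples of h f with h singular, and such h f are not
    epimorphisms. *)
Lemma top_idem_coef V (f f' : rhom V T) : ep f' -> conv e (dl k f) f' = (f == f')%:R.
Proof.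
move=> ef'; rewrite conv_dlrE top_idem_decomp.
under eq_bigr => h _ do rewrite !ffunE mulrDl eq_sym.
rewrite big_split /= sum_delta rcomp1m big1 ?addr0 // => h _.
have [/eqP hf|] := boolP (h ** f == f'); last by rewrite mulr0.
rewrite mulr1 sum_ffunE big1 // => u nu; rewrite !ffunE.
have [hu|] := eqVneq h u; last by rewrite scaler0.
by case/negP: nu; rewrite -hu; apply: (@ep_compl _ _ _ _ f); rewrite hf.
Qed.

(** By [conv_inj] it suffices that e c' dies after every j: e kills the terms with f j singular, and
    those with f j = h invertible cancel by the hypothesis at j h^-1. At an epimorphism e c' has the
    coefficient of c. *)
Lemma ep_matrix_inj V (c : rhom V T -> k) :
  (forall f, ~~ ep f -> c f = 0) ->
  (forall j : rhom T V, \sum_f c f * (f ** j == rid T)%:R = 0) -> forall f, c f = 0.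
Proof.
move=> c0 H; have [_ _ le re] := eP.
pose c' : halg k V T := \sum_f c f *: dl k f.
have E : conv e c' = 0.
  apply: conv_inj => j; rewrite -convA.
  rewrite conv_suml conv_sumr.
  under eq_bigr => f _ do rewrite convZl conv_dl convZr.
  rewrite (partition_big (fun f => f ** j) predT) //= big1 // => h _.
  have [eh|nh] := boolP (ep h); last first.
    by rewrite big1 // => f /eqP ->; rewrite re // scaler0.
  have /epP[g hg] := eh; have gh := endo_inv hg.
  rewrite (eq_bigr (fun f => c f *: conv e (dl k h))); last by move=> f /eqP ->.
  rewrite -scaler_suml.
  rewrite (_ : \sum_(f | f ** j == h) c f = 0) ?scale0r //.
  rewrite -[RHS](H (j ** g)) big_mkcond /=; apply: eq_bigr => f _.
  rewrite rcompA; have -> : (f ** j ** g == rid T) = (f ** j == h).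
    apply/eqP/eqP => [E|->] //.
    by rewrite -[RHS]rcomp1m -E -rcompA gh rcompm1.
  by case: eqP; rewrite ?mulr1 ?mulr0.
move=> f; have [ef|/c0//] := boolP (ep f).
have := congr1 (fun d : halg k V T => d f) E; rewrite [RHS]ffunE => <-.
rewrite conv_sumr sum_ffunE; under eq_bigr => g _ do rewrite convZr ffunE top_idem_coef //.
under eq_bigr => g _ do rewrite -[_ *: _]/(_ * _) mulrC eq_sym.
by rewrite sum_delta.
Qed.

End TopIdem.
End Injectivity.

(** Spares a proof that the matrix of epimorphisms against monomorphisms is square: injectivity on
    both sides makes Q an inverse afterwards. *)
Lemma generalized_inverse (k : fieldType) (I J : finType) (P : I -> J -> k) :
  exists Q : J -> I -> k,
    forall i j, \sum_j' \sum_i' P i j' * Q j' i' * P i' j = P i j.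
Proof.
pose A := \matrix_(i < #|I|, j < #|J|) P (enum_val i) (enum_val j).
pose B := pinvmx A; exists (fun j i => B (enum_rank j) (enum_rank i)) => i j.
have := mulmxKpV (submx_refl A) => /matrixP/(_ (enum_rank i) (enum_rank j)).
rewrite !mxE !enum_rankK => <-; rewrite exchange_big /=.
rewrite [RHS](reindex_onto enum_rank enum_val) /=; last by move=> ? _; rewrite enum_valK.
apply: eq_big => [i'|i' _]; first by rewrite enum_rankK eqxx.
rewrite !mxE !enum_rankK mulr_suml.
rewrite [RHS](reindex_onto enum_rank enum_val) /=; last by move=> ? _; rewrite enum_valK.
by apply: eq_big => [j'|j' _]; rewrite ?mxE !enum_rankK ?eqxx.
Qed.

Section Dual.
Variables (k : fieldType) (C : frcat).

Lemma conv_frop (x y z : C) (c : halg k y z) (d : halg k x y) :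
  @conv k (frop C) z y x d c = conv c d.
Proof.
by apply/ffunP => h; rewrite !ffunE exchange_big; apply: eq_bigr => g _;
  apply: eq_bigr => f _; rewrite [X in X * _]mulrC.
Qed.

Lemma top_idem_frop (T : C) (e : halg k T T) :
  top_idem e -> @top_idem k (frop C) T e.
Proof.
have epE (h : rhom T T) : @ep (frop C) T T h = ep h by rewrite endo_ep_mo.
move=> [e1 e0 le re]; split=> // h; rewrite epE => nh; first exact: e0.
  by rewrite (@conv_frop T T T) re.
by rewrite (@conv_frop T T T) le.
Qed.

End Dual.

(** * The separability element *)

Section Separability.
Variable k : fieldType.
Hypothesis k_char0 : forall n, (0 < n)%N -> (n%:R : k) != 0.
Variable C : frcat.
Implicit Types x y z V W : C.

Lemma mo_matrix_inj (T V : C) (e : halg k T T) (d : rhom T V -> k) : top_idem e ->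
  (forall j, ~~ mo j -> d j = 0) ->
  (forall f : rhom V T, \sum_j d j * (f ** j == rid T)%:R = 0) -> forall j, d j = 0.
Proof.
move=> eT d0 H; apply: (@ep_matrix_inj k k_char0 (frop C) T e (top_idem_frop eT) V).
  exact: d0.
exact: H.
Qed.

Lemma conv_dllE x y z (g : rhom y z) (c : halg k x y) h :
  conv (dl k g) c h = \sum_f c f * (g ** f == h)%:R.
Proof.
rewrite ffunE; under eq_bigr => g' _ do rewrite ffunE eq_sym.
under eq_bigr => g' _ do under eq_bigr => f _ do rewrite -mulrA.
by under eq_bigr => g' _ do rewrite -mulr_sumr; rewrite sum_delta.
Qed.

Section Pairing.
Variables (T : C) (e : halg k T T).

(* The inverse of the matrix ([f ** j = 1]), f ranging over the epimorphisms V -> T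
   and j over the monomorphisms T -> V, extended by zero. *)
Definition pinv V : rhom T V -> rhom V T -> k := fun j f =>
  (mo j)%:R * ((ep f)%:R *
   projT1 (cid (generalized_inverse (fun (f : rhom V T) (j : rhom T V) =>
     (f ** j == rid T)%:R : k))) j f).

Definition nunit : nat := #|[pred h : rhom T T | ep h]|.

(* The coefficients of the T-block of the separability element, which is
   |Aut T|^-1 \sum pinv j f (j e) (x) (e f). *)
Definition sep V (a : rhom T V) (b : rhom V T) : k :=
  nunit%:R^-1 * \sum_j \sum_f pinv j f * (conv (dl k j) e a * conv e (dl k f) b).

Definition sep_idem V : halg k V V :=
  [ffun h => \sum_a \sum_b sep a b * (a ** b == h)%:R].

Hypothesis eT : top_idem e.

(** P Q P = P says that P kills the columns of Q P - 1, and P is injective on functions supported on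
    monomorphisms. *)
Lemma pinvP V (j j' : rhom T V) : mo j' ->
  \sum_f pinv j f * (f ** j' == rid T)%:R = (j == j')%:R.
Proof.
rewrite /pinv; case: cid => Q /= QP mj'.
have [mj|mj] := boolP (mo j); last first.
  rewrite big1 => [|f _]; last by rewrite !mul0r.
  by case: eqP mj => // ->; rewrite mj'.
pose d (i : rhom T V) := (mo i)%:R *
  (\sum_f (ep f)%:R * Q i f * (f ** j' == rid T)%:R) - (i == j')%:R.
suff: d j = 0.
  rewrite /d mj mul1r => /eqP; rewrite subr_eq0 => /eqP <-.
  by apply: eq_bigr => f _; rewrite mul1r.
apply: (mo_matrix_inj eT) => [i /negPf mi|f].
  by rewrite /d mi mul0r sub0r; case: eqP mi => [->|_ _]; rewrite ?mj' ?oppr0.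
under eq_bigr => i _ do rewrite /d mulrBl.
rewrite sumrB; under [X in _ - X]eq_bigr => i _ do rewrite eq_sym.
rewrite sum_delta -(QP f j') -sumrB big1 // => i _.
have [/eqP fi|fi] := boolP (f ** i == rid T); last first.
  by rewrite mulr0 big1 ?subrr // => g _; rewrite !mul0r.
have -> : mo i by apply/moP; exists f.
rewrite mulr1 mul1r; apply/eqP; rewrite subr_eq0; apply/eqP; apply: eq_bigr => g _.
rewrite mul1r; have [/eqP gj|gj] := boolP (g ** j' == rid T); last by rewrite !mulr0.
by have -> : ep g by [apply/epP; exists j']; rewrite mul1r.
Qed.

Lemma pinvP' V (f f' : rhom V T) : ep f' ->
  \sum_j (f' ** j == rid T)%:R * pinv j f = (f == f')%:R.
Proof.
rewrite /pinv; case: cid => Q /= QP mf'.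
have [mf|mf] := boolP (ep f); last first.
  rewrite big1 => [|j _]; last by rewrite mul0r !mulr0.
  by case: eqP mf => // ->; rewrite mf'.
pose d (i : rhom V T) := (ep i)%:R *
  (\sum_j (f' ** j == rid T)%:R * ((mo j)%:R * Q j i)) - (i == f')%:R.
suff: d f = 0.
  rewrite /d mf mul1r => /eqP; rewrite subr_eq0 => /eqP <-.
  by apply: eq_bigr => j _; rewrite mul1r.
apply: (ep_matrix_inj k_char0 eT) => [i /negPf mi|j].
  by rewrite /d mi mul0r sub0r; case: eqP mi => [->|_ _]; rewrite ?mf' ?oppr0.
under eq_bigr => i _ do rewrite /d mulrBl.
rewrite sumrB; under [X in _ - X]eq_bigr => i _ do rewrite eq_sym.
rewrite sum_delta -(QP f' j) exchange_big /= -sumrB big1 // => i _.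
have [/eqP fi|fi] := boolP (i ** j == rid T); last first.
  by rewrite mulr0 big1 ?subrr // => g _; rewrite !mulr0.
have -> : ep i by apply/epP; exists j.
rewrite mulr1 mul1r; apply/eqP; rewrite subr_eq0; apply/eqP; apply: eq_bigr => g _.
rewrite mulr1; have [/eqP gj|gj] := boolP (f' ** g == rid T); last by rewrite !mul0r.
by have -> : mo g by [apply/moP; exists f']; rewrite !mul1r.
Qed.

(** Inserts [pinv] times the matrix, an identity on monomorphisms; for any other j both sides
    vanish. *)
Lemma expand_mo V (j : rhom T V) a :
  conv (dl k j) e a =
  \sum_j1 \sum_f1 pinv j1 f1 * (f1 ** j == rid T)%:R * conv (dl k j1) e a.
Proof.
under eq_bigr => j1 _ do rewrite -mulr_suml.
have [mj|mj] := boolP (mo j).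
  by under eq_bigr => j1 _ do rewrite pinvP // eq_sym; rewrite sum_delta.
rewrite (top_idem_mo eT) // ffunE big1 // => j1 _.
rewrite big1 ?mul0r // => f1 _; case: eqP => [fj|_]; last by rewrite mulr0.
by case/negP: mj; apply/moP; exists f1.
Qed.

Lemma expand_ep V (f : rhom V T) b :
  conv e (dl k f) b =
  \sum_j1 \sum_f1 pinv j1 f1 * (f ** j1 == rid T)%:R * conv e (dl k f1) b.
Proof.
rewrite exchange_big; under eq_bigr => f1 _ do rewrite -mulr_suml.
have [mf|mf] := boolP (ep f).
  under eq_bigr => f1 _ do under eq_bigr => j1 _ do rewrite mulrC.
  by under eq_bigr => f1 _ do rewrite pinvP' // eq_sym; rewrite sum_delta.
rewrite (top_idem_ep eT) // ffunE big1 // => j1 _.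
rewrite big1 ?mul0r // => f1 _; case: eqP => [fj|_]; last by rewrite mulr0.
by case/negP: mf; apply/epP; exists f1.
Qed.

(** Expanding g j over the maps T -> W, or f1 g over the maps V -> T, leads to the same double sum
    with coefficients [f1 g j = 1]. *)
Lemma sep_nat V W (g : rhom V W) (a' : rhom T W) (b : rhom V T) :
  \sum_a sep a b * (g ** a == a')%:R = \sum_b' sep a' b' * (b' ** g == b)%:R.
Proof.
have -> : \sum_a sep a b * (g ** a == a')%:R =
    nunit%:R^-1 * \sum_j \sum_f pinv j f * (conv (dl k (g ** j)) e a' * conv e (dl k f) b).
  under eq_bigr => a _ do rewrite /sep -mulrA mulr_suml.
  rewrite -mulr_sumr exchange_big; congr (_ * _); apply: eq_bigr => j _.
  under eq_bigr => a _ do rewrite mulr_suml.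
  rewrite exchange_big; apply: eq_bigr => f _.
  rewrite -conv_dl -convA conv_dllE mulr_suml mulr_sumr; apply: eq_bigr => a _.
  by ring.
have -> : \sum_b' sep a' b' * (b' ** g == b)%:R =
    nunit%:R^-1 * \sum_j \sum_f pinv j f * (conv (dl k j) e a' * conv e (dl k (f ** g)) b).
  under eq_bigr => b' _ do rewrite /sep -mulrA mulr_suml.
  rewrite -mulr_sumr exchange_big; congr (_ * _); apply: eq_bigr => j _.
  under eq_bigr => b' _ do rewrite mulr_suml.
  rewrite exchange_big; apply: eq_bigr => f _.
  rewrite -conv_dl convA conv_dlrE !mulr_sumr; apply: eq_bigr => b' _.
  by ring.
congr (_ * _).
transitivity (\sum_j \sum_f \sum_j1 \sum_f1 pinv j f * pinv j1 f1 *
    (f1 ** (g ** j) == rid T)%:R * (conv (dl k j1) e a' * conv e (dl k f) b)).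
  apply: eq_bigr => j _; apply: eq_bigr => f _.
  rewrite expand_mo mulr_suml mulr_sumr; apply: eq_bigr => j1 _.
  by rewrite mulr_suml mulr_sumr; apply: eq_bigr => f1 _; ring.
transitivity (\sum_j1 \sum_f1 \sum_j \sum_f pinv j f * pinv j1 f1 *
    (f1 ** (g ** j) == rid T)%:R * (conv (dl k j1) e a' * conv e (dl k f) b)).
  under eq_bigr => j _ do rewrite exchange_big.
  rewrite exchange_big; apply: eq_bigr => j1 _.
  under eq_bigr => j _ do rewrite exchange_big.
  by rewrite exchange_big.
apply: eq_bigr => j1 _; apply: eq_bigr => f1 _.
rewrite (expand_ep (f1 ** g)) !mulr_sumr; apply: eq_bigr => j _.
rewrite !mulr_sumr; apply: eq_bigr => f _; rewrite rcompA; ring.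
Qed.

Lemma sum_sep_idem V (F : rhom V V -> k) :
  \sum_u sep_idem V u * F u = \sum_a \sum_b sep a b * F (a ** b).
Proof.
under eq_bigr => u _ do rewrite ffunE mulr_suml.
rewrite exchange_big; apply: eq_bigr => a _.
under eq_bigr => u _ do rewrite mulr_suml.
rewrite exchange_big; apply: eq_bigr => b _ /=.
by under eq_bigr => u _ do rewrite -mulrA; rewrite -mulr_sumr sum_delta.
Qed.

Lemma sep_idem_nat V W (g : rhom V W) :
  conv (dl k g) (sep_idem V) = conv (sep_idem W) (dl k g).
Proof.
apply/ffunP => h; rewrite conv_dllE conv_dlrE !sum_sep_idem.
transitivity (\sum_a' \sum_b (\sum_a sep a b * (g ** a == a')%:R) * (a' ** b == h)%:R).
  under [RHS]eq_bigr => a' _ do under eq_bigr => b _ do rewrite mulr_suml.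
  under [RHS]eq_bigr => a' _ do rewrite exchange_big.
  rewrite [RHS]exchange_big; apply: eq_bigr => a _; rewrite [RHS]exchange_big.
  apply: eq_bigr => b _; under [RHS]eq_bigr => a' _ do rewrite -mulrA.
  by rewrite -mulr_sumr sum_delta rcompA.
apply: eq_bigr => a' _.
under eq_bigr => b _ do rewrite sep_nat mulr_suml.
rewrite exchange_big; apply: eq_bigr => b' _ /=.
under eq_bigr => b _ do rewrite -mulrA.
by rewrite -mulr_sumr sum_delta rcompA.
Qed.

Lemma sep_idemE V : sep_idem V =
  nunit%:R^-1 *: \sum_j \sum_f pinv j f *: conv (conv (dl k j) e) (conv e (dl k f)).
Proof.
apply/ffunP => h; rewrite !ffunE sum_ffunE.
rewrite -[RHS]/(_ * _).
under eq_bigr => a _ do under eq_bigr => b _ do rewrite /sep -mulrA mulr_suml.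
under eq_bigr => a _ do rewrite -mulr_sumr exchange_big.
rewrite -mulr_sumr exchange_big; congr (_ * _); apply: eq_bigr => j _ /=.
under eq_bigr => a _ do under eq_bigr => b _ do rewrite mulr_suml.
under eq_bigr => a _ do rewrite exchange_big.
rewrite exchange_big sum_ffunE; apply: eq_bigr => f _ /=.
rewrite ffunE -[RHS]/(_ * _) ffunE mulr_sumr; apply: eq_bigr => a _.
by rewrite mulr_sumr; apply: eq_bigr => b _; rewrite -!mulrA.
Qed.

Lemma top_idem_absorbl (c : halg k T T) : conv e (conv c e) = conv c e.
Proof.
have [_ _ le re] := eT; rewrite {1}(top_idem_decomp eT) convDl conv1m conv_suml.
rewrite big1 ?addr0 // => u nu; rewrite convZl convA {1}[c]halgE conv_sumr conv_suml.
rewrite big1 ?scaler0 // => h _; rewrite convZr convZl conv_dl le ?scaler0 //.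
by apply: contra nu; exact: ep_compl.
Qed.

Lemma top_idem_absorbr (c : halg k T T) : conv (conv e c) e = conv e c.
Proof.
have [_ _ le re] := eT; rewrite {2}(top_idem_decomp eT) convDr convm1 conv_sumr.
rewrite big1 ?addr0 // => u nu; rewrite convZr -convA {1}[c]halgE conv_suml conv_sumr.
rewrite big1 ?scaler0 // => h _; rewrite convZl convZr conv_dl re ?scaler0 //.
by apply: contra nu; rewrite !endo_ep_mo; exact: mo_compr.
Qed.

Lemma nunit_neq0 : (nunit%:R : k) != 0.
Proof.
apply: k_char0; apply/card_gt0P; exists (rid T); rewrite inE.
by apply/epP; exists (rid T); rewrite rcomp1m.
Qed.

(** For V = T the matrix is the permutation matrix of inversion on Aut T, so each of the [nunit]
    terms is f^-1 e f = e; hence the normalisation of [sep]. *)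
Lemma sep_idem_top : sep_idem T = e.
Proof.
rewrite sep_idemE exchange_big (bigID (@ep C T T)) /= [X in _ + X]big1 ?addr0; last first.
  by move=> f /negPf nf; rewrite big1 // => j _; rewrite /pinv nf mul0r mulr0 scale0r.
rewrite (eq_bigr (fun=> e)) => [|f /epP[g fg]].
  by rewrite sumr_const -scaler_nat scalerA mulVf ?scale1r // nunit_neq0.
have gf := endo_inv fg.
have mg : mo g by apply/moP; exists f.
have pE j : pinv j f = (j == g)%:R.
  rewrite -(pinvP j mg) (bigD1 f) //= fg eqxx mulr1 big1 ?addr0 // => f' ff'.
  case: eqP => [f'g|_]; last by rewrite mulr0.
  by case/eqP: ff'; rewrite -[f']rcompm1 -gf rcompA f'g rcomp1m.
rewrite (bigD1 g) //= pE eqxx scale1r big1 ?addr0; last first.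
  by move=> j /negPf jg; rewrite pE jg scale0r.
rewrite -convA (convA e) (top_idem_idem eT).
have -> : conv e (dl k f) = conv (dl k f) e.
  by rewrite -[LHS]top_idem_absorbr -convA top_idem_absorbl.
by rewrite convA conv_dl gf conv1m.
Qed.

Lemma top_idem_unique (e' : halg k T T) : top_idem e' -> e = e'.
Proof.
move=> eT'; have [_ _ le _] := eT'; have [_ _ _ re] := eT.
transitivity (conv e e').
  rewrite (top_idem_decomp eT') convDr convm1 conv_sumr big1 ?addr0 // => h nh.
  by rewrite convZr re // scaler0.
rewrite {1}(top_idem_decomp eT) convDl conv1m conv_suml big1 ?addr0 // => h nh.
by rewrite convZl le // scaler0.
Qed.

End Pairing.

Lemma sep_eq0 (T : C) (e : halg k T T) V (a : rhom T V) (b : rhom V T) :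
  ~ retract T V -> sep e a b = 0.
Proof.
move=> nTV; rewrite /sep big1 ?mulr0 // => j _; rewrite big1 // => f _.
rewrite /pinv; case: (boolP (mo j)) => [/moP[g gj]|_]; last by rewrite !mul0r.
by case: nTV; exists j, g.
Qed.

Lemma sep_idem_eq0 (T : C) (e : halg k T T) V : ~ retract T V -> sep_idem e V = 0.
Proof.
move=> nTV; apply/ffunP => h; rewrite !ffunE big1 // => a _; rewrite big1 // => b _.
by rewrite sep_eq0 // mul0r.
Qed.

Lemma sep_idem_ep (T : C) (e : halg k T T) V (h : rhom V V) :
  ~ retract V T -> ep h -> sep_idem e V h = 0.
Proof.
move=> nVT /epP[g hg]; rewrite ffunE big1 // => a _; rewrite big1 // => b _.
case: eqP => [ab|_]; last by rewrite mulr0.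
by case: nVT; exists (b ** g), a; rewrite rcompA ab.
Qed.

(** * Assembling the blocks *)

Section Blocks.
Variables (S : choiceType) (o : S -> C).
Hypothesis oP : forall x, exists s, riso (o s) x.

(** One index for each isomorphism class, so that no block is counted twice. *)
Definition rep x : S := choose (fun s => `[< riso (o s) x >]) (projT1 (cid (oP x))).

Lemma repP x : riso (o (rep x)) x.
Proof.
by apply/asboolP; apply: (@chooseP _ (fun s => `[< riso (o s) x >])); apply/asboolP; case: cid.
Qed.

Lemma rep_eq x y : riso x y -> rep x = rep y.
Proof.
move=> xy; rewrite /rep (@eq_choose _ _ (fun s => `[< riso (o s) y >])).
  apply: choose_id; apply/asboolP; last by case: cid.
  by apply: riso_trans xy; case: cid.
move=> s; apply/asboolP/asboolP => H; first exact: riso_trans xy.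
exact: riso_trans (riso_sym xy).
Qed.

Definition isrep s := rep (o s) = s.

Lemma isrep_rep x : isrep (rep x).
Proof. by apply: rep_eq; exact: repP. Qed.

(** Retracts of x come from idempotents of the finite ring End x, so the list is finite. Other
    endomorphisms contribute [rep x], itself a retract. *)
Definition supp x : seq S := undup
  [seq (if pselect (e ** e = e) is left H then rep (projT1 (cid (rsplit H)))
        else rep x) | e <- enum (rhom x x)].

Lemma suppP s x : s \in supp x <-> isrep s /\ retract (o s) x.
Proof.
rewrite mem_undup; split=> [/mapP[e _ ->]|[sr [i [r ri]]]].
  split; first by case: pselect => H; exact: isrep_rep.
  case: pselect => H; last exact: riso_retract (repP x).
  case: cid => y [a [b [ba ab]]] /=.
  by apply: retract_trans (riso_retract (repP y)) _; exists a, b.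
apply/mapP; exists (i ** r); first by rewrite mem_enum.
case: pselect => [H|]; last by rewrite rcompA -(rcompA i) ri rcompm1.
case: cid => y [a [b [ba ab]]] /=; rewrite -{1}sr; apply: rep_eq.
exists (b ** i), (r ** a); split.
  by rewrite rcompA -(rcompA r) ab rcompA ri rcomp1m ri.
by rewrite rcompA -(rcompA b) -ab !rcompA ba rcomp1m.
Qed.

(** Chosen with default 0, because the existence of the top idempotent is only established along
    with the decomposition, in [all_block_good]. *)
Definition ebar s : halg k (o s) (o s) :=
  if pselect (exists e : halg k (o s) (o s), top_idem e) is left H
  then projT1 (cid H) else 0.

Lemma ebarP s : (exists e : halg k (o s) (o s), top_idem e) -> top_idem (ebar s).
Proof. by rewrite /ebar; case: pselect => // H _; case: cid. Qed.

Definition block s x : halg k x x := sep_idem (ebar s) x.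

Definition block_good s := top_idem (ebar s) /\
  \sum_(t <- supp (o s)) block t (o s) = dl k (rid (o s)).

Lemma supp_iso x y : riso x y -> perm_eq (supp x) (supp y).
Proof.
move=> xy; apply: uniq_perm; rewrite ?undup_uniq // => s.
apply/idP/idP => /suppP[sr H]; apply/suppP; split=> //.
  exact: retract_trans (riso_retract xy).
exact: retract_trans (riso_retract (riso_sym xy)).
Qed.

Lemma block_sum x : (forall s, s \in supp x -> block_good s) ->
  \sum_(t <- supp x) block t x = dl k (rid x).
Proof.
move=> H; have xr := repP x; have [i [r [ri ir]]] := xr.
rewrite -(perm_big _ (supp_iso xr)) /= -ir -conv_dl -[dl k i]convm1.
have [_ <-] : block_good (rep x).
  by apply: H; apply/suppP; split; [exact: isrep_rep|exact: riso_retract].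
rewrite conv_sumr conv_suml !big_seq; apply: eq_bigr => s sx.
have [eT _] : block_good s by apply: H; rewrite -(perm_mem (supp_iso xr)).
by rewrite /block (sep_idem_nat eT) -convA conv_dl ir convm1.
Qed.

(* By induction on the size of End (o s): the top idempotent of o s is the
   complement of the blocks of its proper retracts. *)
Lemma all_block_good s : isrep s -> block_good s.
Proof.
have [n] := ubnP (esize (o s)); elim: n s => // n IH s sn sr.
pose e := dl k (rid (o s)) - \sum_(t <- supp (o s) | t != s) block t (o s).
have tP t : t \in supp (o s) -> t != s -> ~ retract (o s) (o t) /\ block_good t.
  move=> /suppP[tr ts] tns.
  have nst : ~ retract (o s) (o t).
    move=> st; case/eqP: tns; rewrite -tr -sr; apply: rep_eq.
    exact: retract_antisym.
  split=> //; apply: IH tr; rewrite ltnS in sn; apply: leq_trans sn.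
  have [i [r ri]] := ts; apply: (esize_retract ri).
  by apply: contra_not_neq nst => ir; exists r, i.
(* On a proper retract y the blocks other than s already add up to the identity; as blocks are
   natural, e vanishes on maps from and to y. *)
have kill y (a : rhom y (o s)) (b : rhom (o s) y) : b ** a = rid y -> a ** b != rid (o s) ->
    conv e (dl k a) = 0 /\ conv (dl k b) e = 0.
  move=> ba ab; have ys := esize_retract ba ab.
  have sub t : t \in supp y -> (t \in supp (o s)) && (t != s).
    move=> /suppP[tr ty]; apply/andP; split.
      by apply/suppP; split=> //; apply: retract_trans ty _; exists a, b.
    apply: contraTneq ys => ts; rewrite -leqNgt -ts; exact: retract_leq.
  have sumE : \sum_(t <- supp (o s) | t != s) block t y = dl k (rid y).
    rewrite -(@block_sum y); last first.
      by move=> t /sub/andP[t1 t2]; have [] := tP t t1 t2.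
    rewrite big_seq_cond (bigID (mem (supp y))) /= [X in _ + X]big1 ?addr0; last first.
      move=> t /andP[/andP[/suppP[tr _] _] /negP tny].
      by rewrite /block sep_idem_eq0 // => ty; apply: tny; exact/suppP.
    rewrite -big_filter; apply: perm_big; apply: uniq_perm.
    - by rewrite filter_uniq ?undup_uniq.
    - exact: undup_uniq.
    move=> t; rewrite mem_filter; apply/idP/idP => [/andP[/andP[]]//|ty].
    by have /andP[t1 t2] := sub t ty; rewrite ty t1 t2.
  have nat t : t \in supp (o s) -> t != s -> top_idem (ebar t).
    by move=> t1 t2; have [_ []] := tP t t1 t2.
  split.
    rewrite convBl conv1m conv_suml big_seq_cond.
    rewrite (eq_bigr (fun t => conv (dl k a) (block t y))) => [|t /andP[t1 t2]].
      by rewrite -big_seq_cond -conv_sumr sumE convm1 subrr.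
    by rewrite /block (sep_idem_nat (nat t t1 t2)).
  rewrite convBr convm1 conv_sumr big_seq_cond.
  rewrite (eq_bigr (fun t => conv (block t y) (dl k b))) => [|t /andP[t1 t2]].
    by rewrite -big_seq_cond -conv_suml sumE conv1m subrr.
  by rewrite /block (sep_idem_nat (nat t t1 t2)).
(* An invertible h in the support of another block would factor through o t and make o s a retract
   of it. *)
have eh (h : rhom (o s) (o s)) : ep h -> e h = (h == rid (o s))%:R.
  move=> hp; rewrite !ffunE sum_ffunE big_seq_cond big1 ?subr0 //.
  by move=> t /andP[t1 t2]; apply: sep_idem_ep => //; have [] := tP t t1 t2.
have eT : top_idem e.
  split=> [|h hp /negPf h1|h nh|h nh].
  - by rewrite eh ?eqxx //; apply/epP; exists (rid _); rewrite rcomp1m.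
  - by rewrite eh // h1.
  - have [g hg] := rreg h; have gh : (g ** h) ** (g ** h) = g ** h.
      by rewrite -rcompA (rcompA h) hg.
    have [y [a [b [ba ab]]]] := rsplit gh.
    have [|_ E] := kill y a b ba.
      rewrite ab; apply: contra nh => /eqP ghE; rewrite endo_ep_mo.
      by apply/moP; exists g.
    by rewrite -hg -rcompA -ab rcompA -conv_dl -convA E conv0r.
  - have [g hg] := rreg h; have gh : (h ** g) ** (h ** g) = h ** g.
      by rewrite rcompA hg.
    have [y [a [b [ba ab]]]] := rsplit gh.
    have [|E _] := kill y a b ba.
      by rewrite ab; apply: contra nh => /eqP ghE; apply/epP; exists g.
    by rewrite -hg -ab -rcompA -conv_dl convA E conv0l.
have sT : top_idem (ebar s) by apply: ebarP; exists e.
split=> //; have ss : s \in supp (o s).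
  by apply/suppP; split=> //; exact: riso_retract (riso_refl _).
rewrite (bigD1_seq s) ?undup_uniq //= /block (sep_idem_top sT).
by rewrite (top_idem_unique sT eT) /e subrK.
Qed.

Theorem separability :
  exists (sg : forall s x, rhom (o s) x -> rhom x (o s) -> k) (su : C -> seq S),
  [/\ forall x, uniq (su x),
      forall s x a b, s \notin su x -> sg s x a b = 0,
      forall x h, \sum_(s <- su x) \sum_a \sum_b sg s x a b * (a ** b == h)%:R =
        (h == rid x)%:R
    & forall s x y (g : rhom x y) a' b,
        \sum_a sg s x a b * (g ** a == a')%:R = \sum_b' sg s y a' b' * (b' ** g == b)%:R].
Proof.
pose sg s x a b := if pselect (isrep s) then @sep _ (ebar s) x a b else 0.
exists sg, supp; split=> [x|s x a b sx|x h|s x y g a' b].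
- exact: undup_uniq.
- rewrite /sg; case: pselect => // sr; apply: sep_eq0 => sx'.
  by case/negP: sx; exact/suppP.
- have := congr1 (fun c : halg k x x => c h)
    (block_sum (fun s (sx : s \in supp x) => all_block_good ((suppP s x).1 sx).1)).
  rewrite sum_ffunE [RHS]ffunE => <-; rewrite !big_seq; apply: eq_bigr => s sx.
  rewrite ffunE; apply: eq_bigr => a _; apply: eq_bigr => b _; rewrite /sg.
  by case: pselect => // nr; case: nr; have /suppP[] := sx.
- rewrite /sg; case: pselect => [sr|nr] /=; last by rewrite !big1 // => ? _; rewrite mul0r.
  exact: (sep_nat (all_block_good sr).1).
Qed.

End Blocks.

End Separability.

(** * Finitely generated modules over a finite semisimple ring *)

Definition finite_type (T : Type) :=
  exists (F : finType) (g : F -> T), forall t, exists f, g f = t.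

Section FiniteZmodule.
Variables (T : zmodType) (T_fin : finite_type T).

Let F := projT1 (cid T_fin).
Let g : F -> T := projT1 (cid (projT2 (cid T_fin))).
Let gP : forall t, exists f, g f = t := projT2 (cid (projT2 (cid T_fin))).
Let e : seq T := undup (map g (enum F)).

Let eP : Finite.axiom e.
Proof.
move=> t; rewrite count_uniq_mem ?undup_uniq // mem_undup.
by have [f <-] := gP t; rewrite map_f // mem_enum.
Qed.

Let eK : pcancel (fun t => index t e) (fun n => nth None (map Some e) n).
Proof.
move=> t; have te : t \in e by rewrite -has_pred1 has_count eP.
by rewrite (nth_map t) ?index_mem // nth_index.
Qed.

(** Keeps the carrier and the addition of T, so that composition of linear maps can be reused in
    [quotient_frcat]. *)
Definition finzmod : finZmodType :=
  HB.pack (Algebra.Zmodule.sort T) (PCanIsCountable eK)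
    (isFinite.Build (Algebra.Zmodule.sort T) eP).

End FiniteZmodule.

Section SemisimpleModules.
Variables (R : finPzRingType) (R_semisimple : semisimple_ring R).
Implicit Types M N : lmodType R^c.

Lemma fg_finite M : finitely_generated M -> finite_type M.
Proof.
move=> [n [e He]]; exists {ffun 'I_n -> R},
  (fun a : {ffun 'I_n -> R} => \sum_i (a i : R^c) *: e i) => v.
have [a ->] := He v; exists [ffun i => a i].
by apply: eq_bigr => i _; rewrite ffunE.
Qed.

Lemma linear_fg_ext M N n (e : 'I_n -> M) (f g : {linear M -> N}) :
  (forall v, exists a : 'I_n -> R^c, v = \sum_i a i *: e i) ->
  (forall i, f (e i) = g (e i)) -> f =1 g.
Proof.
move=> He fg v; have [a ->] := He v; rewrite !linear_sum.
by apply: eq_bigr => i _; rewrite !linearZ fg.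
Qed.

Lemma linmap_finite M N : finitely_generated M -> finitely_generated N ->
  finite_type (linmap M N).
Proof.
move=> [n [e He]] /fg_finite[F [g gP]].
pose P (w : {ffun 'I_n -> F}) (f : linmap M N) :=
  forall i, (f : {linear M -> N}) (e i) = g (w i).
exists {ffun 'I_n -> F}, (fun w => if pselect (exists f, P w f) is left H
  then projT1 (cid H) else 0) => f.
have [w wP] := choice (fun i => gP ((f : {linear M -> N}) (e i))).
exists [ffun i => w i]; case: pselect => [H|[]]; last first.
  by exists f => i; rewrite ffunE wP.
case: cid => h /= hP; apply: linear_ext; apply: (linear_fg_ext He) => i.
by rewrite hP ffunE wP.
Qed.

Section Submodules.
Variable M : lmodType R^c.
Implicit Types U V : M -> Prop.

Lemma sub0 U : submodule U -> U 0. Proof. by case. Qed.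
Lemma subD U u v : submodule U -> U u -> U v -> U (u + v).
Proof. by move=> [_ UD] Uu Uv; rewrite -[u]scale1r; exact: UD. Qed.
Lemma subZ U a u : submodule U -> U u -> U (a *: u).
Proof. by move=> [U0 UD] Uu; rewrite -[_ *: _]addr0; exact: UD. Qed.
Lemma subB U u v : submodule U -> U u -> U v -> U (u - v).
Proof.
by move=> sU Uu Uv; rewrite -scaleN1r; apply: subD => //; exact: subZ.
Qed.
Lemma sub_sum U I (r : seq I) (F : I -> M) : submodule U ->
  (forall i, U (F i)) -> U (\sum_(i <- r) F i).
Proof.
by move=> sU UF; elim/big_ind: _ => //; [exact: sub0|move=> u v; exact: subD].
Qed.

Lemma sum_submodule U V : submodule U -> submodule V ->
  submodule (fun w => exists u v, [/\ U u, V v & w = u + v]).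
Proof.
move=> sU sV; split; first by exists 0, 0; split; [exact: sub0|exact: sub0|rewrite addr0].
move=> a _ _ [u [v [Uu Vv ->]]] [u' [v' [Uu' Vv' ->]]].
exists (a *: u + u'), (a *: v + v'); split; [exact: sU.2|exact: sV.2|].
by rewrite scalerDr addrACA.
Qed.

(** If w is not in W = U + V, write 1 as a sum of s_i in the minimal right ideals S_i: some s_i w is
    not in W, by minimality S_i w meets W in 0, and V can be enlarged by it. This ends because M is
    finite. *)
Lemma exists_complement U : finitely_generated M -> submodule U ->
  exists V, [/\ submodule V, forall v, U v -> V v -> v = 0
    & forall w, exists u v, [/\ U u, V v & w = u + v]].
Proof.
move=> /fg_finite[F [g gP]] sU.
pose size (V : M -> Prop) := #|[pred f : F | `[< V (g f) >]]|.
suff H n V : submodule V -> (forall v, U v -> V v -> v = 0) ->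
    (#|F| - size V < n)%N ->
    exists V, [/\ submodule V, forall v, U v -> V v -> v = 0
      & forall w, exists u v, [/\ U u, V v & w = u + v]].
  apply: (H _ (fun v => v = 0)); last exact: ltnSn.
    by split=> // a u v -> ->; rewrite scaler0 addr0.
  by [].
elim: n V => // n IH V sV UV Vn.
have [all|] := pselect (forall w, exists u v, [/\ U u, V v & w = u + v]).
  by exists V.
move=> /existsNP[w nw].
have [m [S [simpS decS]]] := R_semisimple.
pose W v := exists u u', [/\ U u, V u' & v = u + u'].
have sUV : submodule W := sum_submodule sU sV.
have [s [[sS s1] _]] := decS (1 : R^c).
have [i nsw] : exists i, ~ W ((s i : R^c) *: w).
  apply: contrapT => ns; apply: nw; suff : W w by [].
  rewrite -[w]scale1r s1 scaler_suml.
  by apply: sub_sum => // i; apply: contrapT => nW; apply: ns; exists i.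
have [sSi _ Smin] := simpS i.
have TW t : S i t -> W ((t : R^c) *: w) -> t = 0.
  move=> St Wt; have [||z|all] := Smin (fun t => S i t /\ W ((t : R^c) *: w)).
  - split; first by split; [case: sSi|rewrite scale0r; exact: sub0].
    move=> a u v [Su Wu] [Sv Wv]; split; first exact: sSi.2.
    by rewrite scalerDl -scalerA; exact: sUV.2.
  - by move=> v [].
  - exact: z.
  - by case: nsw; have [] := all _ (sS i).
pose T v := exists2 t, S i t & v = (t : R^c) *: w.
have sT : submodule T.
  split; first by exists 0; [case: sSi|rewrite scale0r].
  move=> a _ _ [u Su ->] [v Sv ->]; exists (a *: u + v); first exact: sSi.2.
  by rewrite scalerDl -scalerA.
have sVT := sum_submodule sV sT.
apply: (IH _ sVT) => [v Uv [c [_ [Vc [t St ->] vE]]]|].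
  have t0 : t = 0.
    apply: TW => //; exists v, (- c); split=> //.
      by rewrite -sub0r; apply: subB => //; exact: sub0.
    by rewrite vE addrAC subrr add0r.
  by apply: UV => //; rewrite vE t0 scale0r addr0.
rewrite ltnS in Vn; apply: leq_trans Vn.
apply: ltn_sub2l; last first.
  apply: proper_card; apply/properP; split.
    apply/fintype.subsetP => f; rewrite !inE => Vf.
    by exists (g f), 0; split=> //; [exact: sub0|rewrite addr0].
  have [f fE] := gP ((s i : R^c) *: w); exists f; rewrite inE fE.
    exists 0, ((s i : R^c) *: w); split; [exact: sub0| |by rewrite add0r].
    by exists (s i).
  apply/negP => /asboolP Vf; apply: nsw; exists 0, ((s i : R^c) *: w).
  by split=> //; [exact: sub0|rewrite add0r].
apply: leq_trans (max_card _); apply: proper_card.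
apply/properP; split; first exact/fintype.subsetP.
have [f fE] := gP ((s i : R^c) *: w); exists f; first by rewrite inE.
rewrite inE fE; apply/negP => /asboolP Vf; apply: nsw; exists 0, ((s i : R^c) *: w).
by split=> //; [exact: sub0|rewrite add0r].
Qed.

End Submodules.

(** g inverts f from a complement C of the kernel onto the image, and is 0 on a complement D of the
    image. *)
Lemma linear_regular M N (f : {linear M -> N}) :
  finitely_generated M -> finitely_generated N ->
  exists g : {linear N -> M}, forall v, f (g (f v)) = f v.
Proof.
move=> fgM fgN.
have sK : submodule (fun v => f v = 0).
  by split=> [|a u v fu fv]; rewrite ?linear0 // linearP fu fv scaler0 addr0.
have sI : submodule (fun w => exists v, w = f v).
  split=> [|a _ _ [u ->] [v ->]]; first by exists 0; rewrite linear0.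
  by exists (a *: u + v); rewrite linearP.
have [C [sC KC MC]] := exists_complement fgM sK.
have [D [sD ID ND]] := exists_complement fgN sI.
have ex w : exists c, C c /\ D (w - f c).
  have [_ [d [[v ->] Dd ->]]] := ND w; have [u [c [fu Cc ->]]] := MC v.
  by exists c; rewrite linearD fu add0r addrAC subrr add0r.
have uniq w c c' : C c -> D (w - f c) -> C c' -> D (w - f c') -> c = c'.
  move=> Cc Dc Cc' Dc'; apply/eqP; rewrite -subr_eq0; apply/eqP.
  apply: KC; last exact: subB.
  apply: ID; first by exists (c - c').
  have -> : f (c - c') = (w - f c') - (w - f c).
    by rewrite linearB opprB [RHS]addrC addrA subrK.
  exact: subB.
have [g gP] := choice ex.
have gL : linear g.
  move=> a u v; have [Cu Du] := gP u; have [Cv Dv] := gP v.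
  have [Cuv Duv] := gP (a *: u + v).
  apply: uniq Cuv Duv (sC.2 _ _ _ Cu Cv) _.
  have -> : a *: u + v - f (a *: g u + g v) = a *: (u - f (g u)) + (v - f (g v)).
    by rewrite linearP scalerBr opprD addrACA.
  exact: sD.2.
exists (linear_of gL) => v /=; have [Cv Dv] := gP (f v).
apply/esym/eqP; rewrite -subr_eq0; apply/eqP.
by apply: ID => //; exists (v - g (f v)); rewrite linearB.
Qed.

End SemisimpleModules.

Section FixedModule.
Variables (R : pzRingType) (V : lmodType R) (e : {linear V -> V}).

(** The image of the idempotent e, written as its fixed points to be a subtype. *)
Definition fixmod : Type := {v : V | e v == v}.
HB.instance Definition _ := SubChoice.on fixmod.

Fact fixmod_closed : submod_closed (fun v : V => e v == v).
Proof.
split=> [|a u v]; rewrite !unfold_in ?linear0 // => /eqP eu /eqP ev.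
by rewrite linearP eu ev.
Qed.

HB.instance Definition _ :=
  GRing.SubChoice_isSubLmodule.Build R V (fun v : V => e v == v) fixmod
    fixmod_closed.

Hypothesis ee : forall v, e (e v) = e v.

Definition fix_proj (v : V) : fixmod := exist _ (e v) (introT eqP (ee v)).
Fact fix_proj_linear : linear fix_proj.
Proof. by move=> a u v; apply: val_inj; exact: linearP. Qed.

Lemma fix_projK (v : fixmod) : fix_proj (val v) = v.
Proof. by apply: val_inj; exact/eqP/(valP v). Qed.

Lemma fixmod_fg : finitely_generated V -> finitely_generated fixmod.
Proof.
move=> [n [g gP]]; exists n, (fun i => fix_proj (g i)) => v.
have [a va] := gP (val v); exists a; rewrite -[v in LHS]fix_projK va.
pose p := linear_of fix_proj_linear; rewrite -[LHS]/(p _) linear_sum.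
by apply: eq_bigr => i _; rewrite linearZ.
Qed.

Lemma fixmod_proj : projective_module V -> projective_module fixmod.
Proof.
move=> PV N Q p f sp.
have [g gP] := PV N Q p (f \o linear_of fix_proj_linear : {linear _ -> _}) sp.
exists (g \o (val : {linear fixmod -> V}) : {linear _ -> _}) => v /=.
by rewrite gP /= fix_projK.
Qed.

End FixedModule.

Lemma fgproj_split (R : pzRingType) (V : fgproj_cat R) (e : hom V V) :
  e \oc e = e ->
  exists (Y : fgproj_cat R) (a : hom Y V) (b : hom V Y), b \oc a = idm Y /\ a \oc b = e.
Proof.
move=> eE; pose e' : {linear fgmod V -> fgmod V} := e.
have ee v : e' (e' v) = e' v by exact: (congr1 (fun f : {linear _ -> _} => f v) eE).
exists (FGProj (fixmod_fg ee (fgmodP V)) (fixmod_proj ee (@fgmod_proj _ V))).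
exists (val : {linear fixmod e' -> fgmod V}), (linear_of (fix_proj_linear ee)).
by split; apply: linear_ext => v //; exact: fix_projK.
Qed.

Section QuotientCategory.
Variables (R : finPzRingType) (R_semisimple : semisimple_ring R).
Variables (A : additive_category) (phi : functor A (right_fgproj_cat R)).
Hypothesis phi_surj : essentially_surjective phi.

Definition qhom (x y : acob A) : finZmodType :=
  finzmod (linmap_finite (fgmodP (phi x)) (fgmodP (phi y))).

(** P_R with the objects of A, so that those of the skeleton o represent them all; idempotents split
    here because phi is essentially surjective. *)
Definition quotient_frcat : frcat.
Proof.
pose P := right_fgproj_cat R.
refine (@FRCat (acob A) qhom (fun x => @aid P (phi x))
  (fun x y z g f => @acomp P (phi x) (phi y) (phi z) g f) _ _ _ _ _ _ _).
- by move=> x y f; exact: (@acomp1m P).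
- by move=> x y f; exact: (@acompm1 P).
- by move=> x y z t h g f; exact: (@acompA P).
- by move=> x y z g g' f; exact: (@acompDl P).
- by move=> x y z g f f'; exact: (@acompDr P).
- move=> x e ee; have [Y [a [b [ba ab]]]] := @fgproj_split R^c (phi x) e ee.
  have [y [f [g [gf fg]]]] := phi_surj Y.
  have E1 : (g \oc b) \oc (a \oc f) = idm (phi y).
    by rewrite compA -(compA g) ba compm1 gf.
  have E2 : (a \oc f) \oc (g \oc b) = e.
    by rewrite compA -(compA a) fg compm1 ab.
  by exists y, (a \oc f), (g \oc b).
- move=> x y f; have [g gP] := linear_regular R_semisimple
    (f : {linear fgmod (phi x) -> fgmod (phi y)}) (fgmodP _) (fgmodP _).
  by exists (g : linmap (fgmod (phi y)) (fgmod (phi x))); apply: linear_ext.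
Defined.

End QuotientCategory.

(** * Functors factoring through the quotient *)

Section Corepresentables.
Variables (A B : additive_category) (phi : functor A B).
Hypothesis phi_add : additive_functor phi.
Variables (L : Type) (src : L -> acob B).
Implicit Types x y z : acob A.

Local Notation fm f := (@fmap A B phi _ _ f : @ahom B (phi _) (phi _)).

Lemma fmap_biproduct x y z (i : ahom x z) (j : ahom y z) p q :
  is_biproduct i j p q -> is_biproduct (fm i) (fm j) (fm p) (fm q).
Proof.
have fm0 u v : (fm (0 : @ahom A u v)) = 0.
  apply: (@addrI _ (fm (0 : @ahom A u v))).
  by rewrite -[LHS](phi_add (0 : @ahom A u v) 0) !addr0.
have fC u v w (g : @ahom A v w) (f : @ahom A u v) :
    acomp (fm g) (fm f) = fm (acomp g f) := esym (fmap_comp phi g f).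
have f1 u : fm (aid u) = aid (phi u) := fmap_id phi u.
move=> [pi qj pj qi E]; split; rewrite ?fC ?pi ?qj ?pj ?qi ?f1 ?fm0 //.
by rewrite -[LHS](phi_add (acomp i p) (acomp j q)) E f1.
Qed.

Definition corep_obj x : Type := {l : L & @ahom B (src l) (phi x)}.

Definition corep : afset A.
Proof.
refine (@AFSet A corep_obj (fun x y f u => existT _ (projT1 u) (acomp (fm f) (projT2 u)))
  _ _ L (fun x u => projT1 u) _ _ _).
- by move=> x [l u] /=; rewrite [fmap phi _](fmap_id phi x) [acomp _ _](@acomp1m B).
- move=> x y z g f [l u] /=.
  by rewrite acompA; congr existT; congr acomp; exact: (fmap_comp phi g f).
- by [].
- move=> x y z i j p q /fmap_biproduct[pi qj pj qi _] [l f] [l' g] /= E.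
  case: _ / E g => g.
  exists (existT _ l (acomp (fm i) f + acomp (fm j) g)); rewrite /= !acompDr !acompA.
  by rewrite pi pj qi qj !acomp1m !acomp0l addr0 add0r.
- move=> x y z i j p q /fmap_biproduct[_ _ _ _ E] [l f] [l' g] /= E1 E2.
  have ll := congr1 (@projT1 _ _) E1; rewrite /= in ll; case: _ / ll g E1 E2 => g E1 E2.
  have {}E1 := existT_inj E1; have {}E2 := existT_inj E2.
  suff -> : f = g by [].
  by rewrite -[f]acomp1m -[g]acomp1m -E !acompDl -!acompA E1 E2.
Defined.

End Corepresentables.

Lemma mulrn_card (F : finZmodType) (u : F) : u *+ #|F| = 0.
Proof.
apply: (@addrI _ (\sum_(g : F) g)).
by rewrite addr0 [RHS](reindex_inj (addIr u)) big_split /= sumr_const.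
Qed.

Section FiniteOrder.
Variables (T : zmodType) (T_fin : finite_type T).

Lemma mulrn_finite (t : T) : t *+ #|finzmod T_fin| = 0.
Proof.
exact: (@mulrn_card (finzmod T_fin) t).
Qed.

Lemma card_finzmod_gt0 : (0 < #|finzmod T_fin|)%N.
Proof. by apply/card_gt0P; exists (0 : finzmod T_fin). Qed.

End FiniteOrder.

Lemma nt_inverse (k : fieldType) (C : category) (F G : kfunctor k C)
    (eta : nattrans F G) : (forall x, bijective (eta x)) ->
  exists th : nattrans G F, (forall x v, th x (eta x v) = v) /\
    forall x v, eta x (th x v) = v.
Proof.
move=> be; have ie x : injective (eta x) := bij_inj (be x).
have [||th thP] := @nt_factor k C F G G eta (nt_id G).
- by move=> x u u0; apply: (ie x); rewrite u0 linear0.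
- by move=> x v; have [e ee' e'e] := be x; exists (e v); rewrite e'e.
by exists th; split=> x v; [apply: (ie x)|]; exact: thP.
Qed.

Section SeparabilitySums.
Variables (k : fieldType) (C : frcat) (S : choiceType) (o : S -> C).
Variables (sg : forall s x, rhom (o s) x -> rhom x (o s) -> k) (su : C -> seq S).
Arguments sg : clear implicits.
Hypothesis suU : forall x, uniq (su x).
Hypothesis su0 : forall s x a b, s \notin su x -> sg s x a b = 0.
Hypothesis s1 : forall x h,
  \sum_(s <- su x) \sum_a \sum_b sg s x a b * (a ** b == h)%:R = (h == rid x)%:R.
Hypothesis sN : forall s x y (g : rhom x y) a' b,
  \sum_a sg s x a b * (g ** a == a')%:R = \sum_b' sg s y a' b' * (b' ** g == b)%:R.

Lemma sep_unit (x : C) (M : lmodType k) (b : rhom x x -> M) :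
  \sum_(s <- su x) \sum_a \sum_c sg s x a c *: b (a ** c) = b (rid x).
Proof.
transitivity (\sum_h (\sum_(s <- su x) \sum_a \sum_c sg s x a c * (a ** c == h)%:R) *: b h).
  under [RHS]eq_bigr => h _ do rewrite scaler_suml.
  rewrite [RHS]exchange_big; apply: eq_bigr => s _.
  under [RHS]eq_bigr => h _ do rewrite scaler_suml.
  rewrite [RHS]exchange_big; apply: eq_bigr => a _ /=.
  under [RHS]eq_bigr => h _ do rewrite scaler_suml.
  rewrite [RHS]exchange_big; apply: eq_bigr => c _ /=.
  rewrite (bigD1 (a ** c)) //= eqxx mulr1 big1 ?addr0 // => h /negPf.
  by rewrite eq_sym => ->; rewrite mulr0 scale0r.
rewrite (bigD1 (rid x)) //= s1 eqxx scale1r big1 ?addr0 // => h /negPf h1.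
by rewrite s1 h1 scale0r.
Qed.

Lemma sep_natural (x y : C) (g : rhom x y) (M : lmodType k)
    (b : forall s, rhom (o s) y -> rhom x (o s) -> M) :
  \sum_(s <- su x) \sum_a \sum_c sg s x a c *: b s (g ** a) c =
  \sum_(s <- su y) \sum_a \sum_c sg s y a c *: b s a (c ** g).
Proof.
have ext (u : C) (F : S -> M) (r : seq S) : uniq r ->
    {subset su u <= r} -> (forall s, s \notin su u -> F s = 0) ->
    \sum_(s <- su u) F s = \sum_(s <- r) F s.
  move=> ur ur' F0; rewrite [RHS](bigID (mem (su u))) /= [X in _ + X]big1 ?addr0.
    rewrite -[RHS]big_filter; apply: perm_big; apply: uniq_perm => //.
      exact: filter_uniq.
    move=> s; rewrite mem_filter; case: (boolP (s \in su u)) => //= sx.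
    by rewrite ur'.
  by move=> s; exact: F0.
(* The supports at x and y differ; both sums are extended by 0 to their union and compared block by
   block. *)
pose r := undup (su x ++ su y).
rewrite (ext x _ r) ?undup_uniq //; first last.
- move=> s sx; rewrite big1 // => a _; rewrite big1 // => c _.
  by rewrite su0 // scale0r.
- by move=> s sx; rewrite mem_undup mem_cat sx.
rewrite (ext y _ r) ?undup_uniq //; first last.
- move=> s sx; rewrite big1 // => a _; rewrite big1 // => c _.
  by rewrite su0 // scale0r.
- by move=> s sx; rewrite mem_undup mem_cat sx orbT.
apply: eq_bigr => s _.
transitivity (\sum_a' \sum_c (\sum_a sg s x a c * (g ** a == a')%:R) *: b s a' c).
  under [RHS]eq_bigr => a' _ do under eq_bigr => c _ do rewrite scaler_suml.
  under [RHS]eq_bigr => a' _ do rewrite exchange_big.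
  rewrite [RHS]exchange_big; apply: eq_bigr => a _; rewrite [RHS]exchange_big.
  apply: eq_bigr => c _; rewrite (bigD1 (g ** a)) //= eqxx mulr1 big1 ?addr0 //.
  by move=> h /negPf; rewrite eq_sym => ->; rewrite mulr0 scale0r.
apply: eq_bigr => a' _.
under eq_bigr => c _ do rewrite sN scaler_suml.
rewrite exchange_big; apply: eq_bigr => c' _ /=.
rewrite (bigD1 (c' ** g)) //= eqxx mulr1 big1 ?addr0 // => h /negPf.
by rewrite eq_sym => ->; rewrite mulr0 scale0r.
Qed.

End SeparabilitySums.

(** * Functors through phi as retracts of free functors and of products of exponentials *)

Section Factorisation.
Variables (k : fieldType) (k_char0 : [pchar k] =i pred0).
Variables (R : finPzRingType) (R_semisimple : semisimple_ring R).
Variables (A : additive_category) (phi : functor A (right_fgproj_cat R)).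
Hypothesis phi_quotient : additive_quotient phi.
Variables (S : Type) (o : S -> A).
Hypothesis oP : forall x : A, exists s, isomorphic (o s) x.

Let P := right_fgproj_cat R.
Let phi_add : additive_functor phi. Proof. by case: phi_quotient. Qed.
Let phi_surj : essentially_surjective phi. Proof. by case: phi_quotient. Qed.
Let C := quotient_frcat R_semisimple phi_surj.
Let oC : {classic S} -> C := o.

Let char0 n : (0 < n)%N -> (n%:R : k) != 0.
Proof. by move=> n0; rewrite ((pcharf0P k).1 k_char0) -lt0n. Qed.

Let oCP (x : C) : exists s, riso (oC s) x.
Proof.
have [s [f [g [gf fg]]]] := oP x; exists s, (fmap phi f), (fmap phi g).
split.
  by transitivity (fmap phi (g \oc f)); [rewrite fmap_comp|rewrite gf; exact: (fmap_id phi (o s))].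
by transitivity (fmap phi (f \oc g)); [rewrite fmap_comp|rewrite fg; exact: (fmap_id phi x)].
Qed.

Section Retracts.
Variables (sg : forall s x, rhom (oC s) x -> rhom x (oC s) -> k) (su : C -> seq {classic S}).
Arguments sg : clear implicits.
Hypothesis sep_unit : forall (x : C) (M : lmodType k) (b : rhom x x -> M),
  \sum_(s <- su x) \sum_a \sum_c sg s x a c *: b (a ** c) = b (rid x).
Hypothesis sep_natural : forall (x y : C) (g : rhom x y) (M : lmodType k)
    (b : forall s, rhom (oC s) y -> rhom x (oC s) -> M),
  \sum_(s <- su x) \sum_a \sum_c sg s x a c *: b s (g ** a) c =
  \sum_(s <- su y) \sum_a \sum_c sg s y a c *: b s a (c ** g).

Section SepMap.
Variables (x : C) (U V : lmodType k).
Variable F : forall s, rhom (oC s) x -> rhom x (oC s) -> {linear U -> V}.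

Definition sep_sum (u : U) : V := \sum_(s <- su x) \sum_a \sum_c sg s x a c *: F a c u.

Fact sep_sum_linear : linear sep_sum.
Proof.
move=> z u v; rewrite /sep_sum scaler_sumr -big_split; apply: eq_bigr => s _.
rewrite scaler_sumr -big_split; apply: eq_bigr => a _.
rewrite scaler_sumr -big_split; apply: eq_bigr => c _ /=.
by rewrite linearP scalerDr !scalerA [z * _]mulrC.
Qed.

End SepMap.

Lemma linear_sep_sum (x : C) (M N : lmodType k) (h : {linear M -> N})
    (b : forall s, rhom (oC s) x -> rhom x (oC s) -> M) :
  h (\sum_(s <- su x) \sum_a \sum_c sg s x a c *: b s a c) =
  \sum_(s <- su x) \sum_a \sum_c sg s x a c *: h (b s a c).
Proof.
rewrite linear_sum; apply: eq_bigr => s _; rewrite linear_sum; apply: eq_bigr => a _.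
by rewrite linear_sum; apply: eq_bigr => c _; rewrite linearZ.
Qed.

Section Source.
Variable B1 : kfunctor k P.

Let L := {s : S & B1 (phi (o s))}.
Let src (l : L) : acob P := phi (o (projT1 l)).
Let X := corep phi_add src.

(** r is evaluation, and s sends v to the sum of sg a c times a (x) t (c v). Naturality of s is
    [sep_natural], and r o s = id is [sep_unit]. *)
Lemma source_retract : exists (s : nattrans (precompose B1 phi) (freef k X))
    (r : nattrans (freef k X) (precompose B1 phi)), forall x v, r x (s x v) = v.
Proof.
pose e (x : acob A) (u : X x) : precompose B1 phi x :=
  @kmap k P B1 _ _ (projT2 u) (projT2 (projT1 u)).
have eN (x y : acob A) (f : ahom x y) u :
    e y (smap X f u) = @kmap k A (precompose B1 phi) x y f (e x u).
  exact: (@kmap_comp k P B1).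
pose r := @freef_lift k A X (precompose B1 phi) e eN.
pose fr s : lmodType k := {freeg {classic (B1 (phi (o s)))} / k}.
(* The basis element of w is not linear in w, so a linear section of the evaluation
   k[B1 (phi (o s))] -> B1 (phi (o s)) replaces it. *)
have sec s : exists t : {linear B1 (phi (o s)) -> fr s},
    forall w, flift (fun w : {classic _} => (w : B1 (phi (o s)))) (t w) = w.
  by apply: linear_section => w; exists << (w : {classic _}) >>; exact: fliftU.
pose t s := projT1 (cid (sec s)); have tP s := projT2 (cid (sec s)).
pose ten (x : acob A) s (a : @ahom P (phi (o s)) (phi x)) : {linear fr s -> freef k X x} :=
  flift (fun w : {classic (B1 (phi (o s)))} =>
    << (existT _ (existT _ s w) a : sgen X x) >>).
have tenU x s (a : @ahom P (phi (o s)) (phi x)) w :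
    ten x s a << (w : {classic _}) >> = << (existT _ (existT _ s w) a : sgen X x) >>.
  exact: fliftU.
have tenN (x y : acob A) (f : ahom x y) s a v :
    @kmap k A (freef k X) x y f (ten x s a v) = ten y s (acomp (fmap phi f) a) v.
  apply: (flift_ext2 (f := ten x s a) (g := @kmap k A (freef k X) x y f)
    (f' := ten y s (acomp (fmap phi f) a)) (g' := idfun)) => w.
  by rewrite !tenU freef_mapU.
have rten (x : acob A) s (a : @ahom P (phi (o s)) (phi x)) v :
    r x (ten x s a v) = @kmap k P B1 _ _ a
      (flift (fun w : {classic _} => (w : B1 (phi (o s)))) v).
  apply: (flift_ext2 (f := ten x s a) (g := r x)
    (f' := flift (fun w : {classic _} => (w : B1 (phi (o s)))))
    (g' := @kmap k P B1 _ _ a)) => w.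
  by rewrite tenU freef_liftU fliftU.
pose sF x s (a : rhom (oC s) x) (c : rhom x (oC s)) :
    {linear precompose B1 phi x -> freef k X x} :=
  ten x s a \o (t s \o @kmap k P B1 (phi x) (phi (o s)) c).
have sN : forall (x y : acob A) (f : ahom x y) v,
    sep_sum (@sF y) (@kmap k A (precompose B1 phi) x y f v) =
    @kmap k A (freef k X) x y f (sep_sum (@sF x) v).
  move=> x y f v; rewrite /sep_sum linear_sep_sum.
  pose b s (a : @rhom C (oC s) y) (c : @rhom C x (oC s)) :=
    ten y s a (t s (@kmap k P B1 (phi x) (phi (o s)) c v)).
  transitivity (\sum_(s <- su x) \sum_a \sum_c sg s x a c *:
      b s ((fmap phi f : @rhom C x y) ** a) c); last first.
    do 3!(apply: eq_bigr => ? _); congr (_ *: _); exact: esym (tenN _ _ _ _ _ _).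
  transitivity (\sum_(s <- su y) \sum_a \sum_c sg s y a c *:
      b s a (c ** (fmap phi f : @rhom C x y))); last first.
    exact: esym (@sep_natural x y (fmap phi f) _ b).
  do 3!(apply: eq_bigr => ? _).
  congr (_ *: ten _ _ _ (t _ _)); exact: esym (@kmap_comp k P B1 _ _ _ _ _ _).
exists (@nt_of k A (precompose B1 phi) (freef k X) (fun x => sep_sum (@sF x))
  (fun x => @sep_sum_linear x _ _ (@sF x)) sN), r => x v.
rewrite -[LHS]/(r x (sep_sum (@sF x) v)) /sep_sum linear_sep_sum.
transitivity (\sum_(s <- su x) \sum_a \sum_c sg s x a c *:
  (fun h => @kmap k P B1 (phi x) (phi x) h v) (a ** c)).
  do 3!(apply: eq_bigr => ? _); congr (_ *: _).
  by rewrite rten tP; exact: esym (@kmap_comp k P B1 _ _ _ _ _ _).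
exact: etrans (@sep_unit x _ (fun h => @kmap k P B1 (phi x) (phi x) h v))
  (@kmap_id k P B1 _ v).
Qed.

End Source.
Section Target.
Variable B2 : kfunctor k P.

Let G s := funf phi (phi (o s) : acob P) (B2 (phi (o s))).

(** Dually, s records the images of v under all maps phi x -> phi (o s), and r recovers v from them
    by the separability element. *)
Lemma target_retract : exists (s : nattrans (precompose B2 phi) (prodf G))
    (r : nattrans (prodf G) (precompose B2 phi)), forall x v, r x (s x v) = v.
Proof.
pose h (s : S) (x : acob A) (v : precompose B2 phi x) : G s x :=
  fun g : tgt phi (phi (o s)) x => @kmap k P B2 (phi x) (phi (o s)) g v.
have hL s x : linear (@h s x).
  by move=> z u v; apply/funext => g; exact: linearP.
have hN s : forall (x y : acob A) (f : ahom x y) v,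
    h s y (@kmap k A (precompose B2 phi) x y f v) = @kmap k A (G s) x y f (h s x v).
  by move=> x y f v; apply/funext => g; exact: esym (@kmap_comp k P B2 _ _ _ _ _ _).
pose at_ s x (c : @rhom C x (oC s)) : prodf G x -> B2 (phi (o s)) := fun w => w s c.
have atL s x c : linear (@at_ s x c) by [].
pose F x s (a : @rhom C (oC s) x) (c : @rhom C x (oC s)) :
    {linear prodf G x -> precompose B2 phi x} :=
  @kmap k P B2 (phi (o s)) (phi x) a \o linear_of (@atL s x c).
have rN : forall (x y : acob A) (f : ahom x y) w,
    sep_sum (@F y) (@kmap k A (prodf G) x y f w) =
    @kmap k A (precompose B2 phi) x y f (sep_sum (@F x) w).
  move=> x y f w; rewrite /sep_sum linear_sep_sum.
  pose b s (a : @rhom C (oC s) y) (c : @rhom C x (oC s)) :=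
    @kmap k P B2 (phi (o s)) (phi y) a (w s c).
  transitivity (\sum_(s <- su x) \sum_a \sum_c sg s x a c *:
      b s ((fmap phi f : @rhom C x y) ** a) c); last first.
    do 3!(apply: eq_bigr => ? _); congr (_ *: _); exact: (@kmap_comp k P B2 _ _ _ _ _ _).
  transitivity (\sum_(s <- su y) \sum_a \sum_c sg s y a c *:
      b s a (c ** (fmap phi f : @rhom C x y))); last first.
    exact: esym (@sep_natural x y (fmap phi f) _ b).
  by do 3!(apply: eq_bigr => ? _).
exists (nt_tuple (fun s => @nt_of k A (precompose B2 phi) (G s) (h s) (hL s) (hN s))),
  (@nt_of k A (prodf G) (precompose B2 phi) (fun x => sep_sum (@F x))
    (fun x => @sep_sum_linear x _ _ (@F x)) rN) => x v.
transitivity (\sum_(s <- su x) \sum_a \sum_c sg s x a c *: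
  (fun h => @kmap k P B2 (phi x) (phi x) h v) (a ** c)).
  do 3!(apply: eq_bigr => ? _); congr (_ *: _).
  exact: esym (@kmap_comp k P B2 _ _ _ _ _ _).
exact: etrans (@sep_unit x _ (fun h => @kmap k P B2 (phi x) (phi x) h v))
  (@kmap_id k P B2 _ v).
Qed.

Lemma acyc_target (X : afset A) i : acyc (prodf G) i (freef k X).
Proof.
apply: acyc_prod => s.
have fin := linmap_finite (fgmodP (phi (o s))) (fgmodP (phi (o s))).
apply: (@acyc_freef k A P phi phi_add _ _ #|finzmod fin| _ _ S o oP).
  exact/char0/card_finzmod_gt0.
move=> x a.
have E : (aid (phi (o s)) : @ahom P _ _) *+ #|finzmod fin| = 0 :=
  mulrn_finite fin (@aid P (phi (o s))).
have M (n : nat) : acomp ((aid (phi (o s)) : @ahom P _ _) *+ n) a = a *+ n.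
  by elim: n => [|n IH]; rewrite ?mulr0n ?acomp0l // !mulrS acompDl IH acomp1m.
by rewrite -M E acomp0l.
Qed.

End Target.

Lemma acyc_precompose (B1 B2 : kfunctor k P) i :
  acyc (precompose B2 phi) i (precompose B1 phi).
Proof.
have [s [r rs]] := target_retract B2; apply: (acyc_target_retract rs).
have [s' [r' rs']] := source_retract B1; apply: (acyc_retract oP rs').
exact: acyc_target.
Qed.

End Retracts.

Theorem acyc_factor (A1 A2 : kfunctor k A) i :
  factors_through phi A1 -> factors_through phi A2 -> acyc A2 i A1.
Proof.
move=> [B1 [e1 /nt_inverse[t1 [t1e _]]]] [B2 [e2 /nt_inverse[t2 [t2e _]]]].
apply: (acyc_target_retract t2e); apply: (acyc_retract oP t1e).
have [sg [su [suU su0 s1 sN]]] := separability char0 oCP.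
exact: acyc_precompose (sep_unit s1) (sep_natural suU su0 sN) _ _ _.
Qed.

End Factorisation.

(** * From Ext to Tor *)

Section LinearMapModule.
Variables (k : fieldType) (U V : lmodType k).

Fact linmap_scale_linear (a : k) (f : linmap U V) :
  linear (fun u => a *: (f : {linear U -> V}) u).
Proof. by move=> b u v; rewrite linearP scalerDr !scalerA mulrC. Qed.

Definition linmap_scale (a : k) (f : linmap U V) : linmap U V :=
  linear_of (linmap_scale_linear a f).

Fact linmap_scaleA a b f : linmap_scale a (linmap_scale b f) = linmap_scale (a * b) f.
Proof. by apply: linear_ext => u; exact: scalerA. Qed.
Fact linmap_scale1 : left_id 1 linmap_scale.
Proof. by move=> f; apply: linear_ext => u; exact: scale1r. Qed.
Fact linmap_scaleDr : right_distributive linmap_scale +%R.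
Proof. by move=> a f g; apply: linear_ext => u; exact: scalerDr. Qed.
Fact linmap_scaleDl f : {morph linmap_scale^~ f : a b / a + b}.
Proof. by move=> a b; apply: linear_ext => u; exact: scalerDl. Qed.

HB.instance Definition _ := GRing.Zmodule_isLmodule.Build k (linmap U V)
  linmap_scaleA linmap_scale1 linmap_scaleDr linmap_scaleDl.

End LinearMapModule.

Section Dual.
Variables (k : fieldType) (Q : lmodType k).

Section Functor.
Variables (C : category) (F : kfunctor k (op C)).

Definition homf_map x y (f : @hom C x y) (h : linmap (F x) Q) : linmap (F y) Q :=
  (h : {linear _ -> _}) \o @kmap k (op C) F y x f : {linear _ -> _}.

Fact homf_map_linear x y (f : @hom C x y) : linear (homf_map f).
Proof. by move=> a u v; exact: linear_ext. Qed.

Definition homf : kfunctor k C.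
Proof.
refine (@KFunctor k C (fun x => linmap (F x) Q)
  (fun x y f => linear_of (@homf_map_linear x y f)) _ _).
- move=> x h; apply: linear_ext => u /=.
  by rewrite (@kmap_id k (op C) F x).
- move=> x y z g f h; apply: linear_ext => u /=.
  by rewrite (@kmap_comp k (op C) F z y x f g).
Defined.

End Functor.

Lemma homf_factors (C D : category) (phi : functor C D) (F : kfunctor k (op C)) :
  factors_through (op_functor phi) F -> factors_through phi (homf F).
Proof.
move=> [B [e /nt_inverse[t [te et]]]]; exists (homf B).
pose h (x : C) (f : homf F x) : precompose (homf B) phi x :=
  (f : {linear F x -> Q}) \o t x : {linear B (phi x) -> Q}.
have hL x : linear (@h x) by move=> a u v; exact: linear_ext.
have hN : forall x y (f : hom x y) v,
    h y (kmap (homf F) f v) = kmap (precompose (homf B) phi) f (h x v).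
  move=> x y f v; apply: linear_ext => u /=.
  by congr (_ _); exact: esym (ntr_nat t _ _).
exists (nt_of hL hN) => x.
exists (fun f : homf B (phi x) => (f : {linear B (phi x) -> Q}) \o e x : {linear F x -> Q}) => f.
  by apply: linear_ext => u /=; rewrite te.
by apply: linear_ext => u /=; rewrite et.
Qed.

End Dual.

(* The projection of the chains onto their quotient Q by the boundaries is a
   cocycle with values in x |-> Hom(F x, Q); if it is a coboundary, then it kills
   the cycles. *)
Lemma tor_vanishes_ext (k : fieldType) (C : category) (F : kfunctor k (op C))
    (G : kfunctor k C) i :
  (forall Q : lmodType k, ext_vanishes i.+1 G (homf Q F)) ->
  tor_vanishes i.+1 F G.
Proof.
move=> vanish P T z zc.
have N_sub : submodule (@tor_bound k C F G P T i.+1).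
  split=> [|a u v [u' ->] [v' ->]]; first by exists 0; rewrite linear0.
  by exists (a *: u' + v'); rewrite linearP.
pose Q : lmodType k := quomod N_sub.
pose pi := linear_of (qpi_linear N_sub) : {linear T i.+1 -> Q}.
pose f x (v : res P i.+1 x) : homf Q F x :=
  pi \o linear_of (cow_linl (cend_in (T i.+1)) v) : {linear F x -> Q}.
have fL x : linear (@f x).
  move=> a u v; apply: linear_ext => w /=.
  by rewrite -[RHS](linearP pi) /= cow_linr.
have fN : forall x y (g : hom x y) v,
    f y (kmap (res P i.+1) g v) = kmap (homf Q F) g (f x v).
  by move=> x y g v; apply: linear_ext => w /=; rewrite -cow_nat.
have [|g gP] := vanish Q P (nt_of fL fN).
  move=> x v; apply: linear_ext => u; apply/qpi_eq; rewrite subr0.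
  by exists (cend_in (T i.+2) x u v); rewrite /tor_boundary /coend_map cend_liftE.
pose c0 (x : C) (u : F x) (v : res P i x) : Q := (g x v : {linear F x -> Q}) u.
have cl x v : linear (fun u => @c0 x u v) by move=> a u w; exact: linearP.
have cr x u : linear (@c0 x u) by move=> a v w; rewrite /c0 linearP.
have cn (x y : C) (h : hom x y) u v :
    c0 x (@kmap k (op C) F y x h u) v = c0 y u (kmap (res P i) h v).
  by rewrite /c0 ntr_nat.
have E := @cend_ext k C F _ (T i.+1) Q
  (cend_lift (T i) (Cowedge cl cr cn) \o tor_boundary T i : {linear _ -> _}) pi.
have : qpi N_sub z = qpi N_sub 0.
  rewrite -[LHS]E => [|x u v] /=; first by rewrite zc !linear0.
  rewrite /tor_boundary /coend_map cend_liftE /= cend_liftE /=.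
  exact: esym (congr1 (fun m : homf Q F x => (m : {linear F x -> Q}) u) (gP x v)).
by move/qpi_eq; rewrite subr0.
Qed.

Theorem proposition6
  (k : fieldType) (k_char0 : [pchar k] =i pred0)
  (R : finPzRingType) (R_semisimple : semisimple_ring R)
  (A : additive_category) (A_small : essentially_small A)
  (phi : functor A (right_fgproj_cat R)) (phi_quotient : additive_quotient phi) :
  (forall A1 A2 : kfunctor k A,
     factors_through phi A1 -> factors_through phi A2 ->
     forall i : nat, (0 < i)%N -> ext_vanishes i A1 A2)
  /\
  (forall (A1 : kfunctor k (op A)) (A2 : kfunctor k A),
     factors_through (op_functor phi) A1 -> factors_through phi A2 ->
     forall i : nat, (0 < i)%N -> tor_vanishes i A1 A2).
Proof.
have [S [o oP]] := A_small.
have ext (A1 A2 : kfunctor k A) i : factors_through phi A1 ->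
    factors_through phi A2 -> ext_vanishes i.+1 A1 A2.
  by move=> F1 F2; apply: acyc_ext_vanishes;
    exact: (acyc_factor k_char0 R_semisimple phi_quotient oP).
split=> A1 A2 F1 F2 [//|i] _; first exact: ext.
by apply: tor_vanishes_ext => Q; apply: ext => //; exact: homf_factors.
Qed.
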